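(* Let $\{X_n\}_{n\in\mathbf{Z}}$ be a purely nondeterministic stationary process with MA coefficients $c_n$ and AR coefficients $a_n$. Assume that for some $d\in(0,1/2)$ and some slowly varying function $\ell$ at infinity, $c_n\sim n^{-(1-d)}\ell(n)$ and $a_n\sim n^{-(1+d)}\frac{1}{\ell(n)}\cdot\frac{d\sin(\pi d)}{\pi}$ as $n\to\infty$. Then there exists a constant $M\in(0,\infty)$ such that for all $n\in\mathbf{N}$, $$\sum_{j=1}^{n}|\phi_{n,j}-\phi_j|\le M\sum_{k=n+1}^{\infty}|\phi_k|.$$
   Context: $\mathbf{N}=\{1,2,\ldots\}$. A stationary process $\{X_k:k\in\mathbf{Z}\}$ is a real, zero-mean, weakly stationary process on a probability space $(\Omega,\mathcal{F},P)$, with autocovariance $\gamma(n)=E[X_nX_0]$. $H$ is the closed real linear span of $\{X_k:k\in\mathbf{Z}\}$ in $L^2(\Omega,\mathcal{F},P)$, with inner product $(Y,Z)=E[YZ]$. For an interval $I$, $H_I$ is the closed linear span of $\{X_k:k\in I\cap\mathbf{Z}\}$ and $P_I$ is the orthogonal projection of $H$ onto $H_I$. $\{X_n\}$ is purely nondeterministic (PND) if $\bigcap_{n=-\infty}^{\infty}H_{(-\infty,n]}=\{0\}$; equivalently, it has a positive spectral density $\Delta$ (an even, nonnegative, integrable function on $[-\pi,\pi]$ with $\gamma(n)=\int_{-\pi}^{\pi}e^{in\lambda}\Delta(\lambda)\,d\lambda$) such that $\int_{-\pi}^{\pi}|\log\Delta(\lambda)|\,d\lambda<\infty$. For PND $\{X_n\}$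 define $$h(z)=\sqrt{2\pi}\exp\Big\{\frac{1}{4\pi}\int_{-\pi}^{\pi}\frac{e^{i\lambda}+z}{e^{i\lambda}-z}\log\Delta(\lambda)\,d\lambda\Big\},\qquad |z|<1.$$ The MA coefficients $c_n$ and AR coefficients $a_n$ are the real sequences defined by $h(z)=\sum_{n\ge0}c_nz^n$ and $-1/h(z)=\sum_{n\ge0}a_nz^n$ for $|z|<1$. A slowly varying function at infinity is a positive measurable function $\ell$ on some $[A,\infty)$ with $\lim_{x\to\infty}\ell(\lambda x)/\ell(x)=1$ for all $\lambda>0$. The finite predictor coefficients $\phi_{n,j}$ ($n\in\mathbf{N}$, $1\le j\le n$) are the uniquely determined real numbers with $P_{[-n,-1]}X_0=\sum_{j=1}^{n}\phi_{n,j}X_{-j}$. The infinite predictor coefficients are $\phi_j=c_0a_j$, $j\in\mathbf{N}$; they satisfy $P_{(-\infty,-1]}X_0=\sum_{j=1}^{\infty}\phi_jX_{-j}$. *)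

(* Defs.v *)
From HB Require Import structures.
From mathcomp Require Import all_boot all_order all_algebra.
From mathcomp Require Import all_classical all_reals all_analysis.
From mathcomp Require Import complex.
Set Implicit Arguments.
Unset Strict Implicit.
Unset Printing Implicit Defensive.
Import Order.TTheory GRing.Theory Num.Theory.
Import numFieldNormedType.Exports.
Local Open Scope classical_set_scope.
Local Open Scope ring_scope.
Local Open Scope complex_scope.

Section StationaryProcess.
Context (disp : measure_display) (T : measurableType disp) (R : realType)
  (P : probability T R).
Implicit Types (X : int -> T -> R) (Y Z W : T -> R) (I : interval int).

(* E[YZ] is real-valued when Y and Z are square-integrable. *)
Definition inner Y Z : R := fine 'E_P[Y \* Z].

Definition autocovariance X (n : int) : R := inner (X n) (X 0).

Definition stationary X : Prop :=
  [/\ forall k, X k \in Lfun P 2%:E,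
      forall k, ('E_P[X k] = 0)%E
    & forall n m, inner (X (n + m)) (X m) = autocovariance X n].

(* H_I, as a set of functions (representatives of classes modulo a.e.
   equality) that is closed under a.e. equality. *)
Definition closed_span X I : set (T -> R) :=
  [set Y | Y \in Lfun P 2%:E /\
    forall e : R, 0 < e -> exists (s : seq int) (b : int -> R),
      all (fun k => k \in I) s /\
      ('N[P]_2%:E[EFin \o (fun w => Y w - \sum_(k <- s) b k * X k w)%R] < e%:E)%E].

Definition purely_nondeterministic X : Prop :=
  forall Y, (forall n : int, closed_span X `]-oo, n] Y) ->
    {ae P, forall w, Y w = 0}.

(* W is (a representative of) P_I Y. *)
Definition is_orthogonal_projection X I Y W : Prop :=
  closed_span X I W /\
  forall Z, closed_span X I Z -> inner (Y \- W) Z = 0.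

Definition finite_predictor_coefficients X (phi : nat -> nat -> R) : Prop :=
  forall n : nat, (0 < n)%N ->
    is_orthogonal_projection X `[- n%:Z, - 1%:Z] (X 0)
      (fun w => \sum_(1 <= j < n.+1) phi n j * X (- j%:Z) w).

End StationaryProcess.

Section SpectralDensity.
Context (R : realType).

Definition cexp (z : R[i]) : R[i] :=
  (expR (complex.Re z))%:C * (cos (complex.Im z) +i* sin (complex.Im z)).

Definition circle_integral (f : R -> R[i]) : R[i] :=
  (\int[lebesgue_measure]_(x in `[- pi, pi]) complex.Re (f x)) +i*
  (\int[lebesgue_measure]_(x in `[- pi, pi]) complex.Im (f x)).

Definition spectral_density (gamma : int -> R) (Delta : R -> R) : Prop :=
  [/\ {in `[- pi, pi], forall x, Delta (- x) = Delta x},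
      {in `[- pi, pi], forall x, 0 <= Delta x},
      lebesgue_measure.-integrable `[- pi, pi] (EFin \o Delta)
    & forall n : int, (gamma n)%:C =
        circle_integral (fun x => cexp ('i * (n%:~R * x)%:C) * (Delta x)%:C)].

(* As ln x = 0 for x <= 0, integrability of log Delta is meaningful only
   together with the a.e. positivity of Delta. *)
Definition log_integrable (Delta : R -> R) : Prop :=
  {ae lebesgue_measure, forall x, x \in `[- pi, pi] -> 0 < Delta x} /\
  lebesgue_measure.-integrable `[- pi, pi] (EFin \o (@ln R \o Delta)).

Definition szego (Delta : R -> R) (z : R[i]) : R[i] :=
  (Num.sqrt (2 * pi))%:C *
  cexp (((4 * pi)^-1)%:C *
    circle_integral (fun x => (cexp ('i * x%:C) + z) / (cexp ('i * x%:C) - z) *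
                              (ln (Delta x))%:C)).

Definition power_series_on_disc (u : nat -> R) (f : R[i] -> R[i]) : Prop :=
  forall z : R[i], `|z| < 1 ->
    series (fun n => (u n)%:C * z ^+ n : R[i]^o) @ \oo --> (f z : R[i]^o).

Definition MA_coefficients (Delta : R -> R) (c : nat -> R) : Prop :=
  power_series_on_disc c (szego Delta).

Definition AR_coefficients (Delta : R -> R) (a : nat -> R) : Prop :=
  power_series_on_disc a (fun z => - 1 / szego Delta z).

Definition infinite_predictor_coefficient (c a : nat -> R) (j : nat) : R :=
  c 0%N * a j.

Definition slowly_varying (l : R -> R) : Prop :=
  (exists A : R, (forall x, A <= x -> 0 < l x) /\
     measurable_fun `[A, +oo[ l) /\
  forall lam : R, 0 < lam -> l (lam * x) / l x @[x --> +oo] --> (1 : R).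

End SpectralDensity.

(* Main.v *)
(* By Szego's theorem the autocovariance is gamma(m) = sum_k c_k c_(k+m), and
   h * (-1/h) = -1 makes -a the convolution inverse of c. The normal equations
   say that the prediction error filter u = (1, - phi_n) has a potential
   f = gamma * u vanishing on 1..n. Filtering by -a the values of f beyond n, and
   those before 1 in reverse order, gives sequences q and r which satisfy
     r_k = [k = 0] c_0 + sum_i beta_(n+1+k+i) q_i,
     q_i = sum_k beta_(n+1+i+k) r_k,
   where beta_m = sum_v c_v a_(v+m), and phi_(n,j) - c_0 a_j is an explicit
   combination of q, of r - c_0 [k = 0] and of shifts of a.
   The asymptotics of c and a give |beta_m| <= B / m for large m, with B pi < 1:
   the limit constant is sin(pi d) / pi. As the Hilbert kernel 1 / (x + y) maps
   y^(-1/2) to pi x^(-1/2), the system is a contraction for the weight y^(-1/2),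
   so that q and r - c_0 [k = 0] are O(1 / n). Summing over j and using Karamata's
   estimates for the tails of a yields the inequality. *)
Require Import Defs.
From HB Require Import structures.
From mathcomp Require Import all_boot all_order all_algebra.
From mathcomp Require Import all_classical all_reals all_analysis.
From mathcomp Require Import measurable_realfun complex ring lra zify.
Import Order.TTheory GRing.Theory Num.Theory.
Import numFieldNormedType.Exports.
Set Implicit Arguments.
Unset Strict Implicit.
Unset Printing Implicit Defensive.
Local Open Scope classical_set_scope.
Local Open Scope ring_scope.

(** The bound [B pi < 1] decides everything. The integral of x^(d-1) (x+m)^(-1-d) over x > 0 is 1/(d
    m), so the factor d in the asymptotics of [a] cancels and m beta_m tends to sin(pi d) / pi;
    against the Hilbert kernel this leaves sin(pi d), below 1 since d < 1/2. Two obstacles shape the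
    rest. First, a contraction only improves a bound that is already finite, so q and r need
    weighted bounds beforehand, with constants that may depend on n. As [c] is square summable but
    not summable, these bounds and every exchange of sums need estimates of their own, drawn from
    power bounds with an arbitrarily small loss in the exponents. Second, [c] is defined by h inside
    the disc, whereas the autocovariance is an integral over the circle. Boundary values of h are
    never formed: |h(r e^(ix))|^2 / (2 pi) is the exponential of the Poisson integral of log Delta,
    and its L1 convergence to Delta as r tends to 1 comes from comparing total masses. The slowly
    varying factor enters only through Potter's bounds. *)

Lemma sum_nat_shift (V : nmodType) (F : nat -> V) m N :
  \sum_(m <= k < m + N) F k = \sum_(0 <= k < N) F (m + k)%N.
Proof.
rewrite -{1}[m]add0n big_addn addKn.
by apply: eq_bigr => k _; rewrite addnC.
Qed.

Lemma cvg_sumr (R : realType) (I : Type) (s : seq I) (F : I -> nat -> R)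
    (l : I -> R) : (forall i, F i @ \oo --> l i) ->
  (fun n => \sum_(i <- s) F i n) @ \oo --> \sum_(i <- s) l i.
Proof.
move=> Fl; elim: s => [|i s IHs].
  rewrite big_nil; under eq_fun do rewrite big_nil.
  exact: cvg_cst.
rewrite big_cons; under eq_fun do rewrite big_cons.
by apply: cvgD => //; exact: Fl.
Qed.

(** * Absolutely summable real series and their rearrangement *)

Section AbsolutelySummableSeries.
Context {R : realType}.
Implicit Types (f g : nat -> R) (B : R).

(** A uniform bound on the finite sums, rather than a limit, keeps comparison and rearrangement
    arguments finite. *)
Definition abs_summable f :=
  exists B, forall N, \sum_(0 <= k < N) `|f k| <= B.

Definition rsum f : R := limn (series f).

Lemma abs_summable_cvgn f : abs_summable f -> cvgn (series f).
Proof.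
move=> [B fB]; apply: normed_cvg; apply: nondecreasing_is_cvgn.
  by apply: nondecreasing_series => k _ _; exact: normr_ge0.
by exists B => _ [N _ <-]; exact: fB.
Qed.

Lemma abs_summable_cvg f : abs_summable f -> series f @ \oo --> rsum f.
Proof. move=> sf; exact: abs_summable_cvgn sf. Qed.

Lemma rsum_le f B : (forall N, \sum_(0 <= k < N) `|f k| <= B) ->
  `|rsum f| <= B.
Proof.
move=> fB; have cf : cvgn (series f) by apply: abs_summable_cvgn; exists B.
rewrite /rsum -lim_norm//; apply: limr_le; first exact: is_cvg_norm.
by apply: nearW => N; apply: le_trans (fB N); exact: ler_norm_sum.
Qed.

Lemma abs_summable_le f g B : (forall k, `|f k| <= g k) ->
  (forall N, \sum_(0 <= k < N) g k <= B) -> abs_summable f.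
Proof.
by move=> fg gB; exists B => N; apply: le_trans (gB N); apply: ler_sum.
Qed.

Lemma abs_summable_dom f g : (forall k, `|f k| <= `|g k|) ->
  abs_summable g -> abs_summable f.
Proof. by move=> fg [B gB]; apply: abs_summable_le gB. Qed.

Lemma abs_summable_norm f : abs_summable f -> abs_summable (fun k => `|f k|).
Proof. by apply: abs_summable_dom => k; rewrite normr_id. Qed.

Lemma abs_summableZ a f : abs_summable f -> abs_summable (fun k => a * f k).
Proof.
move=> [B fB]; exists (`|a| * B) => N.
under eq_bigr do rewrite normrM.
by rewrite -mulr_sumr ler_wpM2l.
Qed.

Lemma abs_summableD f g : abs_summable f -> abs_summable g ->
  abs_summable (fun k => f k + g k).
Proof.
move=> [A fA] [B gB]; apply: (@abs_summable_le _ (fun k => `|f k| + `|g k|) (A + B)).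
  by move=> k; exact: ler_normD.
by move=> N; rewrite big_split/= lerD.
Qed.

Lemma abs_summable_shift f m : abs_summable f ->
  abs_summable (fun k => f (m + k)%N).
Proof.
move=> [B fB]; exists B => N; apply: le_trans (fB (m + N)%N).
rewrite (@big_cat_nat _ _ _ m 0 (m + N))//= ?leq_addr//.
by rewrite (sum_nat_shift _ m N) lerDr sumr_ge0.
Qed.

Lemma rsumE f l : series f @ \oo --> l -> rsum f = l.
Proof. exact: cvg_lim. Qed.

Lemma eq_rsum f g : f =1 g -> rsum f = rsum g.
Proof. by move=> /funext ->. Qed.

Lemma rsumD f g : abs_summable f -> abs_summable g ->
  rsum (fun k => f k + g k) = rsum f + rsum g.
Proof.
move=> /abs_summable_cvg sf /abs_summable_cvg sg; apply: rsumE.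
rewrite [X in X @ _ --> _](_ : _ = series f \+ series g); first exact: cvgD.
by apply/funext => N; rewrite /series/= big_split.
Qed.

Lemma rsumZ a f : abs_summable f -> rsum (fun k => a * f k) = a * rsum f.
Proof.
move=> /abs_summable_cvg sf; apply: rsumE.
rewrite [X in X @ _ --> _](_ : _ = fun N => a * series f N); first exact: cvgMr.
by apply/funext => N; rewrite /series/= mulr_sumr.
Qed.

Lemma rsumZr a f : abs_summable f -> rsum (fun k => f k * a) = rsum f * a.
Proof.
by move=> sf; rewrite mulrC -rsumZ//; apply: eq_rsum => k; rewrite mulrC.
Qed.

Lemma rsumN f : abs_summable f -> rsum (fun k => - f k) = - rsum f.
Proof.
by move=> sf; rewrite -mulN1r -rsumZ//; apply: eq_rsum => k; rewrite mulN1r.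
Qed.

Lemma rsum0 : rsum (fun=> 0) = 0.
Proof.
apply: rsumE; rewrite [X in X @ _ --> _](_ : _ = fun=> 0); first exact: cvg_cst.
by apply/funext => N; rewrite /series/= big1.
Qed.

Lemma abs_summable_sum (I : Type) (s : seq I) (F : I -> nat -> R) :
  (forall i, abs_summable (F i)) ->
  abs_summable (fun k => \sum_(i <- s) F i k).
Proof.
move=> sF; elim: s => [|i s IHs].
  by exists 0 => N; rewrite big1// => k _; rewrite big_nil normr0.
apply: (@abs_summable_dom _ (fun k => F i k + \sum_(i <- s) F i k)).
  by move=> k; rewrite big_cons.
exact: abs_summableD.
Qed.

Lemma rsum_sum (I : Type) (s : seq I) (F : I -> nat -> R) :
  (forall i, abs_summable (F i)) ->
  rsum (fun k => \sum_(i <- s) F i k) = \sum_(i <- s) rsum (F i).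
Proof.
move=> sF; elim: s => [|i s IHs].
  rewrite big_nil -[RHS]rsum0; apply: eq_rsum => k; by rewrite big_nil.
rewrite big_cons -IHs -rsumD//; last exact: abs_summable_sum.
by apply: eq_rsum => k; rewrite big_cons.
Qed.

Lemma rsum_shift f m : abs_summable f ->
  rsum f = \sum_(0 <= k < m) f k + rsum (fun k => f (m + k)%N).
Proof.
move=> sf; apply: rsumE.
have /abs_summable_cvg sg := abs_summable_shift m sf.
rewrite -(cvg_shiftn m).
rewrite [X in X @ _ --> _](_ : _ =
  fun N => \sum_(0 <= k < m) f k + series (fun k => f (m + k)%N) N).
  by apply: cvgD => //; exact: cvg_cst.
apply/funext => N /=; rewrite /series/= addnC.
by rewrite (@big_cat_nat _ _ _ m 0 (m + N))//= ?leq_addr// (sum_nat_shift _ m N).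
Qed.

Lemma rsum_finsupp f m : (forall k, (m <= k)%N -> f k = 0) ->
  rsum f = \sum_(0 <= k < m) f k.
Proof.
move=> f0; apply: rsumE; rewrite -(cvg_shiftn m).
rewrite [X in X @ _ --> _](_ : _ = fun=> \sum_(0 <= k < m) f k).
  exact: cvg_cst.
apply/funext => N /=; rewrite /series/=.
rewrite (@big_cat_nat _ _ _ m 0 (N + m))//= ?leq_addl//.
by rewrite [X in _ + X]big_nat_cond [X in _ + X]big1 ?addr0// => k /andP[/andP[mk _] _]; exact: f0.
Qed.

Lemma series_le_rsum f N : (forall k, 0 <= f k) -> abs_summable f ->
  \sum_(0 <= k < N) f k <= rsum f.
Proof.
move=> f0 /abs_summable_cvgn cf; apply: (nondecreasing_cvgn_le _ cf).
by apply: nondecreasing_series => k _ _; exact: f0.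
Qed.

Lemma rsum_ge0 f : (forall k, 0 <= f k) -> abs_summable f -> 0 <= rsum f.
Proof. by move=> f0 /(series_le_rsum 0 f0); rewrite big_nil. Qed.

Lemma rsum_ub f B : (forall k, 0 <= f k) ->
  (forall N, \sum_(0 <= k < N) f k <= B) -> rsum f <= B.
Proof.
move=> f0 fB; apply: le_trans (ler_norm _) _; apply: rsum_le => N.
by under eq_bigr do rewrite ger0_norm//.
Qed.

Lemma ler_rsum f g : abs_summable f -> abs_summable g ->
  (forall k, f k <= g k) -> rsum f <= rsum g.
Proof. by move=> /abs_summable_cvgn cf /abs_summable_cvgn cg fg; exact: lim_series_le. Qed.

Lemma ler_norm_rsum f : abs_summable f -> `|rsum f| <= rsum (fun k => `|f k|).
Proof.
move=> sf; apply: rsum_le => N; apply: series_le_rsum => //.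
exact: abs_summable_norm.
Qed.

Lemma rsum_norm_shift_le f m : abs_summable f ->
  rsum (fun k => `|f (m + k)%N|) <= rsum (fun k => `|f k|).
Proof.
move=> sf; rewrite [leRHS](@rsum_shift _ m); last exact: abs_summable_norm.
by rewrite lerDr sumr_ge0.
Qed.

End AbsolutelySummableSeries.

Section AntidiagonalSummation.
Context {R : realType}.

Lemma sum_antidiag (G : nat -> nat -> R) N :
  \sum_(0 <= s < N) \sum_(0 <= i < s.+1) G i (s - i)%N =
  \sum_(0 <= i < N) \sum_(0 <= j < N - i) G i j.
Proof.
elim: N => [|N IHN]; first by rewrite !big_nil.
rewrite big_nat_recr//= IHN [RHS]big_nat_recr//= subSnn big_nat1.
rewrite [X in _ + X = _]big_nat_recr//= subnn addrA; congr (_ + _).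
rewrite -big_split/=; apply: eq_big_nat => i /andP[_ iN].
by rewrite subSn ?(ltnW iN)// big_nat_recr.
Qed.

(* The absolute total over the triangle i + j < N converges, and it controls the
   gap between the partial row sums and the partial antidiagonal sums. *)
Lemma rsum_antidiag (F : nat -> nat -> R) (B : R) :
  (forall N, \sum_(0 <= i < N) \sum_(0 <= j < N) `|F i j| <= B) ->
  rsum (fun i => rsum (F i)) =
  rsum (fun s => \sum_(0 <= i < s.+1) F i (s - i)%N).
Proof.
move=> FB.
have sqB N M : \sum_(0 <= i < N) \sum_(0 <= j < M) `|F i j| <= B.
  apply: le_trans (FB (maxn N M)).
  rewrite [leRHS](@big_cat_nat _ _ _ N)//= ?leq_maxl// -[leLHS]addr0 lerD//.
    apply: ler_sum => i _.
    rewrite [leRHS](@big_cat_nat _ _ _ M)//= ?leq_maxr// lerDl.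
    by rewrite sumr_ge0.
  by rewrite sumr_ge0// => i _; rewrite sumr_ge0.
have rowB i : abs_summable (F i).
  exists B => M; apply: le_trans (sqB i.+1 M).
  by rewrite [leRHS]big_nat_recr//= lerDr sumr_ge0// => k _; rewrite sumr_ge0.
have rowsB : abs_summable (fun i => rsum (F i)).
  exists B => N.
  have cl : (fun M => \sum_(0 <= i < N) \sum_(0 <= j < M) `|F i j|) @ \oo -->
      \sum_(0 <= i < N) rsum (fun j => `|F i j|).
    apply: cvg_sumr => i.
    exact: (abs_summable_cvg (abs_summable_norm (rowB i))).
  apply: (@le_trans _ _ (\sum_(0 <= i < N) rsum (fun j => `|F i j|))).
    by apply: ler_sum => i _; exact: ler_norm_rsum.
  rewrite -(cvg_lim _ cl)//; apply: limr_le; first by apply: cvgP cl.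
  by apply: nearW => M; exact: sqB.
pose D N := \sum_(0 <= s < N) \sum_(0 <= i < s.+1) `|F i (s - i)%N|.
have DE N : D N = \sum_(0 <= i < N) \sum_(0 <= j < N - i) `|F i j|.
  by rewrite /D (sum_antidiag (fun i j => `|F i j|)).
have Dnd : nondecreasing_seq D.
  by apply: nondecreasing_series => s _ _; rewrite sumr_ge0.
have DB N : D N <= B.
  rewrite DE; apply: le_trans (sqB N N); apply: ler_sum => i _.
  rewrite [leRHS](@big_cat_nat _ _ _ (N - i))//= ?leq_subr// lerDl.
  by rewrite sumr_ge0.
have cD : cvgn D by apply: nondecreasing_is_cvgn => //; exists B => _ [N _ <-].
pose A N := \sum_(0 <= s < N) \sum_(0 <= i < s.+1) F i (s - i)%N.
have AE N : A N = \sum_(0 <= i < N) \sum_(0 <= j < N - i) F i j.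
  by rewrite /A (sum_antidiag F).
(* For [i < N], the indices [N - i <= j < M] lie outside the triangle of size [N] and inside the one
   of size [N + M], so their absolute total is at most [D (N + M) - D N]. *)
have gap N M : (N <= M)%N ->
    `|\sum_(0 <= i < N) \sum_(0 <= j < M) F i j - A N| <= limn D - D N.
  move=> NM; rewrite AE -sumrB.
  apply: (@le_trans _ _
    (\sum_(0 <= i < N) \sum_(N - i <= j < M) `|F i j|)).
    apply: le_trans (ler_norm_sum _ _ _) _; apply: ler_sum => i _.
    rewrite (@big_cat_nat _ _ _ (N - i) 0 M)//=; last first.
      by rewrite (leq_trans (leq_subr _ _)).
    rewrite addrAC subrr add0r; exact: ler_norm_sum.
  rewrite lerBrDr.
  apply: le_trans (nondecreasing_cvgn_le Dnd cD (N + M)%N).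
  rewrite !DE -big_split/=.
  rewrite [leRHS](@big_cat_nat _ _ _ N 0 (N + M))//= ?leq_addr//.
  rewrite -[leLHS]addr0; apply: lerD; last first.
    by rewrite sumr_ge0// => i _; rewrite sumr_ge0.
  rewrite big_nat [leRHS]big_nat; apply: ler_sum => i /andP[_ iN].
  rewrite addrC -big_cat_nat//=; last by rewrite (leq_trans (leq_subr _ _)).
  rewrite [leRHS](@big_cat_nat _ _ _ M)//=; last first.
    by rewrite addnC -addnBA ?leq_addr// ltnW.
  by rewrite lerDl sumr_ge0.
have gapN N : `|\sum_(0 <= i < N) rsum (F i) - A N| <= limn D - D N.
  have cl : (fun M => `|\sum_(0 <= i < N) \sum_(0 <= j < M) F i j - A N|) @ \oo
      --> `|\sum_(0 <= i < N) rsum (F i) - A N|.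
    apply: cvg_norm; apply: cvgB; last exact: cvg_cst.
    by apply: cvg_sumr => i; exact: abs_summable_cvg (rowB i).
  rewrite -(cvg_lim _ cl)//; apply: limr_le; first by apply: cvgP cl.
  by near=> M; apply: gap; near: M; exact: nbhs_infty_ge.
symmetry; apply: rsumE.
have c1 : (fun N => \sum_(0 <= i < N) rsum (F i)) @ \oo --> rsum (fun i => rsum (F i)).
  exact: abs_summable_cvg.
have c2 : (fun N => \sum_(0 <= i < N) rsum (F i) - A N) @ \oo --> (0 : R).
  apply: norm_cvg0.
  have cg : (fun N => limn D - D N) @ \oo --> (0 : R).
    by rewrite -[X in _ --> X](subrr (limn D)); exact: (cvgB (cvg_cst _) cD).
  apply: (squeeze_cvgr _ (cvg_cst 0) cg).
  by near=> N; rewrite normr_ge0 gapN.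
rewrite -[X in _ --> X]subr0 [X in X @ _ --> _](_ : _ =
  (fun N => \sum_(0 <= i < N) rsum (F i)) \-
  (fun N => \sum_(0 <= i < N) rsum (F i) - A N)); first exact: cvgB c1 c2.
by apply/funext => N /=; rewrite opprB addrCA subrr addr0.
Unshelve. all: by end_near. Qed.

End AntidiagonalSummation.

(** * Inequalities for real powers and sums of power weights *)

Section RealPowers.
Context {R : realType}.
Implicit Types (a b p s t x y : R).

Lemma powR_expR a p : 0 < a -> a `^ p = expR (p * ln a).
Proof. by move=> a0; rewrite /powR gt_eqF. Qed.

Lemma powR_ge1Dln t p : 0 < t -> 1 + p * ln t <= t `^ p.
Proof. by move=> t0; rewrite powR_expR// expR_ge1Dx. Qed.

Lemma powRDp a p s : 0 < a -> a `^ (p + s) = a `^ p * a `^ s.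
Proof. by move=> a0; rewrite powRD// (gt_eqF a0) implybT. Qed.

Lemma powRVl a p : 0 < a -> (a^-1) `^ p = a `^ (- p).
Proof. by move=> a0; rewrite !powR_expR ?invr_gt0// lnV// mulrN mulNr. Qed.

Lemma ln_ge1BV t : 0 < t -> 1 - t^-1 <= ln t.
Proof.
move=> t0; have := @powR_ge1Dln t^-1 1; rewrite invr_gt0 => /(_ t0).
by rewrite powRr1 ?invr_ge0 ?(ltW t0)// lnV//; lra.
Qed.

(** The convex function x^(-s) lies above its tangent at [b]. Dividing by b^(-s) leaves (b/a)^s >= 1
    + s ln(b/a) together with ln t >= 1 - 1/t. *)
Lemma powRN_sub_ge a b s : 0 < a -> 0 < b -> 0 <= s ->
  s * b `^ (- s - 1) * (b - a) <= a `^ (- s) - b `^ (- s).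
Proof.
move=> a0 b0 s0; have ba0 : 0 < b / a by rewrite divr_gt0.
have -> : a `^ (- s) = b `^ (- s) * (b / a) `^ s.
  rewrite powRM ?invr_ge0 ?(ltW a0) ?(ltW b0)// powRVl// mulrA -powRDp//.
  by rewrite addNr powRr0 mul1r.
have -> : b `^ (- s - 1) = b `^ (- s) * b^-1.
  by rewrite powRDp// powR_inv1// ltW.
have -> : s * (b `^ (- s) / b) * (b - a) = b `^ (- s) * (s * (1 - (b / a)^-1)).
  by field; rewrite !gt_eqF.
rewrite -{3}[b `^ (- s)]mulr1 -mulrBr ler_wpM2l ?powR_ge0//.
rewrite lerBrDl (le_trans _ (powR_ge1Dln s ba0))// lerD2l.
by rewrite ler_wpM2l// ln_ge1BV.
Qed.

(* Weighted AM-GM, in the form of a tangent line to the concave function a^D. *)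
Lemma powR_le_tangent a b (D : R) : 0 <= a -> 0 < b -> 0 < D -> D <= 1 ->
  a `^ D <= b `^ D + D * b `^ (D - 1) * (a - b).
Proof.
move=> a0 b0 D0 D1; have bD : b `^ D = b `^ (D - 1) * b.
  by rewrite powRDp// powR_inv1 ?(ltW b0)// divfK// gt_eqF.
have -> : b `^ D + D * b `^ (D - 1) * (a - b) = b `^ D * (D * (a / b) + (1 - D)).
  by rewrite bD; field; rewrite gt_eqF.
move: a0; rewrite le_eqVlt => /predU1P[<-|a0].
  by rewrite powR0 ?gt_eqF// mulr_ge0 ?powR_ge0//; lra.
have t0 : 0 < a / b by rewrite divr_gt0.
have -> : a `^ D = b `^ D * (a / b) `^ D.
  by rewrite -powRM ?(ltW b0) ?(ltW t0)// mulrC divfK ?gt_eqF.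
rewrite ler_wpM2l ?powR_ge0//; move: (a / b) t0 => t t0.
have tE : t = t `^ D * t `^ (1 - D).
  by rewrite -powRDp// addrC subrK powRr1// ltW.
have oneE : 1 = t `^ D * t `^ (- D) by rewrite -powRDp// subrr powRr0.
(* Weighted by [D] and [1 - D], the two lower bounds add up to 1: their logarithmic terms are
   opposite. *)
have h1 := powR_ge1Dln (1 - D) t0; have h2 := powR_ge1Dln (- D) t0.
have -> : D * t + (1 - D) = t `^ D * (D * t `^ (1 - D) + (1 - D) * t `^ (- D)).
  by rewrite mulrDr mulrCA -tE mulrCA -oneE mulr1.
rewrite ler_peMr ?powR_ge0//.
apply: (@le_trans _ _ (D * (1 + (1 - D) * ln t) + (1 - D) * (1 + - D * ln t))).
  by rewrite le_eqVlt; apply/orP; left; apply/eqP; ring.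
by apply: lerD; apply: ler_wpM2l => //; lra.
Qed.

Lemma atan_sub_ge x y : 0 <= x -> x <= y ->
  (y - x) / (1 + y ^+ 2) <= atan y - atan x.
Proof.
move=> x0; rewrite le_eqVlt => /predU1P[->|xy]; first by rewrite !subrr mul0r.
have [c cxy ->] : exists2 c, c \in `]x, y[ &
    atan y - atan x = (1 + c ^+ 2)^-1 * (y - x).
  apply: MVT => //.
  by apply: continuous_subspaceT => z; exact: continuous_atan.
move: cxy; rewrite in_itv/= => /andP[xc cy].
have c0 : 0 <= c by rewrite (le_trans x0) ?ltW.
rewrite mulrC ler_wpM2r ?subr_ge0 ?(ltW xy)// lef_pV2 ?posrE; last 2 first.
- by rewrite ltr_pwDl ?sqr_ge0.
- by rewrite ltr_pwDl ?sqr_ge0.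
have y0 : 0 <= y by lra.
by rewrite lerD2l lerXn2r ?nnegrE// ltW.
Qed.

Lemma sqrt_sub_ge x y : 0 <= x -> x <= y ->
  (y - x) / (2 * Num.sqrt y) <= Num.sqrt y - Num.sqrt x.
Proof.
move=> x0 xy; have [y0|y0] := eqVneq y 0.
  have -> : x = 0 by lra.
  by rewrite y0 sqrtr0 mulr0 invr0 mulr0 subrr.
have yp : 0 < y by lra.
have sy : 0 < Num.sqrt y by rewrite sqrtr_gt0.
have sx : 0 <= Num.sqrt x by rewrite sqrtr_ge0.
rewrite ler_pdivrMr ?mulr_gt0//.
rewrite -{1}(sqr_sqrtr x0) -{1}(sqr_sqrtr (ltW yp)).
have : 0 <= (Num.sqrt y - Num.sqrt x) ^+ 2 by rewrite sqr_ge0.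
by nra.
Qed.

(* Discrete form of int_0^oo y^(-1/2) / (x + y) dy = pi x^(-1/2). *)
Lemma sqrt_kernel_le x y N : 0 < x -> 0 < y ->
  \sum_(0 <= k < N) (Num.sqrt (y + k.+1%:R))^-1 / (x + (y + k.+1%:R))
    <= pi / Num.sqrt x.
Proof.
move=> x0 y0.
(* An antiderivative of t^(-1/2) / (x + t) is (2 / sqrt x) atan(sqrt(t / x)). The integrand
   decreases, so each term is at most the increment over the unit interval to its left; this is
   obtained from the square root and the arctangent separately. *)
pose g k : R := Num.sqrt (y + k%:R) / Num.sqrt x.
have yk k : 0 < y + k%:R by rewrite ltr_pwDl.
have sx : 0 < Num.sqrt x by rewrite sqrtr_gt0.
apply: (@le_trans _ _
    (2 / Num.sqrt x * \sum_(0 <= k < N) (atan (g k.+1) - atan (g k)))).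
  rewrite mulr_sumr; apply: ler_sum => k _.
  have gk : 0 <= g k by rewrite divr_ge0 ?sqrtr_ge0.
  have le1 : y + k%:R <= y + k.+1%:R by rewrite lerD2l ler_nat.
  have gk1 : g k <= g k.+1 by rewrite ler_wpM2r ?invr_ge0 ?(ltW sx)// ler_wsqrtr.
  have h1 := sqrt_sub_ge (ltW (yk k)) le1.
  have dk : y + k.+1%:R - (y + k%:R) = 1 by rewrite -natr1; ring.
  rewrite dk in h1.
  have h2 := atan_sub_ge gk gk1.
  set s := Num.sqrt (y + k.+1%:R) in h1 *.
  have s0 : 0 < s by rewrite sqrtr_gt0.
  have s2 : s ^+ 2 = y + k.+1%:R by rewrite sqr_sqrtr// ltW.
  rewrite -s2.
  apply: (@le_trans _ _ (2 / Num.sqrt x * ((g k.+1 - g k) / (1 + g k.+1 ^+ 2)))).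
    rewrite /g -/s -mulrBl exprMn exprVn (sqr_sqrtr (ltW x0)).
    have -> : 2 / Num.sqrt x * ((s - Num.sqrt (y + k%:R)) / Num.sqrt x / (1 + s ^+ 2 / x)) =
       2 * (s - Num.sqrt (y + k%:R)) / (x + s ^+ 2).
      have -> : 2 / Num.sqrt x * ((s - Num.sqrt (y + k%:R)) / Num.sqrt x / (1 + s ^+ 2 / x))
        = 2 * (s - Num.sqrt (y + k%:R)) / (Num.sqrt x ^+ 2 * (1 + s ^+ 2 / x)).
        by rewrite expr2 !invfM; ring.
      rewrite sqr_sqrtr ?(ltW x0)//; congr (_ / _).
      by field; rewrite gt_eqF.
    apply: ler_wpM2r; first by rewrite invr_ge0 addr_ge0 ?sqr_ge0 ?(ltW x0).
    by move: h1; rewrite mul1r invfM; lra.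
  by rewrite ler_wpM2l// divr_ge0// ltW.
rewrite telescope_sumr//.
rewrite mulrAC ler_wpM2r ?invr_ge0 ?(ltW sx)//.
have := atan_ltpi2 (g N); have : 0 <= atan (g 0%N).
  by rewrite -atan0 le_atan// divr_ge0 ?sqrtr_ge0.
by lra.
Qed.

End RealPowers.

Section PowerSequences.
Context {R : realType}.
Implicit Types (s t : R) (i j k m N : nat).

(** The base [k.+1] makes the weight positive at index 0, so that one inequality covers a whole
    sequence. *)
Definition pw s k : R := (k.+1%:R : R) `^ (- s).

Lemma pw_gt0 s k : 0 < pw s k.
Proof. by rewrite powR_gt0. Qed.

Lemma pw_ge0 s k : 0 <= pw s k.
Proof. exact: ltW (pw_gt0 s k). Qed.

Lemma pwD s t k : pw (s + t) k = pw s k * pw t k.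
Proof. by rewrite /pw opprD powRDp. Qed.

Lemma pw_le s j k : 0 <= s -> (j <= k)%N -> pw s k <= pw s j.
Proof.
move=> s0 jk; rewrite /pw !powRN lef_pV2 ?posrE ?powR_gt0//.
by rewrite ge0_ler_powR ?nnegrE// ler_nat.
Qed.

Lemma pw_le1 s k : 0 <= s -> pw s k <= 1.
Proof. by move=> s0; rewrite (le_trans (pw_le s0 (leq0n k)))// /pw powR1. Qed.

(** Separates a joint index: shares of one exponent are dealt out to [i] and [j], and a double sum
    becomes a product of sums. *)
Lemma pw_add_le s t i j : 0 <= s -> 0 <= t ->
  pw (s + t) (i + j) <= pw s i * pw t j.
Proof.
by move=> s0 t0; rewrite pwD ler_pM ?pw_ge0 ?pw_le ?leq_addr ?leq_addl.
Qed.

Lemma pw_split_le s t i j : 0 <= s -> s <= t ->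
  pw t (i + j) <= pw s i * pw (t - s) j.
Proof. by move=> s0 st; rewrite -{1}(subrKC s t) pw_add_le// subr_ge0. Qed.

Lemma pw_half k : pw (1 / 2) k = (Num.sqrt k.+1%:R)^-1.
Proof. by rewrite /pw powRN div1r powR12_sqrt. Qed.

Lemma pw_sub_ge s k : 0 <= s -> s * pw (s + 1) k.+1 <= pw s k - pw s k.+1.
Proof.
move=> s0; have := @powRN_sub_ge _ k.+1%:R k.+2%:R s.
rewrite !ltr0n => /(_ isT isT s0).
by rewrite -opprD -natrB// subSnn mulr1.
Qed.

Lemma sum_pw_tail s m N : 0 < s ->
  \sum_(m.+1 <= k < N) pw (s + 1) k <= pw s m / s.
Proof.
move=> s0; have [Nm|mN] := leqP N m.+1.
  by rewrite big_geq// divr_ge0 ?pw_ge0 ?ltW.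
rewrite ler_pdivlMr// mulrC mulr_sumr.
case: N mN => // N mN.
rewrite big_add1/=.
apply: (@le_trans _ _ (\sum_(m <= k < N) (pw s k - pw s k.+1))).
  by apply: ler_sum => k _; rewrite pw_sub_ge// ltW.
have -> : \sum_(m <= k < N) (pw s k - pw s k.+1) =
    - \sum_(m <= k < N) (pw s k.+1 - pw s k).
  by rewrite -sumrN; apply: eq_bigr => k _; rewrite opprB.
rewrite telescope_sumr; last exact: ltnW.
by rewrite opprB gerBl pw_ge0.
Qed.

Lemma sum_pw_le s N : 0 < s -> \sum_(0 <= k < N) pw (s + 1) k <= 1 + s^-1.
Proof.
move=> s0; case: N => [|N]; first by rewrite big_geq// addr_ge0// invr_ge0 ltW.
rewrite big_ltn// lerD ?pw_le1 ?addr_ge0 ?(ltW s0)//.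
by rewrite (le_trans (sum_pw_tail 0 N.+1 s0))// ler_piMl ?invr_ge0 ?pw_le1 ?ltW.
Qed.

(** Telescoping: k^(1-s) is concave, so its increments dominate [(1 - s) * pw s k]. *)
Lemma sum_pw_low s N : 0 <= s -> s < 1 ->
  \sum_(0 <= k < N) pw s k <= N%:R `^ (1 - s) / (1 - s).
Proof.
move=> s0 s1; have D0 : 0 < 1 - s by lra.
rewrite ler_pdivlMr// mulrC mulr_sumr.
apply: (@le_trans _ _
    (\sum_(0 <= k < N) (k.+1%:R `^ (1 - s) - k%:R `^ (1 - s)))).
  apply: ler_sum => k _.
  have := @powR_le_tangent _ k%:R k.+1%:R (1 - s) (ler0n _ _) (ltr0Sn _ _) D0.
  have -> : 1 - s - 1 = - s by lra.
  have -> : k%:R - k.+1%:R = -1 :> R by rewrite -natr1; ring.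
  rewrite -/(pw s k) => /(_ _); lra.
by rewrite telescope_sumr// powR0 ?subr0// gt_eqF.
Qed.

Lemma abs_summable_pw (f : nat -> R) (B s : R) : 0 < s ->
  (forall k, `|f k| <= B * pw (s + 1) k) -> abs_summable f.
Proof.
move=> s0 fB; have B0 : 0 <= B.
  by rewrite -(pmulr_lge0 _ (pw_gt0 (s + 1) 0)) (le_trans _ (fB 0%N)).
apply: (@abs_summable_le _ _ _ (B * (1 + s^-1)) fB) => N.
by rewrite -mulr_sumr ler_wpM2l// sum_pw_le.
Qed.

End PowerSequences.

(** * The coupled system of a finite window *)

Section CausalInverse.
Context {R : realType}.
Variables c a : nat -> R.
Hypothesis conv_ac :
  forall m, \sum_(0 <= i < m.+1) a i * c (m - i)%N = - (m == 0%N)%:R.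

Lemma conv_ca m : \sum_(0 <= i < m.+1) c i * a (m - i)%N = - (m == 0%N)%:R.
Proof.
rewrite -conv_ac big_nat_rev/= add0n [LHS]big_nat [RHS]big_nat.
by apply: eq_bigr => i /andP[_ im]; rewrite subSS subKn// mulrC.
Qed.

(** Convolution with [- a]. On one-sided sequences it inverts convolution with [c], because [a * c]
    is minus the unit impulse. *)
Definition deconv (g : nat -> R) (k : nat) : R :=
  - \sum_(0 <= j < k.+1) a j * g (k - j)%N.

Lemma conv_comp (x y g : nat -> R) k :
  \sum_(0 <= j < k.+1) x j * \sum_(0 <= i < (k - j).+1) y i * g (k - j - i)%N =
  \sum_(0 <= s < k.+1) (\sum_(0 <= j < s.+1) x j * y (s - j)%N) * g (k - s)%N.
Proof.
transitivity (\sum_(0 <= j < k.+1) \sum_(0 <= i < k.+1 - j)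
    x j * y i * g (k - (j + i))%N).
  rewrite [LHS]big_nat [RHS]big_nat; apply: eq_bigr => j /andP[_ jk].
  rewrite subSn// mulr_sumr; apply: eq_bigr => i _.
  by rewrite mulrA subnDA.
rewrite -(sum_antidiag (fun j i => x j * y i * g (k - (j + i))%N)).
apply: eq_bigr => s _; rewrite mulr_suml [LHS]big_nat [RHS]big_nat.
by apply: eq_bigr => j /andP[_ js]; rewrite subnKC.
Qed.

Lemma conv_delta (g : nat -> R) k :
  \sum_(0 <= s < k.+1) - (s == 0%N)%:R * g (k - s)%N = - g k.
Proof.
rewrite big_ltn// subn0 eqxx mulN1r big_nat big1 ?addr0//.
by move=> s /andP[s0 _]; rewrite gtn_eqF// oppr0 mul0r.
Qed.

Lemma deconvK (g : nat -> R) k :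
  g k = \sum_(0 <= j < k.+1) c j * deconv g (k - j)%N.
Proof.
under eq_bigr do rewrite mulrN; rewrite sumrN.
rewrite (conv_comp c a g k).
by under eq_bigr do rewrite conv_ca; rewrite conv_delta opprK.
Qed.

Lemma convK (g : nat -> R) k :
  deconv (fun k => \sum_(0 <= j < k.+1) c j * g (k - j)%N) k = g k.
Proof.
rewrite /deconv (conv_comp a c g k).
by under eq_bigr do rewrite conv_ac; rewrite conv_delta opprK.
Qed.

End CausalInverse.

Section FiniteSection.
Context {R : realType}.
Variables c a : nat -> R.
Hypothesis conv_ac :
  forall m, \sum_(0 <= i < m.+1) a i * c (m - i)%N = - (m == 0%N)%:R.
Hypothesis a_summable : abs_summable a.
Hypothesis c2_summable : abs_summable (fun k => c k ^+ 2).

Definition zext (m : int) : R := if m is Posz k then c k else 0.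

Definition acov m : R := rsum (fun k => c k * c (k + m)%N).

(** The beta_m of the overview, the kernel of the coupled system. *)
Definition cross m : R := rsum (fun k => c k * a (k + m)%N).

Let S := rsum (fun k => c k ^+ 2).

Lemma sum_zext2_le (m : int) N : \sum_(0 <= l < N) zext (l%:Z + m) ^+ 2 <= S.
Proof.
have c2_ge0 k : 0 <= c k ^+ 2 by rewrite sqr_ge0.
case: m => m.
  apply: (@le_trans _ _ (\sum_(0 <= l < m + N) c l ^+ 2)); last first.
    exact: series_le_rsum.
  rewrite [leRHS](@big_cat_nat _ _ _ m)//= ?leq_addr// (sum_nat_shift _ m N).
  rewrite (eq_bigr (fun l => c (m + l)%N ^+ 2)).
    by rewrite lerDr sumr_ge0.
  by move=> l _ /=; rewrite addnC.
apply: (@le_trans _ _ (\sum_(0 <= l < N - m.+1) c l ^+ 2)); last first.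
  exact: series_le_rsum.
have z0 l : (l < m.+1)%N -> zext (l%:Z + Negz m) = 0.
  by move=> lm; rewrite /zext; case E : (l%:Z + Negz m) => [k|//]; lia.
have [Nm|mN] := leqP N m.+1.
  rewrite big_nat big1; last first.
    by move=> l /andP[_ lN]; rewrite z0 ?expr0n//; exact: leq_trans lN Nm.
  by rewrite sumr_ge0.
rewrite (@big_cat_nat _ _ _ m.+1)//= ?(ltnW mN)// big_nat big1 ?add0r; last first.
  by move=> l /andP[_ lN]; rewrite z0 ?expr0n.
rewrite -{1}(subnKC (ltnW mN)) (sum_nat_shift _ m.+1).
apply: ler_sum => l _.
by rewrite (_ : (m.+1 + l)%:Z + Negz m = l%:Z)//; lia.
Qed.

(** Only the squares of [c] are summable, so the products are controlled termwise by |xy| <= (x^2 +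
    y^2) / 2. *)
Lemma sum_corr_le (m : int) N : \sum_(0 <= l < N) `|c l * zext (l%:Z + m)| <= S.
Proof.
apply: (@le_trans _ _ (\sum_(0 <= l < N) (c l ^+ 2 / 2 + zext (l%:Z + m) ^+ 2 / 2))).
  apply: ler_sum => l _; rewrite ler_norml; apply/andP; split.
    by have : 0 <= (c l + zext (l%:Z + m)) ^+ 2 by [rewrite sqr_ge0]; nra.
  by have : 0 <= (c l - zext (l%:Z + m)) ^+ 2 by [rewrite sqr_ge0]; nra.
rewrite big_split/= -!mulr_suml.
have := sum_zext2_le m N; have := @series_le_rsum _ _ N (fun k => sqr_ge0 (c k)) c2_summable.
by rewrite -/S; lra.
Qed.

Lemma abs_summable_corr (m : int) :
  abs_summable (fun l => c l * zext (l%:Z + m)).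
Proof. by exists S => N; exact: sum_corr_le. Qed.

Lemma rsum_corr (m : int) :
  rsum (fun l => c l * zext (l%:Z + m)) = acov `|m|%N.
Proof.
case: m => m.
  by apply: eq_rsum => l; rewrite -PoszD.
rewrite (@rsum_shift _ _ m.+1); last exact: abs_summable_corr.
rewrite big_nat big1 ?add0r; last first.
  move=> l /andP[_ lm]; rewrite /zext.
  by case E : (l%:Z + Negz m) => [k|]; rewrite ?mulr0//; lia.
apply: eq_rsum => l; rewrite mulrC (_ : (m.+1 + l)%:Z + Negz m = l%:Z); last by lia.
by rewrite /= addnC.
Qed.

(* The positions [e j] are [j] or [- j], so that the same identities serve both
   ends of the window. *)
Section Potential.
Variables (e : nat -> int) (n : nat) (u : nat -> R).

Definition fpot (m : int) : R := \sum_(0 <= j < n.+1) u j * acov `|m - e j|%N.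

(** The convolution of [u] with the causal sequence [c]. The autocovariance being the correlation of
    [c] with itself, [fpot] is the correlation of [c] with [pfut]. *)
Definition pfut (m : int) : R := \sum_(0 <= j < n.+1) u j * zext (m - e j).

Let pfutE l m : c l * pfut (l%:Z + m) =
  \sum_(0 <= j < n.+1) u j * (c l * zext (l%:Z + (m - e j))).
Proof. by rewrite mulr_sumr; apply: eq_bigr => j _; rewrite mulrCA addrA. Qed.

Lemma fpotE m : fpot m = rsum (fun l => c l * pfut (l%:Z + m)).
Proof.
under eq_rsum do rewrite pfutE.
rewrite rsum_sum; last by move=> j; apply/abs_summableZ/abs_summable_corr.
apply: eq_bigr => j _.
by rewrite rsumZ ?rsum_corr//; exact: abs_summable_corr.
Qed.

Let K := (\sum_(0 <= j < n.+1) `|u j|) * S.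

Lemma sum_pfut_le m N : \sum_(0 <= l < N) `|c l * pfut (l%:Z + m)| <= K.
Proof.
apply: (@le_trans _ _ (\sum_(0 <= l < N) \sum_(0 <= j < n.+1)
    `|u j| * `|c l * zext (l%:Z + (m - e j))|)).
  apply: ler_sum => l _; rewrite pfutE (le_trans (ler_norm_sum _ _ _))//.
  by apply: ler_sum => j _; rewrite normrM.
rewrite exchange_big/= /K mulr_suml; apply: ler_sum => j _.
by rewrite -mulr_sumr ler_wpM2l// sum_corr_le.
Qed.

Lemma abs_summable_pfut m : abs_summable (fun l => c l * pfut (l%:Z + m)).
Proof. by exists K => N; exact: sum_pfut_le. Qed.

Lemma fpot_bounded m : `|fpot m| <= K.
Proof. by rewrite fpotE; apply: rsum_le => N; exact: sum_pfut_le. Qed.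

(** Substituting [fpotE] gives the double sum of [a i * c l * pfut (l + i + m)]. Along the
    antidiagonals [i + l = s] the coefficients collapse to [- (s == 0)]. Absolute convergence holds
    because [a] is summable and the inner sums are bounded by [K] uniformly in the position. *)
Lemma conv_fpot m : rsum (fun i => a i * fpot (i%:Z + m)) = - pfut m.
Proof.
pose F i l := a i * (c l * pfut (l%:Z + (i%:Z + m))).
have -> : (fun i => a i * fpot (i%:Z + m)) = (fun i => rsum (F i)).
  apply/funext => i; rewrite fpotE rsumZ//; exact: abs_summable_pfut.
have [A aA] := a_summable.
have K0 : 0 <= K by exact: le_trans (fpot_bounded 0).
rewrite (@rsum_antidiag _ F (A * K)); last first.
  move=> N; apply: (@le_trans _ _ ((\sum_(0 <= i < N) `|a i|) * K)).
    rewrite mulr_suml; apply: ler_sum => i _.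
    under eq_bigr do rewrite normrM.
    by rewrite -mulr_sumr ler_wpM2l// sum_pfut_le.
  by rewrite ler_wpM2r.
have FE s : \sum_(0 <= i < s.+1) F i (s - i)%N = - (s == 0%N)%:R * pfut (s%:Z + m).
  rewrite -conv_ac mulr_suml [LHS]big_nat [RHS]big_nat.
  apply: eq_bigr => i /andP[_ si]; rewrite /F mulrA addrA.
  by rewrite (_ : (s - i)%N%:Z + i%:Z = s%:Z)//; lia.
under eq_rsum do rewrite FE.
rewrite (@rsum_finsupp _ _ 1); first by rewrite big_nat1 eqxx mulN1r add0r.
by move=> s s0; rewrite gtn_eqF// oppr0 mul0r.
Qed.

End Potential.

Section NormalEquations.
Variables (n : nat) (u : nat -> R).
Let f := fpot Posz n u.
Let p := pfut Posz n u.
Hypothesis normal : forall m, (1 <= m <= n)%N -> f m%:Z = 0.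

(** Under the normal equations the potential vanishes strictly between the starting points [n.+1] of
    [fright] and [0] of [fleft], so these two sequences carry all of it. [qright] and [rleft] are q
    and r of the overview. *)
Definition fright i : R := fpot Posz n u (n.+1 + i)%N%:Z.
Definition fleft k : R := fpot Posz n u (- k%:Z).
Definition qright := deconv a fright.
Definition rleft := deconv a fleft.

Let fmirror m : fpot (fun j => - j%:Z) n u m = f (- m).
Proof.
by apply: eq_bigr => j _; rewrite -[in LHS]abszN; congr (_ * acov `|_|%N); lia.
Qed.

Let abs_summable_af m : abs_summable (fun i => a i * f (i%:Z + m)).
Proof.
have [A aA] := a_summable.
exists (A * ((\sum_(0 <= j < n.+1) `|u j|) * S)) => N.
apply: (@le_trans _ _ (\sum_(0 <= i < N) `|a i| * ((\sum_(0 <= j < n.+1) `|u j|) * S))).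
  by apply: ler_sum => i _; rewrite normrM ler_wpM2l// fpot_bounded.
by rewrite -mulr_suml ler_wpM2r//; exact: le_trans (fpot_bounded Posz n u 0).
Qed.

Lemma pfut_neg k : (0 < k)%N -> p (- k%:Z) = 0.
Proof.
move=> k0; rewrite /p /pfut big1// => j _.
by case E : (- k%:Z - j%:Z) => [l|]/=; rewrite ?mulr0//; lia.
Qed.

Lemma pfut0 : p 0 = u 0%N * c 0%N.
Proof.
rewrite /p /pfut big_ltn// big_nat big1 ?addr0//.
move=> j /andP[j0 _].
by case E : (0 - j%:Z) => [l|]/=; rewrite ?mulr0//; lia.
Qed.

(** [conv_fpot] at position [- k], split into three ranges: the first [k.+1] terms are minus the
    filtered left potential, the next [n] fall in the window and vanish, the rest see only the right
    potential. *)
Lemma rleftE k :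
  rleft k = p (- k%:Z) + rsum (fun i => a (k + n.+1 + i)%N * fright i).
Proof.
have := @conv_fpot Posz n u (- k%:Z).
rewrite (@rsum_shift _ _ (k + n.+1)%N); last exact: abs_summable_af.
rewrite (@big_cat_nat _ _ _ k.+1)//=; last by rewrite addnS ltnS leq_addr.
rewrite [X in _ + X + _]big_nat [X in _ + X + _]big1 ?addr0; last first.
  move=> j /andP[kj jn]; rewrite (_ : j%:Z - k%:Z = (j - k)%N%:Z); last by lia.
  by rewrite -/(f _) normal ?mulr0//; lia.
rewrite -/p (_ : \sum_(0 <= i < k.+1) _ = - rleft k).
  rewrite (_ : rsum _ = rsum (fun i => a (k + n.+1 + i)%N * fright i)).
    by lra.
  apply: eq_rsum => i; congr (_ * fpot _ _ _ _); lia.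
rewrite /rleft /deconv opprK big_nat [RHS]big_nat.
apply: eq_bigr => j /andP[_ jk]; rewrite /fleft; congr (_ * fpot _ _ _ _); lia.
Qed.

(** Inside the window the left range of the same splitting is empty, so only the right potential
    contributes. *)
Lemma pfut_mid m : (1 <= m <= n)%N ->
  p m%:Z = - rsum (fun i => a (n.+1 - m + i)%N * fright i).
Proof.
move=> mn; have := @conv_fpot Posz n u m%:Z.
rewrite (@rsum_shift _ _ (n.+1 - m)%N); last exact: abs_summable_af.
rewrite big_nat big1 ?add0r; last first.
  move=> j /andP[_ jn]; rewrite -PoszD -/(f _) normal ?mulr0//; lia.
rewrite -/p (_ : rsum _ = rsum (fun i => a (n.+1 - m + i)%N * fright i)).
  by move=> ->; rewrite opprK.
apply: eq_rsum => i; congr (_ * fpot _ _ _ _); lia.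
Qed.

(** The splitting of [rleftE] for the mirrored positions [- j]. No inhomogeneous term appears: at
    [- (n.+1 + i)] the mirrored [pfut] would need an index [j > n]. *)
Lemma qrightE i : qright i = rsum (fun k => a (n.+1 + i + k)%N * fleft k).
Proof.
have := @conv_fpot (fun j => - j%:Z) n u (- (n.+1 + i)%N%:Z).
have -> : (fun k => a k * fpot (fun j => - j%:Z) n u (k%:Z - (n.+1 + i)%N%:Z)) =
    (fun k => a k * f ((n.+1 + i)%N%:Z - k%:Z)).
  by apply/funext => k; rewrite fmirror opprB.
have -> : pfut (fun j => - j%:Z) n u (- (n.+1 + i)%N%:Z) = 0.
  rewrite /pfut big_nat big1// => j /andP[_ jn].
  by case E : (- _ - _) => [l|]/=; rewrite ?mulr0//; lia.
rewrite oppr0 (@rsum_shift _ _ (n.+1 + i)%N); last first.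
  rewrite (_ : (fun k => _) = (fun k => a k * fpot (fun j => - j%:Z) n u (k%:Z - (n.+1 + i)%N%:Z))).
    have [A aA] := a_summable.
    exists (A * ((\sum_(0 <= j < n.+1) `|u j|) * S)) => N.
    apply: (@le_trans _ _ (\sum_(0 <= i < N) `|a i| * ((\sum_(0 <= j < n.+1) `|u j|) * S))).
      by apply: ler_sum => k _; rewrite normrM ler_wpM2l// fpot_bounded.
    by rewrite -mulr_suml ler_wpM2r//; exact: le_trans (fpot_bounded Posz n u 0).
  by apply/funext => k; rewrite fmirror opprB.
rewrite (@big_cat_nat _ _ _ i.+1)//=; last by rewrite addSn ltnS leq_addl.
rewrite [X in _ + X + _]big_nat [X in _ + X + _]big1 ?addr0; last first.
  move=> j /andP[kj jn]; rewrite (_ : (n.+1 + i)%N%:Z - j%:Z = (n.+1 + i - j)%N%:Z); last by lia.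
  by rewrite normal ?mulr0//; lia.
rewrite (_ : \sum_(0 <= k < i.+1) _ = - qright i).
  rewrite (_ : rsum _ = rsum (fun k => a (n.+1 + i + k)%N * fleft k)).
    by lra.
  apply: eq_rsum => k; congr (_ * fpot _ _ _ _); lia.
rewrite /qright /deconv opprK big_nat [RHS]big_nat.
apply: eq_bigr => j /andP[_ jk]; rewrite /fright; congr (_ * fpot _ _ _ _); lia.
Qed.

End NormalEquations.

End FiniteSection.

Section PredictorFormula.
Context {R : realType}.
Variables c a : nat -> R.
Hypothesis conv_ac :
  forall m, \sum_(0 <= i < m.+1) a i * c (m - i)%N = - (m == 0%N)%:R.
Hypothesis a_summable : abs_summable a.
Hypothesis c2_summable : abs_summable (fun k => c k ^+ 2).

(** Turns the kernel [a], acting on a potential, into the kernel [cross], acting on the filtered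
    potential. Each side of the system is then expressed through [qright] and [rleft] alone. *)
Lemma rsum_conv_cross (g : nat -> R) t (B : R) :
  (forall m, abs_summable (fun j => c j * a (j + m)%N)) ->
  (forall N, \sum_(0 <= k < N) \sum_(0 <= j < N)
     `|g k * (c j * a (j + (t + k))%N)| <= B) ->
  rsum (fun k => a (t + k)%N * \sum_(0 <= j < k.+1) c j * g (k - j)%N) =
  rsum (fun k => g k * cross c a (t + k)).
Proof.
move=> sca gB; pose F k j := g k * (c j * a (j + (t + k))%N).
transitivity (rsum (fun k => rsum (F k))); last first.
  by apply: eq_rsum => k; rewrite rsumZ.
rewrite (rsum_antidiag gB); apply: eq_rsum => s.
rewrite mulr_sumr big_nat_rev/= add0n [LHS]big_nat [RHS]big_nat.
apply: eq_bigr => k /andP[_ ks]; rewrite /F subSS subKn//.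
by rewrite (_ : (s - k + (t + k))%N = (t + s)%N); [ring|lia].
Qed.

Variables (n : nat) (u : nat -> R).
Hypothesis normal : forall m, (1 <= m <= n)%N -> fpot c Posz n u m%:Z = 0.

Let p := pfut c Posz n u.

Lemma coef_pfut j : (j <= n)%N ->
  u j = - \sum_(0 <= l < j.+1) a l * p (j - l)%N%:Z.
Proof.
move=> jn; rewrite -[LHS](convK conv_ac); congr (- _).
rewrite [LHS]big_nat [RHS]big_nat; apply: eq_bigr => l /andP[_ lj].
congr (_ * _); rewrite /p /pfut big_nat_rev/= add0n.
rewrite [RHS](@big_cat_nat _ _ _ (j - l).+1)//=; last by lia.
rewrite [X in _ = _ + X]big_nat [X in _ = _ + X]big1 ?addr0; last first.
  move=> i /andP[ji _]; case E : (_ - _) => [k|]/=; rewrite ?mulr0//; lia.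
rewrite [LHS]big_nat [RHS]big_nat; apply: eq_bigr => i /andP[_ ij].
rewrite subSS subKn; last by lia.
rewrite (_ : (j - l)%N%:Z - i%:Z = (j - l - i)%N%:Z)/=; last by lia.
by rewrite mulrC.
Qed.

(** Deconvolution gives [- u j] as the sum of [a l * p (j - l)] over all [l], since [p] vanishes at
    negative positions. Replacing [p] by [rleftE] or [pfut_mid] yields a part in [rleft] (the sum
    [G]) and a double sum [F] over the right potential, whose antidiagonals form [qright]. *)
Lemma coef_formula j (B : R) : (1 <= j <= n)%N ->
  (forall k, `|rleft c a n u k| <= B) ->
  u j = - rsum (fun k => a (j + k)%N * rleft c a n u k)
        - rsum (fun s => a (n.+1 - j + s)%N * qright c a n u s).
Proof.
move=> /andP[j1 jn] rB.
pose r := rleft c a n u; pose q := qright c a n u; pose fr := fright c n u.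
have [A aA] := a_summable.
have A0 : 0 <= A by have := aA 0%N; rewrite big_nil.
pose K := (\sum_(0 <= j < n.+1) `|u j|) * rsum (fun k => c k ^+ 2).
have frK i : `|fr i| <= K by exact: fpot_bounded.
have K0 : 0 <= K by exact: le_trans (frK 0%N).
pose G l := a l * (if (j <= l)%N then r (l - j)%N else 0).
pose F l i := a l * (a (n.+1 - j + l + i)%N * fr i).
have sG : abs_summable G.
  exists (A * B) => N; apply: (@le_trans _ _ (\sum_(0 <= l < N) `|a l| * B)).
    apply: ler_sum => l _; rewrite normrM ler_wpM2l//.
    by case: ifP => // _; rewrite normr0 (le_trans _ (rB 0%N)).
  by rewrite -mulr_suml ler_wpM2r// (le_trans _ (rB 0%N)).
have tailA m N : \sum_(0 <= i < N) `|a (m + i)%N| <= A.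
  apply: le_trans (aA (m + N)%N).
  by rewrite [leRHS](@big_cat_nat _ _ _ m)//= ?leq_addr// (sum_nat_shift _ m N) lerDr sumr_ge0.
have rowB m N : \sum_(0 <= i < N) `|a (m + i)%N * fr i| <= A * K.
  apply: (@le_trans _ _ (\sum_(0 <= i < N) `|a (m + i)%N| * K)).
    by apply: ler_sum => i _; rewrite normrM ler_wpM2l.
  by rewrite -mulr_suml ler_wpM2r.
have srow m : abs_summable (fun i => a (m + i)%N * fr i) by exists (A * K).
have FB N : \sum_(0 <= l < N) \sum_(0 <= i < N) `|F l i| <= A * (A * K).
  apply: (@le_trans _ _ (\sum_(0 <= l < N) `|a l| * (A * K))).
    apply: ler_sum => l _; under eq_bigr do rewrite normrM.
    by rewrite -mulr_sumr ler_wpM2l.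
  by rewrite -mulr_suml ler_wpM2r// mulr_ge0.
have rowF l : rsum (F l) = a l * rsum (fun i => a (n.+1 - j + l + i)%N * fr i).
  by rewrite rsumZ.
have sH : abs_summable (fun l => rsum (F l)).
  exists (A * (A * K)) => N; apply: (@le_trans _ _ (\sum_(0 <= l < N) `|a l| * (A * K))).
    apply: ler_sum => l _; rewrite rowF normrM ler_wpM2l//.
    by apply: rsum_le => M.
  by rewrite -mulr_suml ler_wpM2r// mulr_ge0.
(* For [l >= j] this is [rleftE], for [l < j] it is [pfut_mid]. The shift of [a] is
   [n.+1 - j + l + i] in both, so the double sum needs no case distinction. *)
have GH l : G l + - rsum (F l) = a l * p (j%:Z - l%:Z).
  rewrite rowF /G; case: leqP => jl.
    rewrite /r (rleftE conv_ac a_summable c2_summable normal).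
    rewrite (_ : - (l - j)%N%:Z = j%:Z - l%:Z); last by lia.
    rewrite (_ : (fun i => a (l - j + n.+1 + i)%N * fright c n u i) =
      (fun i => a (n.+1 - j + l + i)%N * fr i)).
      by rewrite -/p; ring.
    by apply/funext => i; congr (a _ * _); lia.
  rewrite mulr0 add0r (_ : j%:Z - l%:Z = (j - l)%N%:Z); last by lia.
  rewrite /p (pfut_mid conv_ac a_summable c2_summable normal); last by lia.
  rewrite mulrN; congr (- (_ * _)); apply: eq_rsum => i.
  by congr (a _ * _); lia.
have E1 : rsum (fun l => a l * p (j%:Z - l%:Z)) = - u j.
  rewrite (@rsum_finsupp _ _ j.+1).
    rewrite (coef_pfut jn) opprK [LHS]big_nat [RHS]big_nat.
    by apply: eq_bigr => l /andP[_ lj]; congr (_ * p _); lia.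
  move=> l jl; rewrite (_ : j%:Z - l%:Z = - (l - j)%N%:Z); last by lia.
  by rewrite /p pfut_neg ?mulr0// subn_gt0.
have E2 : rsum (fun l => a l * p (j%:Z - l%:Z)) = rsum G - rsum (fun l => rsum (F l)).
  rewrite -rsumN// -rsumD//; last by case: sH => C sH; exists C => N; under eq_bigr do rewrite normrN.
  by apply: eq_rsum => l; rewrite GH.
have E3 : rsum G = rsum (fun k => a (j + k)%N * r k).
  rewrite (rsum_shift j sG) big_nat big1 ?add0r; last first.
    by move=> l /andP[_ lj]; rewrite /G leqNgt lj mulr0.
  by apply: eq_rsum => k; rewrite /G leq_addr addKn.
have E4 : rsum (fun l => rsum (F l)) = - rsum (fun s => a (n.+1 - j + s)%N * q s).
  rewrite (rsum_antidiag FB) -rsumN.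
    apply: eq_rsum => s; rewrite -mulrN /q /qright /deconv opprK mulr_sumr.
    rewrite [LHS]big_nat [RHS]big_nat; apply: eq_bigr => l /andP[_ ls].
    by rewrite /F (_ : (n.+1 - j + l + (s - l))%N = (n.+1 - j + s)%N); [rewrite -/fr; ring|lia].
  have qK s : `|q s| <= A * K.
    rewrite /q /qright /deconv normrN (le_trans (ler_norm_sum _ _ _))//.
    apply: (@le_trans _ _ (\sum_(0 <= l < s.+1) `|a l| * K)).
      by apply: ler_sum => i _; rewrite normrM ler_wpM2l// frK.
    by rewrite -mulr_suml ler_wpM2r.
  exists (A * (A * K)) => N.
  apply: (@le_trans _ _ (\sum_(0 <= i < N) `|a (n.+1 - j + i)%N| * (A * K))).
    by apply: ler_sum => i _; rewrite normrM ler_wpM2l.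
  by rewrite -mulr_suml ler_wpM2r// mulr_ge0.
by move: E1; rewrite E2 E3 E4 -/r -/q; lra.
Qed.

End PredictorFormula.

(** * Preliminary decay of the potentials, and the coupled system *)

Section APriori.
Context {R : realType}.
Variables (c a : nat -> R) (x y mu Cc Ca : R).
Hypothesis c_le : forall k, `|c k| <= Cc * pw x k.
Hypothesis a_le : forall k, `|a k| <= Ca * pw y k.
(** [mu] is a decay exponent of the autocovariance. In order, the strict inequalities make [a]
    summable, give the decay in [acov_le], give the decay 1/2 in [rsum_shift_ar_le], and make the
    double sum in [cross_double_le] converge. *)
Hypothesis exponents :
  [/\ 1 < y, 0 <= mu, mu <= x & [/\ 1 < 2 * x - mu, 3 / 2 < y + mu & 7 / 4 < x + y]].

Let Cc_ge0 : 0 <= Cc.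
Proof. by rewrite -(pmulr_lge0 _ (pw_gt0 x 0)) (le_trans _ (c_le 0)). Qed.

Let Ca_ge0 : 0 <= Ca.
Proof. by rewrite -(pmulr_lge0 _ (pw_gt0 y 0)) (le_trans _ (a_le 0)). Qed.

Lemma ar_summable : abs_summable a.
Proof.
have [y1 mu0 mux [xmu ymu xy]] := exponents.
apply: (@abs_summable_pw _ _ Ca (y - 1)); first by lra.
by move=> k; rewrite subrK.
Qed.

Lemma ma_square_summable : abs_summable (fun k => c k ^+ 2).
Proof.
have [y1 mu0 mux [xmu ymu xy]] := exponents.
apply: (@abs_summable_pw _ _ (Cc ^+ 2) (2 * x - 1)); first by lra.
move=> k; rewrite (_ : 2 * x - 1 + 1 = x + x); last by lra.
by rewrite normrX pwD -expr2 -exprMn lerXn2r// nnegrE mulr_ge0 ?pw_ge0.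
Qed.

(** Of the exponent [x] of the shifted factor, [mu] goes to the lag [m] and [x - mu] to the
    summation index, whose total exponent [2 * x - mu] exceeds 1. *)
Lemma acov_le m :
  `|acov c m| <= (Cc ^+ 2 * (1 + (2 * x - mu - 1)^-1)) * pw mu m.
Proof.
have [y1 mu0 mux [xmu ymu xy]] := exponents.
apply: rsum_le => N.
apply: (@le_trans _ _ (\sum_(0 <= k < N)
    Cc ^+ 2 * pw mu m * pw (2 * x - mu - 1 + 1) k)).
  apply: ler_sum => k _; rewrite normrM.
  apply: (@le_trans _ _ ((Cc * pw x k) * (Cc * (pw (x - mu) k * pw mu m)))).
    apply: ler_pM => //; apply: le_trans (c_le _) _; rewrite ler_wpM2l//.
    by rewrite -{1}(subrK mu x) pw_add_le//; lra.
  rewrite (_ : 2 * x - mu - 1 + 1 = x + (x - mu)); last by lra.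
  by rewrite [in leRHS]pwD expr2; lra.
rewrite -mulr_sumr mulrAC ler_wpM2r ?pw_ge0// ler_wpM2l ?sqr_ge0//.
by apply: sum_pw_le; lra.
Qed.

Lemma abs_summable_cross m : abs_summable (fun j => c j * a (j + m)%N).
Proof.
have [y1 mu0 mux [xmu ymu xy]] := exponents.
apply: (@abs_summable_pw _ _ (Cc * Ca) (x + y - 1)); first by lra.
move=> k; rewrite subrK pwD normrM mulrACA ler_pM//.
apply: le_trans (a_le _) _; rewrite ler_wpM2l// pw_le ?leq_addr//; lra.
Qed.

(** Half a power of [a] is spent on the shift [t]; the exponent [y - 1 / 2 + mu] left for [i] still
    exceeds 1. *)
Lemma rsum_shift_ar_le (g : nat -> R) (G : R) t :
  (forall i, `|g i| <= G * pw mu i) ->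
  `|rsum (fun i => a (t + i)%N * g i)| <=
    Ca * G * (1 + (y + mu - 3 / 2)^-1) * pw (1 / 2) t.
Proof.
have [y1 mu0 mux [xmu ymu xy]] := exponents.
move=> gG; have G0 : 0 <= G.
  by rewrite -(pmulr_lge0 _ (pw_gt0 mu 0)) (le_trans _ (gG 0%N)).
apply: rsum_le => N.
apply: (@le_trans _ _ (\sum_(0 <= i < N)
    Ca * G * pw (1 / 2) t * pw (y + mu - 3 / 2 + 1) i)).
  apply: ler_sum => i _; rewrite normrM.
  apply: (@le_trans _ _ (Ca * (pw (1 / 2) t * pw (y - 1 / 2) i) * (G * pw mu i))).
    apply: ler_pM => //; apply: le_trans (a_le _) _; rewrite ler_wpM2l//.
    by apply: pw_split_le; lra.
  rewrite (_ : y + mu - 3 / 2 + 1 = (y - 1 / 2) + mu); last by lra.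
  by rewrite [in leRHS]pwD; lra.
rewrite -mulr_sumr mulrAC ler_wpM2r ?pw_ge0// ler_wpM2l ?mulr_ge0//.
by apply: sum_pw_le; lra.
Qed.

(** The exponent 3/4 taken from [a] gives [k] the total 1/2 + 3/4 = 5/4 and leaves
    [x + y - 3 / 4 > 1] for [j]. *)
Lemma cross_double_le (g : nat -> R) (G : R) t N :
  (forall k, `|g k| <= G * pw (1 / 2) k) ->
  \sum_(0 <= k < N) \sum_(0 <= j < N) `|g k * (c j * a (j + (t + k))%N)| <=
  G * (Cc * Ca) * (1 + (1 / 4)^-1) * (1 + (x + y - 7 / 4)^-1).
Proof.
have [y1 mu0 mux [xmu ymu xy]] := exponents.
move=> gG; have G0 : 0 <= G.
  by rewrite -(pmulr_lge0 _ (pw_gt0 (1 / 2) 0)) (le_trans _ (gG 0%N)).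
apply: (@le_trans _ _ (\sum_(0 <= k < N) \sum_(0 <= j < N)
    G * (Cc * Ca) * pw (1 / 4 + 1) k * pw (x + y - 7 / 4 + 1) j)).
  apply: ler_sum => k _; apply: ler_sum => j _; rewrite !normrM.
  apply: (@le_trans _ _ (G * pw (1 / 2) k * (Cc * pw x j *
     (Ca * (pw (3 / 4) k * pw (y - 3 / 4) j))))).
    apply: ler_pM => //; apply: ler_pM => //.
    apply: le_trans (a_le _) _; rewrite ler_wpM2l//.
    apply: (@le_trans _ _ (pw y (k + j))).
      by apply: pw_le; [lra|lia].
    by apply: pw_split_le; lra.
  rewrite (_ : 1 / 4 + 1 = 1 / 2 + 3 / 4); last by lra.
  rewrite (_ : x + y - 7 / 4 + 1 = x + (y - 3 / 4)); last by lra.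
  by rewrite !pwD; lra.
under eq_bigr do rewrite -mulr_sumr.
rewrite -mulr_suml -mulr_sumr; apply: ler_pM.
- rewrite mulr_ge0 ?mulr_ge0// sumr_ge0// => k _; exact: pw_ge0.
- rewrite sumr_ge0// => k _; exact: pw_ge0.
- by rewrite ler_wpM2l ?mulr_ge0// sum_pw_le//; lra.
- by rewrite sum_pw_le//; lra.
Qed.

Hypothesis conv_ac :
  forall m, \sum_(0 <= i < m.+1) a i * c (m - i)%N = - (m == 0%N)%:R.

Section DecayOfPotentials.
Variables (n : nat) (u : nat -> R).
Hypothesis normal : forall m, (1 <= m <= n)%N -> fpot c Posz n u m%:Z = 0.

Let a_sum := ar_summable.
Let c2_sum := ma_square_summable.

Let G := (\sum_(0 <= j < n.+1) `|u j|) *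
  (Cc ^+ 2 * (1 + (2 * x - mu - 1)^-1)).

Let G1_ge0 : 0 <= Cc ^+ 2 * (1 + (2 * x - mu - 1)^-1).
Proof.
have [y1 mu0 mux [xmu ymu xy]] := exponents.
by rewrite mulr_ge0 ?sqr_ge0// addr_ge0// invr_ge0; lra.
Qed.

Let potential_le (m : int) i :
  (forall j, (j < n.+1)%N -> (i <= `|m - j%:Z|)%N) ->
  `|fpot c Posz n u m| <= G * pw mu i.
Proof.
have [y1 mu0 mux [xmu ymu xy]] := exponents.
move=> im; rewrite /fpot (le_trans (ler_norm_sum _ _ _))//.
rewrite /G -mulrA mulr_suml big_nat [leRHS]big_nat.
apply: ler_sum => j /andP[_ jn]; rewrite normrM ler_wpM2l//.
by rewrite (le_trans (acov_le _))// ler_wpM2l// pw_le// im.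
Qed.

Lemma fright_le i : `|fright c n u i| <= G * pw mu i.
Proof. by apply: potential_le => j jn; lia. Qed.

Lemma fleft_le k : `|fleft c n u k| <= G * pw mu k.
Proof. by apply: potential_le => j jn; lia. Qed.

Let C := Ca * G * (1 + (y + mu - 3 / 2)^-1).

Let C_ge0 : 0 <= C.
Proof.
have [y1 mu0 mux [xmu ymu xy]] := exponents.
have G0 : 0 <= G by rewrite mulr_ge0// sumr_ge0.
by rewrite mulr_ge0 ?(mulr_ge0 Ca_ge0)// addr_ge0// invr_ge0; lra.
Qed.

(** The constant depends on [n] and [u]. It only has to be finite: it justifies the exchange of sums
    in [rleft_cross] and starts the iteration in [contraction_bound]. *)
Lemma qright_decay : exists C, forall i, `|qright c a n u i| <= C * pw (1 / 2) i.
Proof.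
exists C => i; rewrite (qrightE conv_ac a_sum c2_sum normal).
rewrite (le_trans (rsum_shift_ar_le _ fleft_le))// -/C ler_wpM2l//.
by apply: pw_le; [lra|lia].
Qed.

Lemma rleft_decay : exists C, forall k, `|rleft c a n u k| <= C * pw (1 / 2) k.
Proof.
exists (C + `|u 0%N * c 0%N|) => k.
rewrite (rleftE conv_ac a_sum c2_sum normal) (le_trans (ler_normD _ _))//.
rewrite addrC mulrDl lerD//.
  rewrite (le_trans (rsum_shift_ar_le _ fright_le))// -/C ler_wpM2l//.
  by apply: pw_le; [lra|lia].
case: k => [|k].
  by rewrite oppr0 pfut0 /pw powR1 mulr1.
by rewrite pfut_neg// normr0 mulr_ge0 ?pw_ge0.
Qed.

Lemma rleft_cross k :
  rleft c a n u k = (k == 0%N)%:R * (u 0%N * c 0%N) +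
    rsum (fun i => qright c a n u i * cross c a (k + n.+1 + i)).
Proof.
rewrite (rleftE conv_ac a_sum c2_sum normal); congr (_ + _).
  case: k => [|k]; first by rewrite oppr0 pfut0 mul1r.
  by rewrite pfut_neg// mul0r.
have [D qD] := qright_decay.
rewrite -(rsum_conv_cross abs_summable_cross (fun N => cross_double_le _ _ qD)).
by apply: eq_rsum => i; rewrite -(deconvK conv_ac).
Qed.

Lemma qright_cross i :
  qright c a n u i = rsum (fun k => rleft c a n u k * cross c a (n.+1 + i + k)).
Proof.
rewrite (qrightE conv_ac a_sum c2_sum normal).
have [D rD] := rleft_decay.
rewrite -(rsum_conv_cross abs_summable_cross (fun N => cross_double_le _ _ rD)).
by apply: eq_rsum => k; rewrite -(deconvK conv_ac).
Qed.

End DecayOfPotentials.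

End APriori.

(** * The contraction for the inverse square root weight *)

Section Contraction.
Context {R : realType}.

(** Iterating the step [m] times from [K0] gives the constant [E / (1 - rho) + rho ^+ m * K0]; the
    limit forgets [K0], so a poor initial bound does no harm. *)
Lemma contraction_bound (q w : nat -> R) (K0 E rho : R) :
  0 <= rho -> rho < 1 -> 0 <= K0 -> 0 <= E -> (forall i, 0 <= w i) ->
  (forall i, `|q i| <= K0 * w i) ->
  (forall K, 0 <= K -> (forall i, `|q i| <= K * w i) ->
    forall i, `|q i| <= (E + rho * K) * w i) ->
  forall i, `|q i| <= E / (1 - rho) * w i.
Proof.
move=> rho0 rho1 K00 E0 w0 q0 step i.
have rho10 : 0 < 1 - rho by lra.
have qm m : forall i, `|q i| <= (E / (1 - rho) + rho ^+ m * K0) * w i.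
  elim: m => [|m IHm] j.
    rewrite expr0 mul1r (le_trans (q0 j))// ler_wpM2r// lerDr.
    by rewrite divr_ge0// ltW.
  have K1 : 0 <= E / (1 - rho) + rho ^+ m * K0.
    by rewrite addr_ge0 ?mulr_ge0 ?exprn_ge0 ?invr_ge0// ltW.
  rewrite (le_trans (step _ K1 IHm j))// ler_wpM2r// exprS.
  by rewrite le_eqVlt; apply/orP; left; apply/eqP; field; rewrite gt_eqF.
have cl : (fun m => (E / (1 - rho) + rho ^+ m * K0) * w i) @ \oo -->
    (E / (1 - rho) + 0 * K0) * w i.
  apply: cvgMl; apply: cvgD; first exact: cvg_cst.
  by apply: cvgMl; apply: cvg_expr; rewrite ger0_norm.
rewrite mul0r addr0 in cl.
rewrite -(cvg_lim _ cl)//; apply: limr_ge; first by apply: cvgP cl.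
by apply: nearW => m; exact: qm.
Qed.

Variables (c a : nat -> R) (n : nat) (u : nat -> R) (B : R).
Let q := qright c a n u.
Let r := rleft c a n u.
Hypothesis rE : forall k, r k = (k == 0%N)%:R * (u 0%N * c 0%N) +
    rsum (fun i => q i * cross c a (k + n.+1 + i)).
Hypothesis qE : forall i,
  q i = rsum (fun k => r k * cross c a (n.+1 + i + k)).
Hypothesis q_decay : exists C, forall i, `|q i| <= C * pw (1 / 2) i.
Hypothesis r_decay : exists C, forall k, `|r k| <= C * pw (1 / 2) k.
Hypothesis cross_le : forall m, (n < m)%N -> `|cross c a m| <= B / m%:R.
Hypothesis n_gt0 : (0 < n)%N.

(** The gap between the two ends of the window is shared out: [n.+1 + i + k = Y k + X i] with both
    summands at least [n / 2]. The kernel 1 / (x + y) thus stays away from its singularity and the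
    weights are O(n^(-1/2)). The extra unit lies in [X] because the sum in [sqrt_kernel_le] begins
    at [y + 1]. *)
Let s : R := n%:R / 2.

Let s_gt0 : 0 < s. Proof. by rewrite divr_gt0// ltr0n. Qed.

Let B_ge0 : 0 <= B.
Proof.
by have := le_trans (normr_ge0 _) (cross_le (ltnSn n)); rewrite pmulr_lge0.
Qed.

Let X i : R := s + i.+1%:R.
Let Y k : R := k%:R + s.

Let X_gt0 i : 0 < X i. Proof. by rewrite addr_gt0. Qed.
Let Y_gt0 k : 0 < Y k. Proof. by rewrite ltr_wpDl. Qed.

Let XY i k : (n.+1 + i + k)%:R = Y k + X i :> R.
Proof. by rewrite /X /Y /s !natrD -!natr1; field. Qed.

Let kernel_sum (g : nat -> R) z K N (m : nat -> nat) : 0 < z -> 0 <= K ->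
  (forall i, `|g i| <= K * (Num.sqrt (X i))^-1) ->
  (forall i, (n < m i)%N /\ (m i)%:R = z + X i) ->
  \sum_(0 <= i < N) `|g i * cross c a (m i)| <= B * pi * K * (Num.sqrt z)^-1.
Proof.
move=> z0 K0 gK mE.
apply: (@le_trans _ _ (\sum_(0 <= i < N)
    (K * B) * ((Num.sqrt (X i))^-1 / (z + X i)))).
  apply: ler_sum => i _; rewrite normrM.
  have [nm mz] := mE i.
  apply: (@le_trans _ _ ((K * (Num.sqrt (X i))^-1) * (B / (z + X i)))).
    by apply: ler_pM => //; rewrite -mz cross_le.
  by rewrite mulrACA.
rewrite -mulr_sumr [leRHS](_ : _ = K * B * (pi / Num.sqrt z)); last by ring.
by rewrite ler_wpM2l ?mulr_ge0// sqrt_kernel_le.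
Qed.

Let r_step K : 0 <= K -> (forall i, `|q i| <= K * (Num.sqrt (X i))^-1) ->
  forall k, `|r k - (k == 0%N)%:R * (u 0%N * c 0%N)| <=
    B * pi * K * (Num.sqrt (Y k))^-1.
Proof.
move=> K0 qK k; rewrite rE addrAC subrr add0r; apply: rsum_le => N.
apply: kernel_sum => // i; split; first by lia.
by rewrite -XY; congr (_%:R); lia.
Qed.

Let abs_summable_rcross i : abs_summable (fun k => r k * cross c a (n.+1 + i + k)).
Proof.
have [C rC] := r_decay.
apply: (@abs_summable_pw _ _ (C * B) (1 / 2)) => // k.
rewrite pwD normrM mulrACA; apply: ler_pM => //.
apply: (le_trans (cross_le _)); first by lia.
rewrite ler_wpM2l// /pw powR_inv1//.
by rewrite lef_pV2 ?posrE ?ltr0n// ler_nat; lia.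
Qed.

Hypothesis kappa_lt1 : B * pi < 1.
Let kappa := B * pi.

Let kappa_ge0 : 0 <= kappa. Proof. by rewrite mulr_ge0// pi_ge0. Qed.

(** Two passes through the kernel cost [kappa ^+ 2]. The term with [r 0], which contains the source
    [u 0 * c 0] and is not small, is set aside as the forcing; the remaining indices move up by one,
    and [Y k.+1 = X k] restores the form of the kernel sum. *)
Let q_step K : 0 <= K -> (forall i, `|q i| <= K * (Num.sqrt (X i))^-1) ->
  forall i, `|q i| <= (`|r 0| * B / Num.sqrt s + kappa ^+ 2 * K) *
    (Num.sqrt (X i))^-1.
Proof.
move=> K0 qK i; rewrite qE (@rsum_shift _ _ 1); last exact: abs_summable_rcross.
rewrite big_nat1 addn0 (le_trans (ler_normD _ _))// mulrDl lerD//.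
  rewrite normrM -2!mulrA ler_wpM2l// (le_trans (cross_le _))//; first by lia.
  rewrite ler_wpM2l// -invfM lef_pV2 ?posrE ?mulr_gt0 ?sqrtr_gt0//.
  apply: (@le_trans _ _ (Num.sqrt (X i) * Num.sqrt (X i))).
    by rewrite ler_wpM2r ?sqrtr_ge0// ler_wsqrtr// lerDl.
  rewrite -expr2 sqr_sqrtr ?(ltW (X_gt0 i))//.
  by rewrite -[(n.+1 + i)%N]addn0 XY lerDr ltW.
rewrite expr2 -(mulrA kappa kappa K); apply: rsum_le => N.
apply: kernel_sum => //; first by rewrite mulr_ge0.
  move=> k; have := r_step K0 qK k.+1.
  by rewrite mul0r subr0 /Y addrC.
move=> k; split; first by lia.
by rewrite XY /X /Y natrD; ring.
Qed.

Let K := `|r 0| * B / Num.sqrt s / (1 - kappa ^+ 2).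

Let kappa2_lt1 : kappa ^+ 2 < 1.
Proof. by rewrite expr_lt1. Qed.

Let K_ge0 : 0 <= K.
Proof. by rewrite !mulr_ge0 ?invr_ge0 ?sqrtr_ge0// subr_ge0 ltW. Qed.

Let q_le i : `|q i| <= K * (Num.sqrt (X i))^-1.
Proof.
have [C qC] := q_decay.
have C0 : 0 <= C.
  by rewrite -(pmulr_lge0 _ (pw_gt0 (1 / 2 : R) 0)) (le_trans _ (qC 0%N)).
(* The a priori bound passes to the shifted weight at the cost of [Num.sqrt (1 + s)], since
   [s + i.+1 <= (1 + s) * i.+1]. *)
apply: (@contraction_bound q (fun i => (Num.sqrt (X i))^-1)
  (C * Num.sqrt (1 + s)) (`|r 0| * B / Num.sqrt s) (kappa ^+ 2)) => //.
- by rewrite exprn_ge0.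
- by rewrite mulr_ge0 ?sqrtr_ge0.
- by rewrite !mulr_ge0 ?invr_ge0 ?sqrtr_ge0.
- move=> j; rewrite (le_trans (qC j))// -mulrA ler_wpM2l// pw_half.
  rewrite ler_pdivlMr ?sqrtr_gt0// mulrC ler_pdivrMr ?sqrtr_gt0//.
  rewrite -sqrtrM ?addr_ge0 ?(ltW s_gt0)// ler_wsqrtr// /X mulrDl mul1r addrC.
  by rewrite lerD2l ler_peMr ?(ltW s_gt0)// ler1n.
Qed.

(** The origin of the rate 1/n: one factor s^(-1/2) comes from the forcing inside [K], the other
    from the weight. *)
Let invsqrt_le z : s <= z -> K * (Num.sqrt z)^-1 <= `|r 0| * (B / (1 - kappa ^+ 2)) / s.
Proof.
move=> sz; apply: (@le_trans _ _ (K * (Num.sqrt s)^-1)).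
  rewrite ler_wpM2l// lef_pV2 ?posrE ?sqrtr_gt0 ?ler_wsqrtr//.
  exact: lt_le_trans sz.
rewrite /K -[in leRHS](sqr_sqrtr (ltW s_gt0)) expr2 invfM.
by rewrite le_eqVlt; apply/orP; left; apply/eqP; ring.
Qed.

Let D := B / (1 - kappa ^+ 2).

(** The bounds so far are proportional to the unknown [r 0]. For [2 * D <= s] the deviation of [r 0]
    from [u 0 * c 0] is at most half of [|r 0|], and absorbing it gives
    [|r 0| <= 2 * |u 0 * c 0|]. *)
Lemma contraction_conclusion : 2 * D <= s ->
  let M := 2 * D * `|u 0%N * c 0%N| / s in
  [/\ forall i, `|q i| <= M, forall k, (0 < k)%N -> `|r k| <= M &
      `|r 0%N - u 0%N * c 0%N| <= M].
Proof.
move=> Ds M.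
have D0 : 0 <= D by rewrite mulr_ge0// invr_ge0 subr_ge0 ltW.
have rk k : `|r k - (k == 0%N)%:R * (u 0%N * c 0%N)| <= `|r 0| * D / s.
  rewrite (le_trans (r_step K_ge0 q_le k))// -mulrA -/kappa.
  apply: (@le_trans _ _ (K * (Num.sqrt (Y k))^-1)).
    by rewrite ler_piMl ?(ltW kappa_lt1)// mulr_ge0 ?invr_ge0 ?sqrtr_ge0.
  by apply: invsqrt_le; rewrite /Y lerDr.
have Ds2 : D / s <= 1 / 2 by rewrite ler_pdivrMr//; lra.
have r0le : `|r 0| <= 2 * `|u 0%N * c 0%N|.
  have := rk 0%N; rewrite mul1r -mulrA => h.
  have h2 : `|r 0| * (D / s) <= `|r 0| * (1 / 2) by rewrite ler_wpM2l.
  have : `|r 0| <= `|r 0 - u 0%N * c 0%N| + `|u 0%N * c 0%N|.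
    by rewrite -{1}(subrK (u 0%N * c 0%N) (r 0)) ler_normD.
  by lra.
have rD : `|r 0| * D / s <= M.
  rewrite /M ler_wpM2r ?invr_ge0 ?(ltW s_gt0)//.
  rewrite (_ : 2 * D * _ = 2 * `|u 0%N * c 0%N| * D); last by ring.
  by rewrite ler_wpM2r.
split.
- move=> i; rewrite (le_trans (q_le i))// (le_trans (invsqrt_le _))//.
  by rewrite /X lerDl.
- by move=> k k0; have := rk k; rewrite gtn_eqF// mul0r subr0 => /le_trans; apply.
- by have := rk 0%N; rewrite mul1r => /le_trans; apply.
Qed.

End Contraction.

(** * Regularly varying sequences *)

Section RegularVariation.
Context {R : realType}.

(** The finitely many early indices are paid for by adding their ratios [|f k| / w k] to the
    constant. *)
Lemma eventually_le_all (f w : nat -> R) (C : R) N : (forall n, 0 < w n) ->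
  (forall n, (N <= n)%N -> f n <= C * w n) ->
  exists2 C', 0 < C' & forall n, f n <= C' * w n.
Proof.
move=> w0 fC; exists (`|C| + 1 + \sum_(0 <= k < N) `|f k| / w k).
  by rewrite ltr_wpDr ?ltr_wpDl// sumr_ge0// => k _; rewrite divr_ge0// ltW.
have S0 : 0 <= \sum_(0 <= k < N) `|f k| / w k.
  by rewrite sumr_ge0// => k _; rewrite divr_ge0// ltW.
move=> n; have [nN|Nn] := ltnP n N.
  rewrite -ler_pdivrMr// (@le_trans _ _ (`|f n| / w n))//.
    by rewrite ler_wpM2r ?invr_ge0 ?ler_norm// ltW.
  rewrite (bigD1_seq n)/= ?mem_index_iota ?iota_uniq// addrCA lerDl.
  by rewrite addr_ge0// sumr_ge0// => k _; rewrite divr_ge0// ltW.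
rewrite (le_trans (fC n Nn))// ler_wpM2r ?(ltW (w0 n))//.
by have := ler_norm C; lra.
Qed.

(** Potter's bounds, the only form in which slow variation is used for sequences. *)
Definition potter (L : nat -> R) := forall e : R, 0 < e -> exists N, forall k m,
  (N <= k)%N -> (k <= m)%N ->
  L m <= (1 + e) * (m%:R / k%:R) `^ e * L k /\
  L k <= (1 + e) * (m%:R / k%:R) `^ e * L m.

Definition asymp_equiv (f g : nat -> R) := forall e : R, 0 < e ->
  exists N, forall n, (N <= n)%N -> `|f n - g n| <= e * g n.

(** Up to the factor [K], the product [f k * k.+1 ^ y] is eventually decreasing; in [lower_regular]
    it is eventually increasing. These one-sided forms replace the exact asymptotics in the
    estimates for tails. *)
Definition upper_regular (f : nat -> R) (y : R) := exists (K : R) N, 0 < K /\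
  forall k m, (N <= k)%N -> (k <= m)%N ->
    [/\ 0 < f k, 0 < f m & f m * pw y k <= K * pw y m * f k].

Definition lower_regular (f : nat -> R) (y : R) := exists (K : R) N, 0 < K /\
  forall k m, (N <= k)%N -> (k <= m)%N ->
    [/\ 0 < f k, 0 < f m & f k * pw y m <= K * pw y k * f m].

Section Ratios.
Variables (f L : nat -> R) (p C : R).
Hypothesis C_gt0 : 0 < C.
Hypothesis L_gt0 : exists N, forall n, (N <= n)%N -> 0 < L n.
Hypothesis fL : asymp_equiv f (fun n => n%:R `^ (- p) * L n * C).
Hypothesis LP : potter L.

Lemma ratio_bounds (e : R) : 0 < e -> exists N, forall k m,
  (N <= k)%N -> (k <= m)%N ->
  [/\ (0 < k)%N, 0 < f k, 0 < f m,
   f m <= 6 * (1 + e) * (m%:R / k%:R) `^ (e - p) * f k &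
   f k <= 6 * (1 + e) * (m%:R / k%:R) `^ (p + e) * f m].
Proof.
move=> e0; have [N1 L0] := L_gt0; have [N2 LPN] := LP e0.
(* The relative error 1/2 places [f] between one half and three halves of its model, so ratios
   change by a factor at most 3; the stated 6 leaves room. *)
have [N3 fN] := @fL (1 / 2) ltac:(lra).
exists (maxn (maxn N1 N2) (maxn N3 1)) => k m.
rewrite !geq_max => /andP[/andP[kN1 kN2] /andP[kN3 k0]] km.
have m0 : (0 < m)%N by exact: leq_trans km.
have k0R : 0 < k%:R :> R by rewrite ltr0n.
have m0R : 0 < m%:R :> R by rewrite ltr0n.
have [Lm Lk] := LPN _ _ kN2 km.
have Lk0 := L0 _ kN1; have Lm0 := L0 _ (leq_trans kN1 km).
have := fN _ kN3; have := fN _ (leq_trans kN3 km).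
set gm := _ `^ _ * L m * C; set gk := _ `^ _ * L k * C.
have gm0 : 0 < gm by rewrite !mulr_gt0 ?powR_gt0.
have gk0 : 0 < gk by rewrite !mulr_gt0 ?powR_gt0.
rewrite !ler_norml => /andP[fm1 fm2] /andP[fk1 fk2].
have q0 : 0 < m%:R / k%:R :> R by rewrite divr_gt0.
have mq : m%:R = m%:R / k%:R * k%:R :> R by rewrite divfK// gt_eqF.
set q : R := m%:R / k%:R in Lm Lk q0 mq *.
have pm : m%:R `^ (- p) = q `^ (- p) * k%:R `^ (- p).
  by rewrite mq powRM// ltW.
have gmk : gm <= (1 + e) * q `^ (e - p) * gk.
  rewrite /gm /gk pm powRDp// [leRHS](_ : _ = q `^ (- p) * k%:R `^ (- p) *
    ((1 + e) * q `^ e * L k) * C); last by ring.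
  by rewrite ler_wpM2r ?(ltW C_gt0)// ler_wpM2l// mulr_ge0 ?powR_ge0.
have gkm : gk <= (1 + e) * q `^ (p + e) * gm.
  rewrite /gm /gk pm powRDp// [leRHS](_ : _ = (q `^ p * q `^ (- p)) * k%:R `^ (- p) *
    ((1 + e) * q `^ e * L m) * C); last by ring.
  rewrite -powRDp// subrr powRr0 mul1r.
  by rewrite ler_wpM2r ?(ltW C_gt0)// ler_wpM2l// powR_ge0.
have fk0 : 0 < f k by lra.
have fm0 : 0 < f m by lra.
have e1 : 0 <= 1 + e by lra.
split => //.
- have h : (1 + e) * q `^ (e - p) * gk <= (1 + e) * q `^ (e - p) * (2 * f k).
    by apply: ler_wpM2l; [rewrite mulr_ge0 ?powR_ge0|lra].
  have h' : 0 <= (1 + e) * q `^ (e - p) * f k by rewrite !mulr_ge0 ?powR_ge0// ltW.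
  by lra.
- have h : (1 + e) * q `^ (p + e) * gm <= (1 + e) * q `^ (p + e) * (2 * f m).
    by apply: ler_wpM2l; [rewrite mulr_ge0 ?powR_ge0|lra].
  have h' : 0 <= (1 + e) * q `^ (p + e) * f m by rewrite !mulr_ge0 ?powR_ge0// ltW.
  by lra.
Qed.

Let pw_ratio (y : R) k m : pw y m = (m.+1%:R / k.+1%:R) `^ (- y) * pw y k.
Proof. by rewrite /pw -powRM ?divr_ge0// divfK. Qed.

Lemma ratio_upper (e : R) : 0 < e -> e < p -> upper_regular f (p - e).
Proof.
move=> e0 ep; have [N fN] := ratio_bounds e0.
exists (6 * (1 + e) * 2 `^ (p - e)), N; split.
  by rewrite !mulr_gt0 ?powR_gt0//; lra.
move=> k m Nk km; have [k0 fk fm h _] := fN k m Nk km; split => //.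
rewrite (pw_ratio _ k m) (_ : - (p - e) = e - p); last by ring.
set q := m%:R / k%:R in h; set q1 : R := _ / _.
have q10 : 0 < q1 by rewrite divr_gt0 ?ltr0n.
have q0 : 0 < q by rewrite divr_gt0 ?ltr0n//; lia.
have qq : q1 <= q.
  rewrite /q1 /q ler_pdivrMr ?ltr0n// mulrAC ler_pdivlMr ?ltr0n//.
  by rewrite -!natrM ler_nat; lia.
have hq : q `^ (e - p) <= 2 `^ (p - e) * q1 `^ (e - p).
  rewrite (_ : e - p = - (p - e)); last by ring.
  rewrite (@le_trans _ _ (q1 `^ (- (p - e))))//.
    rewrite !powRN lef_pV2 ?posrE ?powR_gt0// ge0_ler_powR ?nnegrE ?(ltW q0) ?(ltW q10)//.
    by lra.
  rewrite ler_peMl ?powR_ge0// -[leLHS](powRr0 2) ler_powR//; lra.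
rewrite (_ : 6 * (1 + e) * 2 `^ (p - e) * (q1 `^ (e - p) * pw (p - e) k) * f k =
  6 * (1 + e) * (2 `^ (p - e) * q1 `^ (e - p)) * f k * pw (p - e) k); last by ring.
rewrite ler_wpM2r ?pw_ge0// (le_trans h)// ler_wpM2r ?(ltW fk)//.
by rewrite ler_wpM2l// mulr_ge0//; lra.
Qed.

Lemma ratio_lower (e : R) : 0 < e -> 0 < p -> lower_regular f (p + e).
Proof.
move=> e0 ep; have [N fN] := ratio_bounds e0.
exists (6 * (1 + e) * 2 `^ (p + e)), N; split.
  by rewrite !mulr_gt0 ?powR_gt0//; lra.
move=> k m Nk km; have [k0 fk fm _ h] := fN k m Nk km; split => //.
rewrite (pw_ratio _ k m).
set q := m%:R / k%:R in h; set q1 : R := _ / _.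
have q10 : 0 < q1 by rewrite divr_gt0 ?ltr0n.
have q0 : 0 < q by rewrite divr_gt0 ?ltr0n//; lia.
(* The weights have base [k.+1] and the Potter ratio has base [k]; since [k >= 1] the two quotients
   differ at most by the factor 2. *)
have qq : q <= 2 * q1.
  rewrite /q1 /q ler_pdivrMr ?ltr0n// mulrA mulrAC ler_pdivlMr ?ltr0n//.
  by rewrite -!natrM ler_nat; nia.
have hq : q `^ (p + e) * q1 `^ (- (p + e)) <= 2 `^ (p + e).
  rewrite powRN ler_pdivrMr ?powR_gt0// -powRM ?(ltW q10)//.
  by rewrite ge0_ler_powR ?nnegrE ?(ltW q0) ?mulr_ge0 ?(ltW q10)//; lra.
apply: (@le_trans _ _ (6 * (1 + e) * (q `^ (p + e) * q1 `^ (- (p + e))) * f m * pw (p + e) k)).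
  rewrite (_ : 6 * (1 + e) * _ * f m * _ =
    (6 * (1 + e) * q `^ (p + e) * f m) * (q1 `^ (- (p + e)) * pw (p + e) k)); last by ring.
  by rewrite ler_wpM2r// mulr_ge0 ?powR_ge0 ?pw_ge0.
rewrite (_ : 6 * (1 + e) * 2 `^ (p + e) * _ * f m =
  6 * (1 + e) * 2 `^ (p + e) * f m * pw (p + e) k); last by ring.
rewrite ler_wpM2r ?pw_ge0// ler_wpM2r ?(ltW fm)// ler_wpM2l//.
by rewrite mulr_ge0//; lra.
Qed.

End Ratios.

Lemma upper_regular_le f y : upper_regular f y ->
  exists2 C, 0 < C & forall n, `|f n| <= C * pw y n.
Proof.
move=> [K [N [K0 fK]]].
apply: (@eventually_le_all _ _ (K / pw y N * f N) N); first exact: pw_gt0.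
move=> n Nn; have [fN fn h] := fK N n (leqnn N) Nn.
rewrite (gtr0_norm fn) -(ler_pM2r (pw_gt0 y N)) (le_trans h)//.
rewrite [leRHS](_ : _ = (K * pw y n * f N) * (pw y N / pw y N)); last by ring.
by rewrite divff ?mulr1// gt_eqF// pw_gt0.
Qed.

Section TailSums.
Variables (a : nat -> R) (y y' : R).
Hypothesis a_upper : upper_regular a y.
Hypothesis a_lower : lower_regular a y'.
Hypothesis a_sum : abs_summable a.
Hypothesis exps : 1 < y /\ 1 < y' < 2.

Definition tail (j : nat) : R := rsum (fun k => `|a (j.+1 + k)%N|).

Lemma tail_summable j : abs_summable (fun k => `|a (j.+1 + k)%N|).
Proof. by apply: abs_summable_norm; exact: abs_summable_shift. Qed.

Lemma tail_ge0 j : 0 <= tail j.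
Proof. by apply: rsum_ge0 => //; exact: tail_summable. Qed.

Let pw_succ (t : R) k : pw (t - 1) k = pw t k * k.+1%:R.
Proof.
by rewrite /pw opprB addrC powRDp// powRr1.
Qed.

(** The block from [n.+1] to [2 * n + 1] has [n.+1] terms, each at least a fixed multiple of [a n],
    because the bases at most double there. *)
Lemma tail_lower : exists K N, 0 < K /\ forall n, (N <= n)%N ->
  0 < a n /\ n.+1%:R * a n <= K * tail n.
Proof.
have [y1 /andP[y'1 y'2]] := exps; have [K [N [K0 aK]]] := a_lower.
exists (K * 2 `^ y'), N; split; first by rewrite mulr_gt0 ?powR_gt0.
move=> n Nn; have [an _ _] := aK n n Nn (leqnn n); split => //.
rewrite -ler_pdivrMl ?mulr_gt0 ?powR_gt0//.
rewrite (le_trans _ (series_le_rsum n.+1 _ (tail_summable n)))//.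
rewrite (_ : (K * 2 `^ y')^-1 * (n.+1%:R * a n) =
  \sum_(0 <= k < n.+1) (K * 2 `^ y')^-1 * a n); last first.
  by rewrite sumr_const_nat subn0 -[RHS]mulr_natl; ring.
rewrite big_nat [leRHS]big_nat; apply: ler_sum => k /andP[_ kn].
have [_ ak h] := aK n (n.+1 + k)%N Nn ltac:(lia).
rewrite gtr0_norm// ler_pdivrMl ?mulr_gt0 ?powR_gt0//.
have pk : pw y' n <= 2 `^ y' * pw y' (n.+1 + k)%N.
  rewrite /pw !powRN ler_pdivlMr ?powR_gt0// mulrC ler_pdivrMr ?powR_gt0//.
  rewrite -powRM// ge0_ler_powR ?nnegrE ?mulr_ge0//; first by lra.
  by rewrite -natrM ler_nat; lia.
rewrite -(ler_pM2r (pw_gt0 y' (n.+1 + k)%N)) (le_trans h)//.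
rewrite [leRHS](_ : _ = K * (2 `^ y' * pw y' (n.+1 + k)%N) * a (n.+1 + k)%N); last by ring.
by rewrite ler_wpM2r ?(ltW ak)// ler_wpM2l// ltW.
Qed.

Lemma tail_upper : exists K N, 0 < K /\ forall n, (N <= n)%N ->
  0 < a n /\ tail n <= K * (n.+1%:R * a n).
Proof.
have [y1 /andP[y'1 y'2]] := exps; have [K [N [K0 aK]]] := a_upper.
exists (K / (y - 1)), N; split; first by rewrite divr_gt0//; lra.
move=> n Nn; have [an _ _] := aK n n Nn (leqnn n); split => //.
apply: rsum_ub => // M.
rewrite -(sum_nat_shift (fun k => `|a k|) n.+1 M).
apply: (@le_trans _ _ (\sum_(n.+1 <= k < n.+1 + M)
    K * a n / pw y n * pw (y - 1 + 1) k)).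
  rewrite big_nat [leRHS]big_nat; apply: ler_sum => k /andP[nk _].
  have [_ ak h] := aK n k Nn (ltnW nk).
  rewrite gtr0_norm// subrK mulrAC ler_pdivlMr ?pw_gt0// (le_trans h)//.
  by rewrite mulrAC.
rewrite -mulr_sumr.
apply: (@le_trans _ _ (K * a n / pw y n * (pw (y - 1) n / (y - 1)))).
  apply: ler_wpM2l; first by rewrite divr_ge0 ?pw_ge0// mulr_ge0 ?ltW.
  by apply: sum_pw_tail; lra.
have yn0 : y - 1 != 0 by rewrite gt_eqF//; lra.
have pn0 : pw y n != 0 by rewrite gt_eqF ?pw_gt0.
rewrite pw_succ le_eqVlt; apply/orP; left; apply/eqP; field.
by rewrite yn0 pn0.
Qed.

(** The tail at [n] has the order of [n * a n], and [y' < 2]. Hence the tails decay slowly enough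
    for their sum up to [n] to have the order of its last summand times [n], and [n * tail n], being
    of order [n ^ 2 * a n], stays bounded below. Both facts are needed to turn a bound O(1/n) into a
    multiple of the tail. *)
Lemma tail_sum_le : exists M N, 0 < M /\ forall n, (N <= n)%N ->
  \sum_(0 <= j < n) tail j <= M * (n.+1%:R * tail n) /\
  1 <= M * (n.+1%:R * tail n).
Proof.
have [y1 /andP[y'1 y'2]] := exps; have [K [N [K0 aK]]] := a_lower.
have [K1 [N1 [K10 lo]]] := tail_lower; have [K2 [N2 [K20 up]]] := tail_upper.
pose m := maxn N (maxn N1 N2).
have [Nm N1m N2m] : [/\ (N <= m)%N, (N1 <= m)%N & (N2 <= m)%N] by rewrite /m; split; lia.
pose M1 := K * pw y' m / a m * K1.
have am : 0 < a m by have [] := aK m m Nm (leqnn m).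
have M10 : 0 < M1 by rewrite !mulr_gt0 ?invr_gt0 ?pw_gt0.
have one_le n : (m <= n)%N -> 1 <= M1 * (n.+1%:R * tail n).
  move=> mn; have [_ an h] := aK m n Nm mn.
  have [_ h2] := lo n (leq_trans N1m mn).
  rewrite /M1 -mulrA [K1 * _]mulrCA.
  apply: (@le_trans _ _ (K * pw y' m / a m * (n.+1%:R * (n.+1%:R * a n)))); last first.
    rewrite ler_wpM2l//; last by rewrite ler_wpM2l.
    by rewrite !mulr_ge0 ?invr_ge0 ?pw_ge0 ?ltW.
  rewrite [leRHS](_ : _ = (K * pw y' m * a n) / a m * (n.+1%:R * n.+1%:R)); last by ring.
  apply: (@le_trans _ _ (pw y' n * (n.+1%:R * n.+1%:R))); last first.
    apply: ler_wpM2r => //; rewrite ler_pdivlMr// mulrC; exact: h.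
  rewrite mulrA -!pw_succ (_ : y' - 1 - 1 = - (2 - y')); last by ring.
  rewrite /pw opprK [leLHS](_ : _ = 1 `^ (2 - y')); last by rewrite powR1.
  by rewrite ge0_ler_powR ?nnegrE// ?ler1n//; lra.
pose A := rsum (fun k => `|a k|).
have A0 : 0 <= A by apply: rsum_ge0 => //; exact: abs_summable_norm.
have tA j : tail j <= A by exact: rsum_norm_shift_le.
pose M2 := K2 * K / (2 - y') * K1.
have M20 : 0 < M2 by rewrite !mulr_gt0 ?invr_gt0//; lra.
have M1A : 0 <= M1 * m%:R * A by rewrite mulr_ge0// mulr_ge0// ltW.
exists (M1 * m%:R * A + M1 + M2), m; split; first by lra.
move=> n mn; have T0 : 0 <= n.+1%:R * tail n by rewrite mulr_ge0 ?tail_ge0.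
split; last first.
  rewrite (le_trans (one_le n mn))// ler_wpM2r//.
  by lra.
(* The first [m] tails are each at most [A] and are absorbed with [one_le]; from [m] on,
   [tail_upper] compares [tail j] with [j.+1 * a j], and [lower_regular] compares [a j] with
   [a n]. *)
rewrite (@big_cat_nat _ _ _ m)//= !mulrDl -addrA; apply: lerD.
  apply: (@le_trans _ _ (m%:R * A)).
    rewrite -[m in leRHS]subn0 mulr_natl -sumr_const_nat.
    by apply: ler_sum => j _.
  rewrite (_ : _ * _ * _ * _ = (m%:R * A) * (M1 * (n.+1%:R * tail n))); last by ring.
  by rewrite ler_peMr ?one_le ?mulr_ge0.
rewrite ler_wpDl//; first by rewrite mulr_ge0// ltW.
have [_ an _] := aK m n Nm mn; have [_ h2] := lo n (leq_trans N1m mn).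
apply: (@le_trans _ _ (\sum_(m <= j < n) K2 * (K * a n / pw y' n) * pw (y' - 1) j)).
  rewrite big_nat [leRHS]big_nat; apply: ler_sum => j /andP[mj jn].
  have [_ h3] := up j (leq_trans N2m mj); rewrite (le_trans h3)//.
  rewrite -mulrA ler_wpM2l ?(ltW K20)// pw_succ mulrA [leRHS]mulrC.
  rewrite ler_wpM2l// mulrAC ler_pdivlMr ?pw_gt0//.
  have [_ _ h4] := aK j n (leq_trans Nm mj) (ltnW jn).
  by rewrite (le_trans h4)// mulrAC.
rewrite -mulr_sumr.
have sumle : \sum_(m <= j < n) pw (y' - 1) j <= n.+1%:R * (n.+1%:R * pw y' n) / (2 - y').
  apply: (@le_trans _ _ (\sum_(0 <= j < n.+1) pw (y' - 1) j)).
    rewrite [leRHS](@big_cat_nat _ _ _ m)//= ?(leq_trans mn)//.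
    rewrite [X in _ <= _ + X]big_nat_recr//= addrCA lerDl.
    by rewrite addr_ge0 ?pw_ge0// sumr_ge0// => j _; exact: pw_ge0.
  apply: le_trans (sum_pw_low _ _ _) _; [lra|lra|].
  rewrite (_ : 1 - (y' - 1) = 2 - y'); last by ring.
  apply: ler_wpM2r; first by rewrite invr_ge0; lra.
  rewrite [leRHS](_ : _ = (pw y' n * n.+1%:R) * n.+1%:R); last by ring.
  by rewrite -!pw_succ /pw (_ : - (y' - 1 - 1) = 2 - y')//; ring.
apply: (@le_trans _ _ (K2 * (K * a n / pw y' n) *
    (n.+1%:R * (n.+1%:R * pw y' n) / (2 - y')))).
  by rewrite ler_wpM2l// !mulr_ge0 ?invr_ge0 ?pw_ge0 ?ltW.
rewrite (_ : K2 * (K * a n / pw y' n) * _ =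
  K2 * K / (2 - y') * (n.+1%:R * (n.+1%:R * a n))); last first.
  have yn0 : 2 - y' != 0 by rewrite gt_eqF//; lra.
  have pn0 : pw y' n != 0 by rewrite gt_eqF ?pw_gt0.
  by field; rewrite yn0 pn0.
rewrite /M2 -[leRHS]mulrA ler_wpM2l//.
  by rewrite !mulr_ge0 ?invr_ge0 ?ltW//; lra.
by rewrite [leRHS]mulrCA ler_wpM2l.
Qed.

End TailSums.

End RegularVariation.

(** * The decay of the cross sequence, with its constant *)

Section CrossBound.
Context {R : realType}.

Lemma pw_eventually_le (s eta : R) : 0 < s -> 0 < eta ->
  exists N, forall m, (N <= m)%N -> pw s m <= eta.
Proof.
move=> s0 eta0; pose z := (eta^-1) `^ (s^-1).
have z0 : 0 <= z by exact: powR_ge0.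
exists (Num.trunc z) => m zm.
have zm1 : z <= m.+1%:R.
  by rewrite (le_trans (ltW (truncnS_gt z)))// ler_nat ltnS.
rewrite /pw powRN -[leRHS]invrK lef_pV2 ?posrE ?invr_gt0 ?powR_gt0//.
have -> : eta^-1 = z `^ s.
  by rewrite /z -powRrM mulVf ?gt_eqF// powRr1// invr_ge0 ltW.
by rewrite ge0_ler_powR ?nnegrE// ltW.
Qed.

(* The summand is a telescoping difference of (k / (k + m))^D, up to the tangent inequality. *)
Lemma beta_sum_le (D : R) N M m : 0 < D -> D <= 1 -> (0 < N)%N -> (0 < m)%N ->
  \sum_(N <= k < M) k%:R `^ (D - 1) * (k + m)%:R `^ (- 1 - D) <= (m%:R * D)^-1.
Proof.
move=> D0 D1 N0 m0; have m0R : 0 < m%:R :> R by rewrite ltr0n.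
pose b k : R := k%:R / (k + m)%:R.
have b1 k : b k <= 1.
  rewrite /b ler_pdivrMr ?mul1r ?ler_nat ?leq_addr// ltr0n; lia.
have b0 k : 0 <= b k by rewrite divr_ge0.
have [MN|NM] := leqP M N.
  by rewrite big_geq// invr_ge0 mulr_ge0// ltW.
rewrite -[leRHS]mul1r ler_pdivlMr ?mulr_gt0// mulr_suml.
apply: (@le_trans _ _ (\sum_(N <= k < M) (b k `^ D - b k.-1 `^ D))).
  rewrite big_nat [leRHS]big_nat; apply: ler_sum => k /andP[Nk _].
  have k0 : (0 < k)%N by exact: leq_trans Nk.
  have k0R : 0 < k%:R :> R by rewrite ltr0n.
  have km0 : 0 < (k + m)%:R :> R by rewrite ltr0n; lia.
  have bk : 0 < b k by rewrite divr_gt0.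
  have h := powR_le_tangent (b0 k.-1) bk D0 D1.
  have k1E : (k.-1)%:R = k%:R - 1 :> R by rewrite -subn1 natrB.
  have kmp : 0 < (k.-1 + m)%:R :> R by rewrite ltr0n; lia.
  have kmE : (k.-1 + m)%:R = (k + m)%:R - 1 :> R by rewrite natrD k1E natrD; ring.
  have diff : m%:R / (k + m)%:R ^+ 2 <= b k - b k.-1.
    have -> : b k - b k.-1 = m%:R / ((k + m)%:R * (k.-1 + m)%:R).
      rewrite /b k1E kmE; rewrite kmE in kmp.
      have -> : m%:R = (k + m)%:R - k%:R :> R by rewrite natrD; ring.
      move: (k + m)%:R km0 kmp => K K0 K1.
      by field; rewrite (gt_eqF K0) (gt_eqF K1).
    rewrite ler_wpM2l ?(ltW m0R)// lef_pV2 ?posrE ?exprn_gt0 ?mulr_gt0//.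
    by rewrite expr2 ler_wpM2l ?(ltW km0)// kmE; lra.
  have bD : b k `^ (D - 1) = k%:R `^ (D - 1) * (k + m)%:R `^ (1 - D).
    rewrite /b powRM ?invr_ge0 ?(ltW k0R) ?(ltW km0)// powRVl//.
    by rewrite opprB.
  have kmD : (k + m)%:R `^ (- 1 - D) = (k + m)%:R `^ (1 - D) / (k + m)%:R ^+ 2.
    rewrite -powR_invn ?(ltW km0)// -powRDp//; congr (_ `^ _).
    by ring.
  have bD0 : 0 <= D * b k `^ (D - 1) by rewrite mulr_ge0 ?powR_ge0 ?ltW.
  have h2 := ler_wpM2l bD0 diff.
  rewrite kmD [leLHS](_ : _ = D * b k `^ (D - 1) * (m%:R / (k + m)%:R ^+ 2)); last first.
    by rewrite bD; ring.
  by apply: (le_trans h2); move: h; lra.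
case: N N0 NM => // N _ NM.
case: M NM => // M NM.
rewrite big_add1/= telescope_sumr//; last exact: ltnW.
rewrite (@le_trans _ _ (b M `^ D))//; first by rewrite gerBl powR_ge0.
rewrite -[leRHS](powRr0 (b M)); have := b1 M; have := b0 M.
rewrite le_eqVlt => /predU1P[<-|bM0 bM1].
  by rewrite powR0 ?gt_eqF// powR_ge0.
by rewrite ger_powR ?bM0// ltW.
Qed.

Lemma norm_le_near (t g e : R) : 0 <= g -> `|t - g| <= e * g ->
  `|t| <= (1 + e) * g.
Proof.
move=> g0 tg; rewrite mulrDl mul1r -{1}(subrK g t) addrC.
by rewrite (le_trans (ler_normD _ _))// (ger0_norm g0) lerD2l.
Qed.

Lemma cube_le (e delta : R) : 0 <= e -> e <= delta / 7 -> delta <= 1 ->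
  (1 + e) ^+ 3 <= 1 + delta.
Proof.
move=> e0 ed d1; have e2 : e ^+ 2 <= e by rewrite expr2 ler_piMl//; lra.
have e3 : e ^+ 3 <= e by rewrite exprS (le_trans (ler_wpM2l e0 e2))// -expr2.
rewrite (_ : (1 + e) ^+ 3 = 1 + 3 * e + 3 * e ^+ 2 + e ^+ 3); last by ring.
by lra.
Qed.

(** Both [(1 + e) ^+ 3] and [d / D] are at most [1 + delta], and the square of that is at most
    [1 + 3 * delta]; the value of [delta] makes [3 * delta] equal to [(1 - sn) / 4]. *)
Lemma constant_le (sn delta d D e : R) : 0 < d -> 0 <= sn -> sn < 1 ->
  delta = (1 - sn) / 12 -> D = d * (1 - delta / 7) ->
  0 <= e -> e <= delta / 7 ->
  (1 + e) ^+ 3 * (d / D) * sn <= sn + (1 - sn) / 4.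
Proof.
move=> d0 sn0 sn1 dE DE e0 ed.
have delta0 : 0 < delta by lra.
have delta1 : delta <= 1 / 12 by lra.
have D0 : 0 < D by rewrite DE mulr_gt0//; lra.
have h3 : (1 + e) ^+ 3 <= 1 + delta by apply: cube_le => //; lra.
have dD : d / D <= 1 + delta.
  rewrite ler_pdivrMr// DE mulrCA ler_peMr ?(ltW d0)//.
  have : delta ^+ 2 <= delta by rewrite expr2 ler_piMl//; lra.
  by lra.
apply: (@le_trans _ _ ((1 + delta) * (1 + delta) * sn)).
  apply: ler_wpM2r => //; apply: ler_pM => //.
    by apply: exprn_ge0; lra.
  by rewrite divr_ge0// ltW.
apply: (@le_trans _ _ ((1 + 3 * delta) * sn)).
  apply: ler_wpM2r => //.
  have : delta ^+ 2 <= delta by rewrite expr2 ler_piMl//; lra.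
  by lra.
have : delta * sn <= delta by rewrite ler_piMr// ltW.
by lra.
Qed.

(** The approximations of [c] and [a] and Potter's bound for [L k / L (k + m)] cost one factor
    [1 + e] each. The power of [(k + m) / k] in Potter's bound lowers [d] to [D = d - e], and
    [beta_sum_le] then sums the terms from [N] on to at most [G / (m * D)]. The [N] early terms are
    O(m^(-y)) with [y > 1], negligible against 1 / m. *)
Lemma cross_le_div (c a L : nat -> R) (d sn Cc Ca y : R) :
  0 < d -> d < 1 -> 0 <= sn -> sn < 1 ->
  (exists N, forall n, (N <= n)%N -> 0 < L n) ->
  asymp_equiv c (fun n => n%:R `^ (- (1 - d)) * L n) ->
  asymp_equiv a (fun n => n%:R `^ (- (1 + d)) * (L n)^-1 * (d * sn / pi)) ->
  potter L ->
  (forall k, `|c k| <= Cc) -> (forall k, `|a k| <= Ca * pw y k) -> 1 < y ->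
  exists B N, B * pi < 1 /\
    forall m, (N <= m)%N -> `|cross c a m| <= B / m%:R.
Proof.
move=> d0 d1 sn0 sn1 [N1 L0] cL aL LP cC aC y1.
have pi0 : 0 < pi :> R by exact: pi_gt0.
have Cc0 : 0 <= Cc by exact: le_trans (cC 0%N).
have Ca0 : 0 <= Ca by rewrite -(pmulr_lge0 _ (pw_gt0 y 0)) (le_trans _ (aC 0%N)).
pose delta := (1 - sn) / 12.
have delta0 : 0 < delta by rewrite /delta; lra.
have delta1 : delta <= 1 / 12 by rewrite /delta; lra.
pose e := d * (delta / 7).
have e0 : 0 < e by rewrite mulr_gt0// divr_gt0.
have ed : e <= delta / 7 by rewrite /e ler_piMl ?ltW// divr_gt0.
pose D := d - e.
have eE : D = d * (1 - delta / 7) by rewrite /D /e; ring.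
have D0 : 0 < D by rewrite eE mulr_gt0//; lra.
have D1 : D <= 1 by rewrite /D; lra.
have [N2 cN] := cL _ e0; have [N3 aN] := aL _ e0; have [N4 LN] := LP _ e0.
pose N := maxn 1 (maxn (maxn N1 N2) (maxn N3 N4)).
have [NN1 NN2 NN3 NN4 N0] : [/\ (N1 <= N)%N, (N2 <= N)%N, (N3 <= N)%N, (N4 <= N)%N & (0 < N)%N].
  by rewrite /N; split; rewrite !leq_max leqnn ?orbT.
clearbody N.
pose G := (1 + e) ^+ 3 * (d * sn / pi).
have e1 : 0 <= 1 + e by rewrite addr_ge0// ltW.
have dsn : 0 <= d * sn / pi.
  by apply: divr_ge0; [apply: mulr_ge0 => //; exact: ltW|exact: ltW].
have G0 : 0 <= G by apply: mulr_ge0 => //; exact: exprn_ge0.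
have term k m : (N <= k)%N -> (0 < m)%N ->
    `|c k * a (k + m)%N| <= G * (k%:R `^ (D - 1) * (k + m)%:R `^ (- 1 - D)).
  move=> Nk m0; have k0 : (0 < k)%N by exact: leq_trans Nk.
  have k0R : 0 < k%:R :> R by rewrite ltr0n.
  have km0 : 0 < (k + m)%:R :> R by rewrite ltr0n addn_gt0 k0.
  have Lk0 : 0 < L k by apply: L0; exact: leq_trans Nk.
  have Nkm : (N <= k + m)%N by rewrite (leq_trans Nk)// leq_addr.
  have Lm0 : 0 < L (k + m)%N by apply: L0; exact: leq_trans Nkm.
  have ck : `|c k| <= (1 + e) * (k%:R `^ (- (1 - d)) * L k).
    by apply: (norm_le_near _ (cN k (leq_trans NN2 Nk))); rewrite mulr_ge0 ?powR_ge0 ?ltW.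
  have ak : `|a (k + m)%N| <= (1 + e) *
      ((k + m)%:R `^ (- (1 + d)) * (L (k + m)%N)^-1 * (d * sn / pi)).
    apply: (norm_le_near _ (aN (k + m)%N (leq_trans NN3 Nkm))).
    by apply: mulr_ge0 => //; rewrite mulr_ge0 ?powR_ge0// invr_ge0 ltW.
  have [_ LL] := LN k (k + m)%N (leq_trans NN4 Nk) (leq_addr _ _).
  have LL' : L k / L (k + m)%N <= (1 + e) * ((k + m)%:R `^ e * k%:R `^ (- e)).
    rewrite ler_pdivrMr// (le_trans LL)// ler_wpM2r ?(ltW Lm0)//.
    rewrite ler_wpM2l//.
    by rewrite powRM ?invr_ge0 ?(ltW k0R) ?(ltW km0)// powRVl.
  rewrite normrM (le_trans (ler_pM _ _ ck ak))//.
  rewrite [leLHS](_ : _ = (1 + e) ^+ 2 * (d * sn / pi) * (k%:R `^ (- (1 - d)) *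
    (k + m)%:R `^ (- (1 + d))) * (L k / L (k + m)%N)); last by rewrite expr2; ring.
  have kE : k%:R `^ (D - 1) = k%:R `^ (- (1 - d)) * k%:R `^ (- e).
    by rewrite -powRDp//; congr (_ `^ _); rewrite /D; ring.
  have kmE : (k + m)%:R `^ (- 1 - D) = (k + m)%:R `^ (- (1 + d)) * (k + m)%:R `^ e.
    by rewrite -powRDp//; congr (_ `^ _); rewrite /D; ring.
  rewrite kE kmE [leRHS](_ : _ = (1 + e) ^+ 2 * (d * sn / pi) * (k%:R `^ (- (1 - d)) *
    (k + m)%:R `^ (- (1 + d))) * ((1 + e) * ((k + m)%:R `^ e * k%:R `^ (- e)))); last first.
    by rewrite /G; ring.
  apply: ler_wpM2l => //; apply: mulr_ge0.
    by apply: mulr_ge0 => //; exact: exprn_ge0.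
  by rewrite mulr_ge0 ?powR_ge0.
have GD : G / D <= (sn + (1 - sn) / 4) / pi.
  rewrite /G [leLHS](_ : _ = (1 + e) ^+ 3 * (d / D) * sn / pi); last by ring.
  rewrite ler_wpM2r ?invr_ge0 ?(ltW pi0)//.
  exact: (constant_le d0 sn0 sn1 erefl eE (ltW e0) ed).
pose H := N%:R * (Cc * Ca) + 1.
have H0 : 0 < H by rewrite ltr_wpDl// !mulr_ge0.
have eta0 : 0 < (1 - sn) / 4 / pi / H by rewrite !divr_gt0//; lra.
have [N5 pwN] := @pw_eventually_le (y - 1) _ ltac:(lra) eta0.
(* The head and the excess of the main sum receive [(1 - sn) / 4] each, so [B * pi] is the midpoint
   of [sn] and 1. *)
exists ((sn + (1 - sn) / 2) / pi), (maxn 1 N5); split.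
  by rewrite divfK ?gt_eqF//; lra.
move=> m; rewrite geq_max => /andP[m0 N5m]; have m0R : 0 < m%:R :> R by rewrite ltr0n.
apply: rsum_le => M.
apply: (@le_trans _ _ (\sum_(0 <= k < N + M) `|c k * a (k + m)%N|)).
  by rewrite addnC [leRHS](@big_cat_nat _ _ _ M)//= ?leq_addr// lerDl sumr_ge0.
rewrite (@big_cat_nat _ _ _ N)//= ?leq_addr//.
have head : \sum_(0 <= k < N) `|c k * a (k + m)%N| <= ((1 - sn) / 4 / pi) / m%:R.
  apply: (@le_trans _ _ (\sum_(0 <= k < N) Cc * (Ca * pw y m))).
    apply: ler_sum => k _; rewrite normrM ler_pM// (le_trans (aC _))//.
    by rewrite ler_wpM2l// pw_le ?leq_addl//; lra.
  rewrite sumr_const_nat subn0 -[_ *+ N]mulr_natl ler_pdivlMr//.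
  apply: (@le_trans _ _ (H * pw (y - 1) m)).
    rewrite /pw opprB addrC powRDp// powRr1// -/(pw y m).
    rewrite [leLHS](_ : _ = (N%:R * (Cc * Ca)) * (pw y m * m%:R)); last by ring.
    apply: ler_pM; rewrite ?mulr_ge0 ?pw_ge0//; first by rewrite /H lerDl.
    by rewrite ler_wpM2l ?pw_ge0// ler_nat.
  apply: (le_trans (ler_wpM2l (ltW H0) (pwN m N5m))).
  by rewrite mulrC divfK ?gt_eqF.
have tl : \sum_(N <= k < N + M) `|c k * a (k + m)%N| <= (G / D) / m%:R.
  apply: (@le_trans _ _ (\sum_(N <= k < N + M) G * (k%:R `^ (D - 1) * (k + m)%:R `^ (- 1 - D)))).
    by rewrite big_nat [leRHS]big_nat; apply: ler_sum => k /andP[Nk _]; exact: term.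
  rewrite -mulr_sumr -mulrA -invfM ler_wpM2l// [D * _]mulrC.
  exact: beta_sum_le.
apply: (le_trans (lerD head tl)).
rewrite -mulrDl ler_wpM2r ?invr_ge0 ?(ltW m0R)//.
apply: (le_trans (lerD (lexx _) GD)).
by rewrite -mulrDl ler_wpM2r ?invr_ge0 ?(ltW pi0)//; lra.
Qed.

End CrossBound.

(** * From the normal equations to the tail inequality *)

Section BaxterInequality.
Context {R : realType}.

Lemma potterV (L : nat -> R) : (exists N, forall n, (N <= n)%N -> 0 < L n) ->
  potter L -> potter (fun n => (L n)^-1).
Proof.
move=> [N1 L0] LP e e0; have [N2 LN] := LP e e0.
exists (maxn N1 N2) => k m; rewrite geq_max => /andP[Nk1 Nk2] km.
have Lk := L0 _ Nk1; have Lm := L0 _ (leq_trans Nk1 km).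
have [h1 h2] := LN k m Nk2 km.
by split; rewrite ler_pdivlMr// mulrC ler_pdivrMr.
Qed.

Variables (c a L : nat -> R) (d sn : R).
Hypothesis d_range : 0 < d < 1 / 2.
Hypothesis sn_range : 0 < sn < 1.
Hypothesis L_gt0 : exists N, forall n, (N <= n)%N -> 0 < L n.
Hypothesis L_potter : potter L.
Hypothesis c_equiv : asymp_equiv c (fun n => n%:R `^ (- (1 - d)) * L n).
Hypothesis a_equiv : asymp_equiv a
  (fun n => n%:R `^ (- (1 + d)) * (L n)^-1 * (d * sn / pi)).

(** A loss small against both [d] and [1 / 2 - d]. The true exponents of [c], [a] and the
    autocovariance are 1 - d, 1 + d and 1 - 2d; with the losses below, [2 * x - mu = 1 + e],
    [y + mu = 2 - d - 4 * e] and [x + y = 2 - 2 * e]. *)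
Let e := d * ((1 / 2 - d) / 5).

Let e_range : [/\ 0 < e, 10 * e <= d & 10 * e <= 1 / 2 - d].
Proof.
have /andP[d0 d1] := d_range.
have e0 : 0 < e by rewrite mulr_gt0//; lra.
have h1 : e <= d * (1 / 10) by rewrite ler_wpM2l ?(ltW d0)//; lra.
have h2 : e <= 1 / 2 * ((1 / 2 - d) / 5).
  by apply: ler_wpM2r; lra.
by split=> //; lra.
Qed.

Let x := 1 - d - e.
Let y := 1 + d - e.
Let mu := 1 - 2 * d - 3 * e.

Let exponents :
  [/\ 1 < y, 0 <= mu, mu <= x & [/\ 1 < 2 * x - mu, 3 / 2 < y + mu & 7 / 4 < x + y]].
Proof.
have [e0 ed ed'] := e_range; have /andP[d0 d1] := d_range.
by rewrite /x /y /mu; split; [lra|lra|lra|split; lra].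
Qed.

Let side_conditions : [/\ 0 <= x, d < 1 & 1 < 1 + d + e < 2].
Proof.
have [e0 ed ed'] := e_range; have /andP[d0 d1] := d_range.
by rewrite /x; split; [lra|lra|apply/andP; split; lra].
Qed.

Lemma ma_power_bound : exists2 C, 0 < C & forall k, `|c k| <= C * pw x k.
Proof.
have [e0 ed ed'] := e_range; have /andP[d0 d1] := d_range.
apply: upper_regular_le; apply: (@ratio_upper _ _ L (1 - d) 1) => //; last by lra.
by under [X in asymp_equiv _ X]eq_fun do rewrite mulr1.
Qed.

Let C1 := d * sn / pi.

Let C1_gt0 : 0 < C1.
Proof.
have /andP[d0 d1] := d_range; have /andP[s0 s1] := sn_range.
by rewrite divr_gt0 ?mulr_gt0 ?pi_gt0.
Qed.

Let LV_gt0 : exists N, forall n, (N <= n)%N -> 0 < (L n)^-1.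
Proof. by have [N LN] := L_gt0; exists N => n /LN; rewrite invr_gt0. Qed.

Let a_upper : upper_regular a y.
Proof.
have [e0 ed ed'] := e_range; have /andP[d0 d1] := d_range.
apply: (@ratio_upper _ _ (fun n => (L n)^-1) (1 + d) C1) => //; last by lra.
exact: potterV.
Qed.

Let a_lower : lower_regular a (1 + d + e).
Proof.
have [e0 ed ed'] := e_range; have /andP[d0 d1] := d_range.
apply: (@ratio_lower _ _ (fun n => (L n)^-1) (1 + d) C1) => //; last by lra.
exact: potterV.
Qed.

Lemma ar_power_bound : exists2 C, 0 < C & forall k, `|a k| <= C * pw y k.
Proof. exact: upper_regular_le. Qed.

Lemma ar_abs_summable : abs_summable a.
Proof.
have [Ca _ aC] := ar_power_bound.
apply: (@abs_summable_pw _ _ Ca (y - 1)); last by move=> k; rewrite subrK.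
by have [y1 _ _ _] := exponents; lra.
Qed.

Lemma ma_square_abs_summable : abs_summable (fun k => c k ^+ 2).
Proof. by have [Cc _ cC] := ma_power_bound; exact: ma_square_summable cC exponents. Qed.

Hypothesis conv_ac :
  forall m, \sum_(0 <= i < m.+1) a i * c (m - i)%N = - (m == 0%N)%:R.
Variable phi : nat -> nat -> R.
Hypothesis phi_normal : forall n m, (1 <= m <= n)%N ->
  acov c m = \sum_(1 <= j < n.+1) phi n j * acov c `|m%:Z - j%:Z|%N.

Let u n j : R := if j == 0%N then 1 else - phi n j.

Let u_normal n m : (1 <= m <= n)%N -> fpot c Posz n (u n) m%:Z = 0.
Proof.
move=> mn; rewrite /fpot big_ltn// /u eqxx mul1r subr0 (phi_normal mn) -big_split/=.
by rewrite big_nat big1// => j /andP[j0 _]; rewrite gtn_eqF// mulNr subrr.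
Qed.

(** In [coef_formula] the part [c 0] of [rleft 0] produces exactly the infinite predictor
    coefficient. What remains is at most [M] times [|a j|], the tail beyond [j], and the tail beyond
    [n - j]; summed over [j], the last two each give at most the sum of the first [n] tails. *)
Lemma predictor_gap n (M : R) : (0 < n)%N ->
  (forall i, `|qright c a n (u n) i| <= M) ->
  (forall k, (0 < k)%N -> `|rleft c a n (u n) k| <= M) ->
  `|rleft c a n (u n) 0%N - c 0%N| <= M ->
  \sum_(1 <= j < n.+1) `|phi n j - c 0%N * a j| <=
    M * (rsum (fun k => `|a k|) + 2 * \sum_(0 <= j < n) tail a j).
Proof.
move=> n0; pose q := qright c a n (u n); pose r := rleft c a n (u n).
rewrite -/q -/r => qM rM r0M; have a_sum := ar_abs_summable.
have M0 : 0 <= M by exact: le_trans (qM 0%N).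
have rB k : `|r k| <= M + `|c 0%N|.
  case: k => [|k]; last by rewrite (le_trans (rM k.+1 _))// lerDl.
  by rewrite -{1}(subrK (c 0%N) (r 0%N)) (le_trans (ler_normD _ _))// lerD2r.
have sar (g : nat -> R) B j : (forall k, `|g k| <= B) -> 0 <= B ->
    abs_summable (fun k => a (j + k)%N * g k).
  move=> gB B0; apply: (@abs_summable_dom _ _ (fun k => B * a (j + k)%N)).
    by move=> k; rewrite !normrM (ger0_norm B0) mulrC ler_wpM2r.
  by apply: abs_summableZ; exact: abs_summable_shift.
have bnd (g : nat -> R) j : (forall k, `|g k| <= M) ->
    `|rsum (fun k => a (j + k)%N * g k)| <= M * rsum (fun k => `|a (j + k)%N|).
  move=> gM; rewrite -rsumZ; last by apply: abs_summable_norm; exact: abs_summable_shift.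
  rewrite (le_trans (ler_norm_rsum (sar g M j gM M0)))//.
  apply: ler_rsum.
  - by apply: abs_summable_norm; exact: sar gM M0.
  - by apply: abs_summableZ; apply: abs_summable_norm; exact: abs_summable_shift.
  - by move=> k; rewrite normrM mulrC ler_wpM2r.
have term j : (1 <= j <= n)%N -> `|phi n j - c 0%N * a j| <=
    M * `|a j| + M * tail a j + M * tail a (n - j).
  move=> jn; have j0 : (0 < j)%N by case/andP: jn.
  have h := coef_formula conv_ac a_sum ma_square_abs_summable (@u_normal n) jn rB.
  rewrite {1}/u gtn_eqF// in h.
  have sr : abs_summable (fun k => a (j + k)%N * r k) by apply: sar rB _; rewrite addr_ge0.
  have E : phi n j - c 0%N * a j = a j * (r 0%N - c 0%N) +
      rsum (fun k => a (j.+1 + k)%N * r k.+1) +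
      rsum (fun s => a (n.+1 - j + s)%N * q s).
    move: h; rewrite (rsum_shift 1 sr) big_nat1 addn0.
    rewrite (_ : (fun k => a (j + (1 + k))%N * r (1 + k)%N) =
      (fun k => a (j.+1 + k)%N * r k.+1)).
      by rewrite -/q; lra.
    by apply/funext => k; rewrite addnA addn1.
  rewrite E (le_trans (ler_normD _ _))// lerD//; last first.
    rewrite (_ : (n.+1 - j)%N = (n - j).+1); first exact: bnd.
    by rewrite subSn//; case/andP: jn.
  rewrite (le_trans (ler_normD _ _))// lerD//.
    by rewrite normrM mulrC ler_wpM2r.
  by apply: bnd => k; exact: rM.
apply: (@le_trans _ _ (\sum_(1 <= j < n.+1)
    (M * `|a j| + M * tail a j + M * tail a (n - j)))).
  by rewrite big_nat [leRHS]big_nat; apply: ler_sum => j; exact: term.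
rewrite !big_split/= -!mulr_sumr -!mulrDr ler_wpM2l// -addrA lerD//.
  rewrite (le_trans _ (series_le_rsum n.+1 _ (abs_summable_norm a_sum)))//.
  by rewrite [leRHS]big_ltn// lerDr.
rewrite mulr_natl mulr2n lerD//.
  rewrite big_add1/=; apply: ler_sum => j _.
  rewrite /tail [leRHS](rsum_shift 1).
    rewrite big_nat1 (_ : (fun k => `|a (j.+1 + (1 + k))%N|) = (fun k => `|a (j.+2 + k)%N|)).
      by rewrite lerDr.
    by apply/funext => k; rewrite addnA addn1.
  by apply: abs_summable_norm; exact: abs_summable_shift.
rewrite big_add1/= big_nat_rev/= add0n big_nat [leRHS]big_nat.
rewrite le_eqVlt; apply/orP; left; apply/eqP; apply: eq_bigr => j /andP[_ jn].
by congr (tail a _); lia.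
Qed.

Theorem baxter_of_normal_equations : exists2 M, 0 < M & forall n, (0 < n)%N ->
  \sum_(1 <= j < n.+1) `|phi n j - c 0%N * a j| <= M * tail (fun k => c 0%N * a k) n.
Proof.
have [x0 d1 e12] := side_conditions; have /andP[d0 _] := d_range.
have /andP[s0 s1] := sn_range.
have a_sum := ar_abs_summable.
have [Cc Cc0 cC] := ma_power_bound; have [Ca Ca0 aC] := ar_power_bound.
have [y1 mu0 mux [xmu ymu xy]] := exponents.
have c00 : c 0%N != 0.
  apply/eqP => c0; have := conv_ac 0; rewrite big_nat1 subnn c0 mulr0 eqxx.
  by move=> /eqP; rewrite eq_sym oppr_eq0 oner_eq0.
have [B [N1 [Bpi crossB]]] := @cross_le_div _ c a L d sn Cc Ca y d0
  d1 (ltW s0) s1 L_gt0 c_equiv a_equiv L_potter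
  (fun k => le_trans (cC k) (ler_piMr (ltW Cc0) (pw_le1 k x0))) aC y1.
have [M2 [N2 [M20 tl]]] := tail_sum_le a_upper a_lower a_sum (conj y1 e12).
have [K3 [N3 [K30 up]]] := tail_lower a_lower a_sum (conj y1 e12).
(* Positivity for every [n], not only for large ones, allows [eventually_le_all] to cover the [n]
   below the threshold. *)
have tail0 n : 0 < tail (fun k => c 0%N * a k) n.
  have [aN _] := up (n + N3).+1 (leq_trans (leq_addl n N3) (leqnSn _)).
  apply: (@lt_le_trans _ _ (`|c 0%N * a (n + N3).+1|)).
    by rewrite normr_gt0 mulf_neq0// gt_eqF.
  have sca : abs_summable (fun k => c 0%N * a k) by exact: abs_summableZ.
  rewrite (le_trans _ (series_le_rsum N3.+1 _ (tail_summable sca n)))//.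
  by rewrite big_nat_recr//= addSn lerDr sumr_ge0.
have tailE n : tail (fun k => c 0%N * a k) n = `|c 0%N| * tail a n.
  rewrite /tail -rsumZ; last exact: tail_summable.
  by apply: eq_rsum => k; rewrite normrM.
pose D := B / (1 - (B * pi) ^+ 2).
pose A := rsum (fun k => `|a k|).
have A0 : 0 <= A by apply: rsum_ge0 => //; exact: abs_summable_norm.
pose N := maxn (maxn N1 N2) (maxn 1 (Num.trunc (4 * D)).+1).
suff main n : (N <= n)%N -> \sum_(1 <= j < n.+1) `|phi n j - c 0%N * a j| <=
    8 * D * M2 * (A + 2) * tail (fun k => c 0%N * a k) n.
  by have [M M0 hM] := eventually_le_all tail0 main; exists M => // n _; exact: hM.
rewrite /N !geq_max => /andP[/andP[nN1 nN2] /andP[n0 nD]].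
pose s : R := n%:R / 2.
have sD : 2 * D <= s.
  have : 4 * D <= n%:R.
    by rewrite (le_trans (ltW (truncnS_gt _)))// ler_nat.
  by rewrite /s; lra.
have n0R : 0 < n%:R :> R by rewrite ltr0n.
have s_gt0 : 0 < s by rewrite /s divr_gt0.
have c2_sum := ma_square_abs_summable.
have crossn m : (n < m)%N -> `|cross c a m| <= B / m%:R.
  by move=> nm; apply: crossB; exact: leq_trans nN1 (ltnW nm).
have [q_le r_le r0_le] := contraction_conclusion
  (rleft_cross cC aC exponents conv_ac (@u_normal n))
  (qright_cross cC aC exponents conv_ac (@u_normal n))
  (qright_decay cC aC exponents conv_ac (@u_normal n))
  (rleft_decay cC aC exponents conv_ac (@u_normal n))
  crossn n0 Bpi sD.
rewrite {1 2}/u eqxx mul1r in r0_le.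
rewrite /u eqxx mul1r in q_le r_le r0_le.
rewrite (le_trans (predictor_gap n0 q_le r_le r0_le))//.
have [t1 t2] := tl n nN2; rewrite tailE.
set M := 2 * _ * _ / _.
have M0 : 0 <= M by exact: le_trans (q_le 0%N).
(* The two parts of [tail_sum_le] bound the sum of tails and the constant [A] by multiples of
   [n.+1 * tail a n]. The factor [n.+1] cancels the 1 / s in [M], as [n.+1 / s <= 4]; this is how 2
   becomes 8 in the constant. *)
apply: (@le_trans _ _ (M * ((A + 2) * (M2 * (n.+1%:R * tail a n))))).
  by rewrite ler_wpM2l// [leRHS]mulrDl lerD ?ler_peMr// ler_wpM2l.
rewrite /M -/s -/D.
rewrite [leLHS](_ : _ = 2 * D * `|c 0%N| * (A + 2) * M2 * tail a n * (n.+1%:R / s)); last by ring.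
rewrite [leRHS](_ : _ = 2 * D * `|c 0%N| * (A + 2) * M2 * tail a n * 4); last by ring.
have B0 : 0 <= B.
  by have := le_trans (normr_ge0 _) (crossn _ (ltnSn n)); rewrite pmulr_lge0.
have D0 : 0 <= D.
  by rewrite /D divr_ge0// subr_ge0 expr_le1 ?mulr_ge0 ?pi_ge0// ltW.
have tail_n0 : 0 <= tail a n by exact: tail_ge0.
have A2 : 0 <= A + 2 by rewrite addr_ge0.
apply: ler_wpM2l.
  by apply: mulr_ge0 => //; rewrite mulr_ge0 ?(ltW M20)// mulr_ge0// mulr_ge0// mulr_ge0.
rewrite ler_pdivrMr// /s -natr1.
have : 1 <= n%:R :> R by rewrite ler1n.
by lra.
Qed.

End BaxterInequality.

(** * Poisson kernels and the Szego function *)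

Section CircleIntegrals.
Context {R : realType}.
Implicit Types (f g : R -> R) (b w x : R) (k n : nat).
Notation mu := (@lebesgue_measure R).
Notation circle := (`[- pi, pi]%classic : set R).

Lemma lebesgue_circle : mu circle = (2 * pi)%:E.
Proof.
rewrite lebesgue_measure_itv/= lte_fin gtrN ?pi_gt0// -EFinB; congr EFin; lra.
Qed.

Lemma continuous_circle_integrable (f : R -> R) :
  continuous f -> mu.-integrable circle (EFin \o f).
Proof.
move=> cf; apply: continuous_compact_integrable; first exact: segment_compact.
exact: continuous_subspaceT.
Qed.

Definition circle_integrable (f : R -> R) := mu.-integrable circle (EFin \o f).

Lemma circle_integrableD f g : circle_integrable f -> circle_integrable g ->
  circle_integrable (fun x => f x + g x).
Proof.
move=> fi gi; rewrite /circle_integrable.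
have -> : EFin \o (fun x => f x + g x) = ((EFin \o f) \+ (EFin \o g))%E.
  by apply/funext => x /=; rewrite EFinD.
exact: integrableD.
Qed.

Lemma circle_integrableB f g : circle_integrable f -> circle_integrable g ->
  circle_integrable (fun x => f x - g x).
Proof.
move=> fi gi; rewrite /circle_integrable.
have -> : EFin \o (fun x => f x - g x) = ((EFin \o f) \- (EFin \o g))%E.
  by apply/funext => x /=; rewrite EFinB.
exact: integrableB.
Qed.

Lemma circle_integrableZ w f : circle_integrable f ->
  circle_integrable (fun x => w * f x).
Proof.
move=> fi; rewrite /circle_integrable.
have -> : EFin \o (fun x => w * f x) = (fun x => w%:E * (EFin \o f) x)%E.
  by apply/funext => x /=; rewrite EFinM.
exact: integrableZl.
Qed.

Lemma circle_integrable_norm f : circle_integrable f ->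
  circle_integrable (fun x => `|f x|).
Proof. exact: integrable_norm. Qed.

Lemma circle_integrable_cst w : circle_integrable (fun=> w).
Proof. by apply: continuous_circle_integrable; exact: cst_continuous. Qed.

Lemma circle_integrable_measurable f : circle_integrable f -> measurable_fun circle f.
Proof. by move=> /integrableP[/measurable_EFinP]. Qed.

Lemma circle_integrable_le f g : measurable_fun circle f ->
  (forall x, circle x -> `|f x| <= g x) -> circle_integrable g ->
  circle_integrable f.
Proof.
move=> mf fg; apply: le_integrable => //; first exact/measurable_EFinP.
by move=> x xI /=; rewrite lee_fin (le_trans (fg x xI))// ler_norm.
Qed.

Lemma circle_integrableMl f g C : measurable_fun circle f ->
  (forall x, circle x -> `|f x| <= C) -> circle_integrable g ->
  circle_integrable (fun x => f x * g x).
Proof.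
move=> mf fC gi; apply: (@circle_integrable_le _ (fun x => C * `|g x|)).
- by apply: measurable_funM => //; exact: circle_integrable_measurable.
- by move=> x xI; rewrite normrM ler_wpM2r// fC.
- by apply: circle_integrableZ; exact: circle_integrable_norm.
Qed.

Lemma circle_integral_cst w : \int[mu]_(x in circle) w = 2 * pi * w.
Proof. by rewrite Rintegral_cst// [X in fine X]lebesgue_circle/= mulrC. Qed.

Lemma continuous_affine_comp (f : R -> R) w b : continuous f ->
  continuous (fun x => f (w * x + b)).
Proof.
move=> cf x; apply: (@continuous_comp _ _ _ (fun x => w * x + b) f).
  by apply: cvgD; [apply: cvgMr; exact: cvg_id|exact: cvg_cst].
exact: cf.
Qed.

Lemma circle_integral_cos w b : w != 0 -> sin (w * pi) = 0 ->
  \int[mu]_(x in circle) cos (w * x + b) = 0.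
Proof.
move=> w0 sw; pose F x := w^-1 * sin (w * x + b).
have dF x : is_derive x 1 F (cos (w * x + b)).
  have d1 : is_derive x 1 (fun x => w * x + b) w.
    have -> : (fun x => w * x + b) = (w \*: id) + cst b by [].
    by apply: is_derive_eq; rewrite addr0 [LHS]mulr1.
  have d2 := @is_derive1_comp _ sin (fun x => w * x + b) x _ _ (is_derive_sin _) d1.
  have -> : F = w^-1 \*: (sin \o (fun x => w * x + b)) by [].
  by apply: is_derive_eq; rewrite /GRing.scale/= mulrCA mulVf// mulr1.
have cF : continuous F.
  by move=> x; apply/differentiable_continuous/derivable1_diffP/ex_derive.
have E : (\int[mu]_(x in circle) (cos (w * x + b))%:E)%E = (F pi - F (- pi))%:E.
  rewrite (@continuous_FTC2 _ _ F).
  - by rewrite EFinB.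
  - by rewrite gtrN ?pi_gt0.
  - by apply: continuous_subspaceT; apply: continuous_affine_comp; exact: continuous_cos.
  - split.
    + by move=> x _; apply: ex_derive.
    + by apply: cvg_at_right_filter; exact: cF.
    + by apply: cvg_at_left_filter; exact: cF.
  - by move=> x _; rewrite derive1E derive_val.
rewrite /Rintegral E/= /F mulrN !sinD sinN cosN sw; ring.
Qed.

Lemma sin_intpi (m : int) : sin (m%:~R * pi) = 0 :> R.
Proof.
have nat_case k : sin (k%:R * pi) = 0 :> R.
  elim: k => [|k IHk]; first by rewrite mul0r sin0.
  by rewrite -natr1 mulrDl mul1r sinDpi IHk oppr0.
case: m => m; first exact: nat_case.
by rewrite NegzE mulrNz mulNr sinN nat_case oppr0.
Qed.

Lemma circle_integral_cos_int (m : int) b :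
  \int[mu]_(x in circle) cos (m%:~R * x + b) = (m == 0)%:R * (2 * pi * cos b).
Proof.
have [->|m0] := eqVneq m 0.
  under eq_Rintegral do rewrite mul0r add0r.
  by rewrite circle_integral_cst mul1r.
by rewrite circle_integral_cos ?mul0r ?intr_eq0// sin_intpi.
Qed.

Lemma cvg_circle_integral_unif (F : R -> R) (F_ : nat -> R -> R) (e_ : nat -> R) l :
  circle_integrable F -> (forall N, circle_integrable (F_ N)) ->
  (forall N x, `|F x - F_ N x| <= e_ N) -> e_ @ \oo --> (0 : R) ->
  (fun N => \int[mu]_(x in circle) F_ N x) @ \oo --> l ->
  \int[mu]_(x in circle) F x = l.
Proof.
move=> iF iF_ Fe e0 Fl.
suff : (fun N => \int[mu]_(x in circle) F_ N x) @ \oo --> \int[mu]_(x in circle) F x.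
  by move=> h; rewrite -(cvg_lim _ h)// -(cvg_lim _ Fl).
apply: cvg_sub0 (cvg_cst _).
apply: norm_cvg0.
have c0 : (fun N => 2 * pi * e_ N) @ \oo --> (0 : R).
  by rewrite -[X in _ --> X](mulr0 (2 * pi)); apply: cvgMr.
apply: (squeeze_cvgr _ (cvg_cst 0) c0).
apply: nearW => N; rewrite normr_ge0/= !fctE distrC -(RintegralB _ iF (iF_ N))//.
have iB := circle_integrableB iF (iF_ N).
rewrite (le_trans (le_normr_Rintegral _ iB))// -circle_integral_cst.
apply: le_Rintegral => //.
- exact: (integrable_norm iB).
- exact: circle_integrable_cst.
Qed.

End CircleIntegrals.

Section PoissonKernel.
Context {R : realType}.
Notation mu := (@lebesgue_measure R).
Notation circle := (`[- pi, pi]%classic : set R).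
Implicit Types (x t : R) (f g : R -> R).

Lemma cos_lipschitz x t : `|cos x - cos t| <= `|x - t|.
Proof.
wlog xt : x t / x < t => [h|].
  have [xt|tx|->] := ltgtP x t; first exact: h.
    by rewrite distrC [leRHS]distrC h.
  by rewrite !subrr.
have [z _ E] : exists2 z, z \in `]x, t[ & cos t - cos x = - sin z * (t - x).
  apply: MVT => //; apply: continuous_subspaceT; exact: continuous_cos.
by rewrite distrC E normrM normrN [leRHS]distrC ler_piMl// sin_max.
Qed.

Variable r : R.
Hypothesis r_range : 0 <= r < 1.

(** The squared distance |e^(ix) - r|^2. *)
Definition pden x := 1 - 2 * r * cos x + r ^+ 2.

Definition pkernel x := (1 - r ^+ 2) / pden x.

Let r0 : 0 <= r. Proof. by case/andP: r_range. Qed.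
Let r1 : r < 1. Proof. by case/andP: r_range. Qed.
Let r10 : 0 < 1 - r. Proof. by rewrite subr_gt0. Qed.

Lemma pdenE x : pden x = (1 - r) ^+ 2 + 2 * r * (1 - cos x).
Proof. by rewrite /pden; ring. Qed.

Lemma pden_ge x : (1 - r) ^+ 2 <= pden x.
Proof. by rewrite pdenE lerDl !mulr_ge0// subr_ge0 cos_le1. Qed.

Lemma pden_gt0 x : 0 < pden x.
Proof. by rewrite (lt_le_trans _ (pden_ge x))// exprn_gt0. Qed.

Let num_ge0 : 0 <= 1 - r ^+ 2.
Proof. by rewrite subr_ge0 expr_le1// ltW. Qed.

Lemma pkernel_ge0 x : 0 <= pkernel x.
Proof. by rewrite divr_ge0// ltW// pden_gt0. Qed.

Lemma pkernel_le x : pkernel x <= (1 - r ^+ 2) / (1 - r) ^+ 2.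
Proof.
by rewrite ler_wpM2l// lef_pV2 ?posrE ?pden_gt0 ?exprn_gt0// pden_ge.
Qed.

Lemma pkernelN x : pkernel (- x) = pkernel x.
Proof. by rewrite /pkernel /pden cosN. Qed.

Definition plip := (1 - r ^+ 2) * (2 * r) / (1 - r) ^+ 4.

Lemma pkernel_lipschitz x t : `|pkernel x - pkernel t| <= plip * `|x - t|.
Proof.
have dx := pden_gt0 x; have dt := pden_gt0 t.
have -> : pkernel x - pkernel t =
    (1 - r ^+ 2) * (2 * r) / (pden x * pden t) * (cos x - cos t).
  have -> : (1 - r ^+ 2) * (2 * r) / (pden x * pden t) * (cos x - cos t) =
      (1 - r ^+ 2) * (pden t - pden x) / (pden x * pden t).
    have -> : pden t - pden x = 2 * r * (cos x - cos t) by rewrite /pden; ring.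
    by ring.
  by rewrite /pkernel; field; rewrite !gt_eqF.
have A0 : 0 <= (1 - r ^+ 2) * (2 * r) by rewrite !mulr_ge0.
rewrite normrM; apply: ler_pM => //; last exact: cos_lipschitz.
rewrite ger0_norm ?divr_ge0 ?mulr_ge0 ?(ltW dx) ?(ltW dt)//.
rewrite ler_wpM2l// lef_pV2 ?posrE ?mulr_gt0 ?exprn_gt0//.
by rewrite (exprD _ 2 2) ler_pM ?exprn_ge0 ?(ltW r10)// pden_ge.
Qed.

Lemma lipschitz_continuous f (C : R) :
  (forall x t, `|f x - f t| <= C * `|x - t|) -> continuous f.
Proof.
move=> fC x; apply/cvgrPdist_le => /= e e0.
have C1 : 0 < `|C| + 1 by rewrite ltr_wpDl.
near=> t; apply: (le_trans (fC x t)).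
apply: (@le_trans _ _ ((`|C| + 1) * `|x - t|)).
  by rewrite ler_wpM2r// (le_trans (ler_norm C))// lerDl.
rewrite -ler_pdivlMl// mulrC; near: t.
have d0 : 0 < e / (`|C| + 1) by rewrite divr_gt0.
by apply: filterS (nbhsx_ballx x _ d0) => t /ltW.
Unshelve. all: by end_near. Qed.

Lemma continuous_pkernel : continuous pkernel.
Proof. exact: lipschitz_continuous pkernel_lipschitz. Qed.

Let psum N x := 1 + \sum_(0 <= k < N) 2 * r ^+ k.+1 * cos (k.+1%:R * x).

(** [psum] is a partial cosine series of the Poisson kernel. Multiplied by [pden] it telescopes,
    through the recurrence cos((N+2)x) = 2 cos x cos((N+1)x) - cos(Nx), and the remainder is small
    uniformly in [x]. *)
Let psumE N x : pden x * psum N x = 1 - r ^+ 2 -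
  2 * r ^+ N.+1 * cos (N.+1%:R * x) + 2 * r ^+ N.+2 * cos (N%:R * x).
Proof.
elim: N => [|N IHN].
  by rewrite /psum big_nil addr0 mulr1 mul1r mul0r cos0 /pden expr1; ring.
rewrite /psum big_nat_recr//= addrA mulrDr IHN.
have -> : cos (N.+2%:R * x) = 2 * (cos x * cos (N.+1%:R * x)) - cos (N%:R * x).
  have -> : N.+2%:R * x = N.+1%:R * x + x by rewrite -[N.+2%:R]natr1 mulrDl mul1r.
  have -> : N%:R * x = N.+1%:R * x - x by rewrite -natr1 mulrDl mul1r addrK.
  by rewrite cosD cosB; ring.
by rewrite /pden !exprS; ring.
Qed.

Let psum_near N x : `|pkernel x - psum N x| <= 4 * r ^+ N / (1 - r) ^+ 2.
Proof.
have dx := pden_gt0 x.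
have -> : pkernel x - psum N x =
   (2 * r ^+ N.+1 * cos (N.+1%:R * x) - 2 * r ^+ N.+2 * cos (N%:R * x)) / pden x.
  have -> : psum N x = (pden x * psum N x) / pden x.
    by rewrite mulrAC divff ?mul1r// gt_eqF.
  by rewrite psumE /pkernel -mulrBl; congr (_ / _); ring.
rewrite normrM; apply: ler_pM => //.
  have h m (y : R) : (N <= m)%N -> `|2 * r ^+ m * cos y| <= 2 * r ^+ N.
    move=> Nm; rewrite !normrM (ger0_norm (_ : 0 <= 2))// (ger0_norm (exprn_ge0 _ r0)).
    rewrite -[leRHS]mulr1 ler_pM ?mulr_ge0 ?exprn_ge0 ?cos_max// ler_wpM2l//.
    by rewrite ler_wiXn2l// ltW.
  rewrite (le_trans (ler_normB _ _))// (_ : 4 * r ^+ N = 2 * r ^+ N + 2 * r ^+ N); last by ring.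
  by rewrite lerD// h// leqW.
rewrite ger0_norm ?invr_ge0 ?(ltW dx)// lef_pV2 ?posrE ?exprn_gt0//.
exact: pden_ge.
Qed.

(** Integrating the uniformly convergent cosine series, only the constant term survives. The
    translate by [t] stays in the phases, so no periodic change of variables is needed. *)
Lemma pkernel_integral t : \int[mu]_(x in circle) pkernel (x - t) = 2 * pi.
Proof.
have ccont k : continuous (fun x => 2 * r ^+ k.+1 * cos (k.+1%:R * x - k.+1%:R * t)).
  move=> x; apply: cvgMr; apply: continuous_affine_comp; exact: continuous_cos.
have cint k := continuous_circle_integrable (ccont k).
pose S N x := 1 + \sum_(0 <= k < N) 2 * r ^+ k.+1 * cos (k.+1%:R * x - k.+1%:R * t).
have SE N x : psum N (x - t) = S N x.
  by congr (_ + _); apply: eq_bigr => k _; rewrite mulrBr.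
have iS N : circle_integrable (S N).
  elim: N => [|N IHN].
    rewrite (_ : S 0%N = fun=> 1); first exact: circle_integrable_cst.
    by apply/funext => x; rewrite /S big_nil addr0.
  rewrite (_ : S N.+1 = fun x => S N x + 2 * r ^+ N.+1 * cos (N.+1%:R * x - N.+1%:R * t)).
    exact: (circle_integrableD IHN (cint N)).
  by apply/funext => x; rewrite /S big_nat_recr//= addrA.
have SI N : \int[mu]_(x in circle) S N x = 2 * pi.
  elim: N => [|N IHN].
    rewrite -[RHS]mulr1 -circle_integral_cst; apply: eq_Rintegral => x _.
    by rewrite /S big_nil addr0.
  rewrite -[RHS]addr0 -{}IHN.
  transitivity (\int[mu]_(x in circle)
      (S N x + 2 * r ^+ N.+1 * cos (N.+1%:R * x - N.+1%:R * t))).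
    by apply: eq_Rintegral => x _; rewrite /S big_nat_recr//= addrA.
  rewrite RintegralD//; [congr (_ + _)|exact: iS].
  rewrite RintegralZl//; last first.
    apply: continuous_circle_integrable; apply: continuous_affine_comp.
    exact: continuous_cos.
  rewrite (_ : N.+1%:R = (N.+1%:Z)%:~R)//.
  by rewrite (circle_integral_cos_int N.+1%:Z) mul0r mulr0.
apply: (@cvg_circle_integral_unif _ _ S (fun N => 4 * r ^+ N / (1 - r) ^+ 2)).
- apply: continuous_circle_integrable => x.
  rewrite (_ : (fun x => pkernel (x - t)) = (fun x => pkernel (1 * x - t))).
    by apply: continuous_affine_comp; exact: continuous_pkernel.
  by apply/funext => z; rewrite mul1r.
- exact: iS.
- by move=> N x; rewrite -SE; exact: psum_near.
- rewrite (_ : 0 = 4 * 0 * ((1 - r) ^+ 2)^-1 :> R); last by rewrite mulr0 mul0r.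
  by apply: cvgMl; apply: cvgMr; apply: cvg_expr; rewrite ger0_norm.
- under eq_fun do rewrite SI.
  exact: cvg_cst.
Qed.

Lemma pkernel_integral_sym t : \int[mu]_(x in circle) pkernel (t - x) = 2 * pi.
Proof.
by rewrite -(pkernel_integral t); apply: eq_Rintegral => x _; rewrite -pkernelN opprB.
Qed.

End PoissonKernel.

Section PoissonOperator.
Context {R : realType}.
Notation mu := (@lebesgue_measure R).
Notation circle := (`[- pi, pi]%classic : set R).
Implicit Types (x t : R) (f g : R -> R).

Lemma EFin_circle_integral f : circle_integrable f ->
  (\int[mu]_(x in circle) (f x)%:E)%E = (\int[mu]_(x in circle) f x)%:E.
Proof.
by move=> fi; rewrite /Rintegral fineK//; exact: integrable_fin_num.
Qed.

Lemma circle_integral_le f g : circle_integrable f -> circle_integrable g ->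
  (forall x, circle x -> f x <= g x) ->
  \int[mu]_(x in circle) f x <= \int[mu]_(x in circle) g x.
Proof. by move=> fi gi fg; exact: le_Rintegral. Qed.

Lemma circle_integralD f g : circle_integrable f -> circle_integrable g ->
  \int[mu]_(x in circle) (f x + g x) =
  \int[mu]_(x in circle) f x + \int[mu]_(x in circle) g x.
Proof. by move=> fi gi; exact: RintegralD. Qed.

Lemma circle_integralB f g : circle_integrable f -> circle_integrable g ->
  \int[mu]_(x in circle) (f x - g x) =
  \int[mu]_(x in circle) f x - \int[mu]_(x in circle) g x.
Proof. by move=> fi gi; exact: RintegralB. Qed.

Lemma circle_integralZ (w : R) f : circle_integrable f ->
  \int[mu]_(x in circle) (w * f x) = w * \int[mu]_(x in circle) f x.
Proof. by move=> fi; exact: RintegralZl. Qed.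

Lemma circle_integral_norm_le f : circle_integrable f ->
  `|\int[mu]_(x in circle) f x| <= \int[mu]_(x in circle) `|f x|.
Proof. by move=> fi; exact: le_normr_Rintegral. Qed.

Definition poisson (r : R) f x : R :=
  (2 * pi)^-1 * \int[mu]_(t in circle) (pkernel r (t - x) * f t).

Let twopi : 0 < 2 * pi :> R. Proof. by rewrite mulr_gt0// pi_gt0. Qed.

Section FixedRadius.
Variable r : R.
Hypothesis r_range : 0 <= r < 1.

Lemma continuous_pkernel_shift x : continuous (fun t => pkernel r (t - x)).
Proof.
move=> t; rewrite (_ : (fun t => pkernel r (t - x)) = (fun t => pkernel r (1 * t - x))).
  by apply: continuous_affine_comp; exact: continuous_pkernel.
by apply/funext => z; rewrite mul1r.
Qed.

Let pk_le x : `|pkernel r x| <= (1 - r ^+ 2) / (1 - r) ^+ 2.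
Proof. by rewrite ger0_norm ?pkernel_ge0// pkernel_le. Qed.

Lemma circle_integrable_pkernel f x : circle_integrable f ->
  circle_integrable (fun t => pkernel r (t - x) * f t).
Proof.
move=> fi; apply: (@circle_integrableMl _ _ _ ((1 - r ^+ 2) / (1 - r) ^+ 2)) => //.
by apply: measurable_funTS; apply: continuous_measurable_fun; exact: continuous_pkernel_shift.
Qed.

Lemma poissonB f g x : circle_integrable f -> circle_integrable g ->
  poisson r (fun t => f t - g t) x = poisson r f x - poisson r g x.
Proof.
move=> fi gi; rewrite /poisson -mulrBr -circle_integralB; try exact: circle_integrable_pkernel.
by congr (_ * _); apply: eq_Rintegral => t _; rewrite mulrBr.
Qed.

Lemma poisson_cst (w x : R) : poisson r (fun=> w) x = w.
Proof.
rewrite /poisson; under eq_Rintegral do rewrite mulrC.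
rewrite circle_integralZ; last first.
  by apply: continuous_circle_integrable; exact: continuous_pkernel_shift.
by rewrite pkernel_integral// mulrCA mulVf ?mulr1// gt_eqF.
Qed.

Lemma poisson_le f g x : circle_integrable f -> circle_integrable g ->
  (forall t, circle t -> f t <= g t) -> poisson r f x <= poisson r g x.
Proof.
move=> fi gi fg; rewrite ler_wpM2l ?invr_ge0 ?(ltW twopi)//.
apply: circle_integral_le; try exact: circle_integrable_pkernel.
by move=> t tI; rewrite ler_wpM2l ?pkernel_ge0 ?fg.
Qed.

Lemma poisson_norm_le f x : circle_integrable f ->
  `|poisson r f x| <= poisson r (fun t => `|f t|) x.
Proof.
move=> fi; rewrite normrM ger0_norm ?invr_ge0 ?(ltW twopi)//.
rewrite ler_wpM2l ?invr_ge0 ?(ltW twopi)//.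
have fki := circle_integrable_pkernel x fi.
apply: (le_trans (circle_integral_norm_le fki)).
apply: circle_integral_le.
- exact: circle_integrable_norm.
- by apply: circle_integrable_pkernel; exact: circle_integrable_norm.
- by move=> t _; rewrite normrM ger0_norm ?pkernel_ge0.
Qed.

Lemma continuous_poisson f : circle_integrable f -> continuous (poisson r f).
Proof.
move=> fi; apply: (@lipschitz_continuous _ _
  ((2 * pi)^-1 * (plip r * \int[mu]_(t in circle) `|f t|))) => x y.
rewrite /poisson -mulrBr normrM ger0_norm ?invr_ge0 ?(ltW twopi)// -mulrA.
rewrite ler_wpM2l ?invr_ge0 ?(ltW twopi)//.
have ix := circle_integrable_pkernel x fi; have iy := circle_integrable_pkernel y fi.
rewrite -circle_integralB// (le_trans (circle_integral_norm_le (circle_integrableB ix iy)))//.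
rewrite mulrAC -circle_integralZ; last exact: circle_integrable_norm.
apply: circle_integral_le.
- by apply: circle_integrable_norm; exact: circle_integrableB.
- by apply: circle_integrableZ; exact: circle_integrable_norm.
- move=> t _; rewrite -mulrBl normrM ler_wpM2r//.
  rewrite (le_trans (pkernel_lipschitz r_range _ _))//.
  by rewrite opprB addrC subrKA [leRHS]mulrC distrC mulrC.
Qed.

Lemma circle_integrable_poisson f : circle_integrable f ->
  circle_integrable (poisson r f).
Proof. by move=> fi; apply: continuous_circle_integrable; exact: continuous_poisson. Qed.

(** Tonelli: the kernel has mass [2 * pi] in either variable. The function is extended by 0 off the
    circle to work on the whole plane. *)
Lemma poisson_norm_integral f : circle_integrable f ->
  \int[mu]_(x in circle) poisson r (fun t => `|f t|) x =
  \int[mu]_(x in circle) `|f x|.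
Proof.
move=> fi.
have ni : circle_integrable (fun t => `|f t|) := circle_integrable_norm fi.
pose phi := (fun t => `|f t|) \_ circle.
have mphi : measurable_fun setT phi.
  apply/(measurable_restrictT _ _).1 => //; exact: circle_integrable_measurable.
have phi0 t : 0 <= phi t by rewrite /phi patchE; case: ifP => _ /=; rewrite ?normr_ge0.
pose G (z : R * R) := (pkernel r (z.2 - z.1) * phi z.2 * \1_circle z.1)%:E.
have G0 z : (0 <= G z)%E.
  rewrite lee_fin; apply: mulr_ge0; last by rewrite indicE.
  by apply: mulr_ge0 => //; exact: pkernel_ge0.
have mG : measurable_fun setT G.
  apply/measurable_EFinP; apply: measurable_funM; first apply: measurable_funM.
  - apply: (@measurableT_comp _ _ _ _ _ _ (pkernel r)).
      by apply: continuous_measurable_fun; exact: continuous_pkernel.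
    by apply: measurable_funB; [exact: measurable_snd|exact: measurable_fst].
  - by apply: measurableT_comp => //; exact: measurable_snd.
  - by apply: measurableT_comp => //; exact: measurable_fst.
have := @fubini_tonelli _ _ _ _ _ mu mu G mG G0.
have -> : (fun x => \int[mu]_y G (x, y))%E =
   (fun x => (2 * pi * poisson r (fun t => `|f t|) x)%:E) \_ circle.
  apply/funext => x; rewrite patchE; case: ifPn => xI.
    rewrite /poisson mulrA divff ?mul1r ?gt_eqF// -EFin_circle_integral; last first.
      exact: circle_integrable_pkernel.
    rewrite [RHS]integral_mkcond; apply: eq_integral => t _.
    rewrite /G /= indicE xI mulr1 patchE /phi patchE.
    by case: ifP => _//; rewrite mulr0.
  rewrite (_ : (fun y => G (x, y)) = cst 0%E) ?integral_cst ?mul0e//.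
  by apply/funext => y; rewrite /G /= indicE (negbTE xI) mulr0.
have -> : (fun y => \int[mu]_x G (x, y))%E =
   (fun t => (2 * pi * `|f t|)%:E) \_ circle.
  apply/funext => t; rewrite patchE; case: ifPn => tI.
    have -> : 2 * pi * `|f t| = \int[mu]_(x in circle) (`|f t| * pkernel r (t - x)).
      rewrite circle_integralZ ?pkernel_integral_sym// 1?mulrC//.
      apply: continuous_circle_integrable => x.
      rewrite (_ : (fun x => pkernel r (t - x)) = (fun x => pkernel r (-1 * x + t))).
        by apply: continuous_affine_comp; exact: continuous_pkernel.
      by apply/funext => z; rewrite mulN1r addrC.
    rewrite -EFin_circle_integral; last first.
      apply: circle_integrableZ.
      apply: continuous_circle_integrable => x.
      rewrite (_ : (fun x => pkernel r (t - x)) = (fun x => pkernel r (-1 * x + t))).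
        by apply: continuous_affine_comp; exact: continuous_pkernel.
      by apply/funext => z; rewrite mulN1r addrC.
    rewrite [RHS]integral_mkcond; apply: eq_integral => x _.
    rewrite /G /= indicE patchE /phi patchE tI.
    by case: ifP => _; rewrite ?mulr1 ?mulr0// mulrC.
  rewrite (_ : (fun x => G (x, t)) = cst 0%E) ?integral_cst ?mul0e//.
  by apply/funext => x; rewrite /G /= /phi patchE (negbTE tI) mulr0 mul0r.
rewrite -!integral_mkcond.
rewrite EFin_circle_integral; last by apply: circle_integrableZ; exact: circle_integrable_poisson.
rewrite EFin_circle_integral; last exact: circle_integrableZ.
rewrite (circle_integralZ _ (circle_integrable_poisson ni)) (circle_integralZ _ ni).
have pn0 : 2 * pi != 0 :> R by rewrite gt_eqF.
by move=> [] /(mulfI pn0).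
Qed.

Lemma poisson_contraction f : circle_integrable f ->
  \int[mu]_(x in circle) `|poisson r f x| <= \int[mu]_(x in circle) `|f x|.
Proof.
move=> fi; rewrite -(poisson_norm_integral fi); apply: circle_integral_le.
- by apply: circle_integrable_norm; exact: circle_integrable_poisson.
- by apply: circle_integrable_poisson; exact: circle_integrable_norm.
- by move=> x _; exact: poisson_norm_le.
Qed.

End FixedRadius.

End PoissonOperator.

(** * Convergence of Poisson integrals, pointwise and in L1 *)

Section PoissonConvergence.
Context {R : realType}.
Notation mu := (@lebesgue_measure R).
Notation circle := (`[- pi, pi]%classic : set R).
Implicit Types (x t : R) (f g : R -> R).

Variable rs : nat -> R.
Hypothesis rs_range : forall n, 0 <= rs n < 1.
Hypothesis rs_cvg : rs @ \oo --> (1 : R).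

(** Differences of two points of the circle range up to [2 * pi] in absolute value, and cos returns
    to 1 there; hence the upper restriction on [|x|]. *)
Lemma one_sub_cos_ge (eta x : R) : 0 < eta -> eta < pi ->
  eta <= `|x| -> `|x| <= 2 * pi - eta -> cos x <= cos eta.
Proof.
move=> e0 epi ex xe; rewrite -cos_norm; set y := `|x| in ex xe *.
have [ypi|piy] := leP y pi.
  move: ex; rewrite le_eqVlt => /predU1P[->//|ey].
  by rewrite ltW// ltr_cos ?in_itv/= ?ypi ?(ltW epi) ?(ltW e0) ?(ltW (lt_trans e0 ey)).
have -> : cos y = cos (2 * pi - y).
  rewrite -[RHS]cosN opprB -[RHS]cosD2pi; congr cos.
  by rewrite mulr2n; ring.
have ey : eta <= 2 * pi - y by lra.
have yp : 2 * pi - y <= pi by lra.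
move: ey; rewrite le_eqVlt => /predU1P[->//|ey].
by rewrite ltW// ltr_cos ?in_itv/= ?yp ?(ltW epi) ?(ltW e0) ?(ltW (lt_trans e0 ey)).
Qed.

Lemma cos_lt1 (eta : R) : 0 < eta -> eta < pi -> cos eta < 1.
Proof.
move=> e0 epi; rewrite -[ltRHS]cos0 ltr_cos// in_itv/= ?lexx ?pi_ge0//.
by rewrite !ltW.
Qed.

(** As [pden] is at least [2 * r * (1 - cos x)], the Poisson mean of [1 - cos] tends to 0 as r tends
    to 1; this one test function measures the concentration of the kernel. *)
Lemma pkernel_one_sub_cos_le (r x : R) : 0 < r -> r < 1 ->
  pkernel r x * (1 - cos x) <= (1 - r ^+ 2) / (2 * r).
Proof.
move=> r0 r1; have rr : 0 <= r < 1 by rewrite (ltW r0).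
have D0 := pden_gt0 rr x; rewrite /pkernel mulrAC ler_pdivrMr//.
rewrite -mulrA ler_wpM2l ?subr_ge0 ?expr_le1// ?(ltW r0) ?(ltW r1)//.
rewrite mulrC ler_pdivlMr ?mulr_gt0// pdenE mulrC lerDr sqr_ge0//.
Qed.

Lemma continuous_circle_bounded g : continuous g ->
  exists2 M, 0 <= M & forall t, circle t -> `|g t| <= M.
Proof.
move=> cg; have cI : {within circle, continuous g} by exact: continuous_subspaceT.
have /compact_bounded[M [_ gM]] := continuous_compact cI (@segment_compact _ _ _).
exists (`|M| + 1); first by rewrite addr_ge0.
move=> t tI; apply: (gM (`|M| + 1)).
  by rewrite (le_lt_trans (ler_norm M))// ltrDl.
by exists t.
Qed.

Lemma continuous_one_sub_cos x : continuous (fun t => 1 - cos (t - x)).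
Proof.
have cc : continuous (fun t => cos (t - x)).
  rewrite (_ : (fun t => cos (t - x)) = (fun t => cos (1 * t - x))).
    by apply: continuous_affine_comp; exact: continuous_cos.
  by apply/funext => z; rewrite mul1r.
by move=> t; apply: cvgB; [exact: cvg_cst|exact: cc].
Qed.

(** A Korovkin argument: |g t - g x| is at most e / 2 near [x] and at most a multiple of
    [1 - cos (t - x)] elsewhere, and the operator is positive and fixes constants. [eta] is below
    both the modulus of continuity and half the distance from [x] to the ends. The end points are
    excluded because [g] need not be periodic. *)
Lemma poisson_cvg_continuous g x : continuous g -> - pi < x < pi ->
  (fun n => poisson (rs n) g x) @ \oo --> g x.
Proof.
move=> cg /andP[x1 x2]; apply/cvgrPdist_le => /= e e0.
have [M M0 gM] := continuous_circle_bounded cg.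
have e2 : 0 < e / 2 by rewrite divr_gt0.
have [d /= d0 gd] : exists2 d : R, 0 < d & forall t, `|x - t| < d -> `|g x - g t| <= e / 2.
  by have /cvgrPdist_le/(_ _ e2)[d /= d0 gd] := cg x; exists d.
pose eta := Num.min (d / 2) ((pi - `|x|) / 2).
have xpi : `|x| < pi by rewrite ltr_norml x1.
have eta0 : 0 < eta by rewrite lt_min !divr_gt0// subr_gt0.
have etad : eta < d by rewrite gt_min; apply/orP; left; lra.
have etax : 2 * eta <= pi - `|x|.
  have : eta <= (pi - `|x|) / 2 by rewrite ge_min lexx orbT.
  by lra.
have x0 : 0 <= `|x| by [].
have etapi : eta < pi by lra.
pose m := 1 - cos eta; have m0 : 0 < m by rewrite subr_gt0 cos_lt1.
pose K := 2 * M / m.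
have K0 : 0 <= K by rewrite divr_ge0 ?mulr_ge0// ltW.
have xI : circle x by rewrite /= in_itv/= !ltW.
have bnd t : circle t -> `|g t - g x| <= e / 2 + K * (1 - cos (t - x)).
  move=> tI; have c1 : 0 <= 1 - cos (t - x) by rewrite subr_ge0 cos_le1.
  have [tx|tx] := ltP (`|x - t|) d.
    by rewrite distrC (le_trans (gd _ tx))// lerDl mulr_ge0.
  have h : m <= 1 - cos (t - x).
    rewrite lerD2l lerN2; apply: one_sub_cos_ge => //.
      by rewrite distrC (le_trans (ltW etad)).
    rewrite (le_trans (ler_normB _ _))//.
    have : `|t| <= pi by move: tI; rewrite /= in_itv/= ler_norml.
    by lra.
  rewrite (le_trans (ler_normB _ _))//.
  apply: (@le_trans _ _ (2 * M)).
    by have := gM _ tI; have := gM _ xI; lra.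
  apply: (@le_trans _ _ (K * m)).
    by rewrite /K divfK// gt_eqF.
  by rewrite -[leLHS]add0r lerD ?(ltW e2)// ler_wpM2l.
have gi : circle_integrable g := continuous_circle_integrable cg.
have ci : circle_integrable (fun t => 1 - cos (t - x)).
  by apply: continuous_circle_integrable; exact: continuous_one_sub_cos.
have main (r : R) : 0 < r -> r < 1 ->
    `|g x - poisson r g x| <= e / 2 + K * ((1 - r ^+ 2) / (2 * r)).
  move=> r0 r1; have rr : 0 <= r < 1 by rewrite (ltW r0).
  have ggi : circle_integrable (fun t => g t - g x).
    by apply: circle_integrableB => //; exact: circle_integrable_cst.
  have Kci : circle_integrable (fun t => e / 2 + K * (1 - cos (t - x))).
    by apply: circle_integrableD; [exact: circle_integrable_cst|exact: circle_integrableZ].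
  rewrite distrC -(poisson_cst rr (g x) x) -poissonB//; last exact: circle_integrable_cst.
  rewrite (le_trans (poisson_norm_le rr _ ggi))//.
  rewrite (le_trans (poisson_le rr x (circle_integrable_norm ggi) Kci bnd))//.
  rewrite (_ : poisson r _ x = e / 2 + K * poisson r (fun t => 1 - cos (t - x)) x).
    rewrite lerD2l ler_wpM2l// /poisson.
    rewrite ler_pdivrMl ?mulr_gt0 ?pi_gt0// -circle_integral_cst.
    apply: circle_integral_le.
    - exact: circle_integrable_pkernel.
    - exact: circle_integrable_cst.
    - by move=> t _; exact: pkernel_one_sub_cos_le.
  rewrite -[in RHS](poisson_cst rr (e / 2) x) /poisson mulrCA -mulrDr; congr (_ * _).
  rewrite -circle_integralZ; last exact: circle_integrable_pkernel.
  rewrite -circle_integralD.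
  - by apply: eq_Rintegral => t _; ring.
  - by apply: circle_integrable_pkernel => //; exact: circle_integrable_cst.
  - by apply: circle_integrableZ; exact: circle_integrable_pkernel.
have c0 : (fun n => K * ((1 - rs n ^+ 2) / (2 * rs n))) @ \oo --> (0 : R).
  rewrite [X in _ --> X](_ : 0 = K * ((1 - 1 * 1) / (2 * 1))); last by rewrite mulr1 subrr mul0r mulr0.
  apply: cvgMr; apply: cvgM; first by apply: cvgB; [exact: cvg_cst|exact: cvgM].
  by apply: cvgV; [rewrite mulr1|exact: cvgMr].
have c1 : \forall n \near \oo, K * ((1 - rs n ^+ 2) / (2 * rs n)) <= e / 2.
  have /cvgrPdist_le/(_ _ e2) := c0; apply: filterS => n.
  by rewrite sub0r normrN; apply: le_trans (ler_norm _).
have c2 : \forall n \near \oo, 0 < rs n by apply: cvgr_gt rs_cvg _ _.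
near=> n; rewrite (le_trans (main (rs n) _ _))//.
- by near: n.
- by case/andP: (rs_range n).
- rewrite [leRHS](_ : e = e / 2 + e / 2); last by field.
  by rewrite lerD2l; near: n.
Unshelve. all: by end_near. Qed.

Lemma poisson_bounded (r : R) g (M x : R) : 0 <= r < 1 -> circle_integrable g ->
  (forall t, circle t -> `|g t| <= M) -> `|poisson r g x| <= M.
Proof.
move=> rr gi gM; rewrite (le_trans (poisson_norm_le rr x gi))//.
rewrite -[leRHS](poisson_cst rr M x); apply: poisson_le => //.
- exact: circle_integrable_norm.
- exact: circle_integrable_cst.
Qed.

Lemma ae_circle_interior : {ae mu, forall x, circle x -> - pi < x < pi}.
Proof.
exists ([set - pi] `|` [set pi]); split.
- by apply: measurableU; exact: measurable_set1.
- apply/eqP; rewrite -measure_le0 (le_trans (measureU2 _ _ _))//.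
  by rewrite [X in (X + _)%E](lebesgue_measure_set1 (- pi)) [X in (_ + X)%E](lebesgue_measure_set1 pi) adde0.
- move=> x /= /not_implyP[]; rewrite in_itv/= !le_eqVlt => /andP[].
  move=> /predU1P[<-|x1]; first by left.
  move=> /predU1P[->|x2]; first by right.
  by rewrite x1 x2.
Qed.

Lemma poisson_L1_continuous g : continuous g ->
  (fun n => \int[mu]_(x in circle) `|poisson (rs n) g x - g x|) @ \oo --> (0 : R).
Proof.
move=> cg; have [M M0 gM] := continuous_circle_bounded cg.
have gi : circle_integrable g := continuous_circle_integrable cg.
have pi_ n := circle_integrable_poisson (rs_range n) gi.
have mI f : circle_integrable f -> measurable_fun circle (EFin \o f).
  by move=> fi; apply/measurable_EFinP; exact: circle_integrable_measurable.
have mc : measurable circle by exact: measurable_itv.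
have [] := @dominated_convergence _ _ _ mu circle mc
  (fun n x => (poisson (rs n) g x)%:E) (EFin \o g) (fun=> M%:E).
- by move=> n; apply: mI.
- exact: mI.
- have [N [mN N0 NI]] := ae_circle_interior.
  exists N; split => // x /= h; apply: NI => /= xI; apply: h => /xI xin.
  by apply: cvg_EFin; [exact: nearW|exact: poisson_cvg_continuous].
- exact: circle_integrable_cst.
- apply: aeW => x n xI /=; rewrite lee_fin.
  by apply: poisson_bounded.
move=> _ h _.
have -> : (fun n => \int[mu]_(x in circle) `|poisson (rs n) g x - g x|) =
  fine \o [sequence (\int[mu]_(x in circle) `|(poisson (rs n) g x)%:E - (EFin \o g) x|)%E]_n.
  by [].
exact: fine_cvg.
Qed.

(** Density of continuous functions in L1; [poisson_contraction] makes the approximation error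
    uniform in the radius. *)
Theorem poisson_L1 f : circle_integrable f ->
  (fun n => \int[mu]_(x in circle) `|poisson (rs n) f x - f x|) @ \oo --> (0 : R).
Proof.
move=> fi; apply/cvgrPdist_le => /= e e0.
have e3 : 0 < e / 3 by rewrite divr_gt0.
have muc : (mu circle < +oo)%E by rewrite [X in (X < _)%E]lebesgue_circle ltry.
have [g_ [cg gi gf]] := approximation_continuous_integrable (measurable_itv _) muc fi.
have [k fgk] : exists k, \int[mu]_(x in circle) `|f x - g_ k x| <= e / 3.
  have /fine_cvgP[_ /cvgrPdist_le/(_ _ e3)[k _ hk]] := gf.
  exists k; have := hk k (leqnn k); rewrite /= sub0r normrN.
  by apply: le_trans (ler_norm _).
pose g := g_ k; have gci : circle_integrable g := gi k.
have fgi : circle_integrable (fun x => f x - g x) by exact: circle_integrableB.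
have /cvgrPdist_le/(_ _ e3) := poisson_L1_continuous (cg k).
apply: filterS => n; rewrite !sub0r !normrN => h.
have pfi := circle_integrable_poisson (rs_range n) fi.
have pgi := circle_integrable_poisson (rs_range n) gci.
have pfgi := circle_integrable_poisson (rs_range n) fgi.
have ni u v : circle_integrable u -> circle_integrable v ->
    circle_integrable (fun x => `|u x - v x|).
  by move=> ui vi; apply: circle_integrable_norm; exact: circle_integrableB.
rewrite ger0_norm; last by apply: Rintegral_ge0.
apply: (@le_trans _ _ (\int[mu]_(x in circle)
    (`|poisson (rs n) (fun t => f t - g t) x| + `|poisson (rs n) g x - g x| + `|f x - g x|))).
  apply: circle_integral_le; first exact: ni.
    apply: circle_integrableD; last exact: ni.
    by apply: circle_integrableD; [exact: circle_integrable_norm|exact: ni].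
  move=> x _; rewrite (poissonB (rs_range n))//.
  have -> : poisson (rs n) f x - f x = (poisson (rs n) f x - poisson (rs n) g x) +
      (poisson (rs n) g x - g x) - (f x - g x) by ring.
  by rewrite (le_trans (ler_normB _ _))// lerD2r ler_normD.
rewrite !circle_integralD; try exact: ni; try exact: circle_integrable_norm; last first.
  by apply: circle_integrableD; [exact: circle_integrable_norm|exact: ni].
have h1 := poisson_contraction (rs_range n) fgi.
have h2 : \int[mu]_(x in circle) `|poisson (rs n) g x - g x| <= e / 3.
  by rewrite (le_trans (ler_norm _)).
move: h1 h2 fgk; rewrite -/g; lra.
Qed.

End PoissonConvergence.

(** * Parseval's identity for absolutely summable coefficients *)

Section Parseval.
Context {R : realType}.
Notation mu := (@lebesgue_measure R).
Notation circle := (`[- pi, pi]%classic : set R).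
Variable b : nat -> R.
Hypothesis b_summable : abs_summable b.

Definition cos_series x := rsum (fun k => b k * cos (k%:R * x)).
Definition sin_series x := rsum (fun k => b k * sin (k%:R * x)).

Let Cn N x := \sum_(0 <= k < N) b k * cos (k%:R * x).
Let Sn N x := \sum_(0 <= k < N) b k * sin (k%:R * x).

Let A := rsum (fun k => `|b k|).
Let gap N := A - \sum_(0 <= k < N) `|b k|.

Let b_norm : abs_summable (fun k => `|b k|) := abs_summable_norm b_summable.

Let A_ge0 : 0 <= A. Proof. exact: rsum_ge0. Qed.

Let abs_summable_trig (t : nat -> R) : (forall k, `|t k| <= 1) ->
  abs_summable (fun k => b k * t k).
Proof.
by move=> t1; apply: abs_summable_dom b_summable => k; rewrite normrM ler_piMr.
Qed.

Let trig_gap (t : nat -> R) N : (forall k, `|t k| <= 1) ->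
  `|rsum (fun k => b k * t k) - \sum_(0 <= k < N) b k * t k| <= gap N.
Proof.
move=> t1; have st := abs_summable_trig t1.
rewrite (rsum_shift N st) addrAC subrr add0r /gap /A (rsum_shift N b_norm).
rewrite addrAC subrr add0r (le_trans (ler_norm_rsum (abs_summable_shift N st)))//.
apply: ler_rsum.
- exact: (abs_summable_norm (abs_summable_shift N st)).
- exact: (abs_summable_shift N b_norm).
- by move=> k; rewrite normrM ler_piMr.
Qed.

Let trig_bound (t : nat -> R) : (forall k, `|t k| <= 1) ->
  `|rsum (fun k => b k * t k)| <= A.
Proof.
move=> t1; have := trig_gap 0 t1; by rewrite /gap !big_nil !subr0.
Qed.

Let trig_sum_bound (t : nat -> R) N : (forall k, `|t k| <= 1) ->
  `|\sum_(0 <= k < N) b k * t k| <= A.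
Proof.
move=> t1; rewrite (le_trans (ler_norm_sum _ _ _))//.
rewrite (le_trans _ (series_le_rsum N _ b_norm))//.
by apply: ler_sum => k _; rewrite normrM ler_piMr.
Qed.

Let sqr_gap (t : nat -> R) N : (forall k, `|t k| <= 1) ->
  `|rsum (fun k => b k * t k) ^+ 2 - (\sum_(0 <= k < N) b k * t k) ^+ 2| <=
    2 * A * gap N.
Proof.
move=> t1; rewrite subr_sqr normrM mulrC ler_pM ?trig_gap//.
by rewrite (le_trans (ler_normD _ _))// mulr_natl mulr2n lerD ?trig_bound ?trig_sum_bound.
Qed.

Let gap_cvg : gap @ \oo --> (0 : R).
Proof.
rewrite -[X in _ --> X](subrr A); apply: cvgB; first exact: cvg_cst.
exact: (abs_summable_cvg b_norm).
Qed.

(** The squared modulus of the sum of b_k e^(ikx), kept in real form. *)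
Definition energy x := cos_series x ^+ 2 + sin_series x ^+ 2.

Let energyN N x := Cn N x ^+ 2 + Sn N x ^+ 2.

Let energy_gap N x : `|energy x - energyN N x| <= 4 * A * gap N.
Proof.
rewrite /energy /energyN opprD addrACA (le_trans (ler_normD _ _))//.
rewrite [leRHS](_ : _ = 2 * A * gap N + 2 * A * gap N); last by ring.
by rewrite lerD//; apply: sqr_gap => k; [exact: cos_max|exact: sin_max].
Qed.

Let energyNE N x : energyN N x =
  \sum_(0 <= k < N) \sum_(0 <= j < N) b k * b j * cos ((k%:Z - j%:Z)%:~R * x).
Proof.
rewrite /energyN !expr2 /Cn /Sn !mulr_suml -big_split/=; apply: eq_bigr => k _.
rewrite !mulr_sumr -big_split/=; apply: eq_bigr => j _.
by rewrite rmorphB/= mulrBl cosB; ring.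
Qed.

Let continuous_energyN N : continuous (energyN N).
Proof.
have ct (t : R -> R) k : continuous t -> continuous (fun x : R => b k * t (k%:R * x)).
  move=> tc; rewrite (_ : (fun x => _) = (fun x : R => b k * t (k%:R * x + 0))).
    by move=> x; apply: cvgMr; apply: continuous_affine_comp.
  by apply/funext => x; rewrite addr0.
have cs (t : R -> R) : continuous t ->
    continuous (fun x : R => \sum_(0 <= k < N) b k * t (k%:R * x)).
  move=> tc; elim: N => [|M IHM].
    by rewrite (_ : (fun x => _) = fun=> 0); [exact: cst_continuous|apply/funext => x; rewrite big_nil].
  rewrite (_ : (fun x => _) = fun x => \sum_(0 <= k < M) b k * t (k%:R * x) + b M * t (M%:R * x)).
    by move=> x; apply: cvgD; [exact: IHM|exact: ct].
  by apply/funext => x; rewrite big_nat_recr.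
have cC := cs _ (@continuous_cos R); have cS := cs _ (@continuous_sin R).
by move=> x; apply: cvgD; rewrite expr2; apply: cvgM; [exact: cC|exact: cC|exact: cS|exact: cS].
Qed.

Lemma circle_integrable_energy : circle_integrable energy.
Proof.
apply: (@circle_integrable_le _ _ (fun=> 2 * A ^+ 2)).
- apply: (@measurable_fun_cvg _ _ _ _ energyN).
  + by move=> N; apply: measurable_funTS; apply: continuous_measurable_fun; exact: continuous_energyN.
  + move=> x _; apply: cvg_sub0 (cvg_cst _).
    apply: norm_cvg0.
    have c0 : (fun N => 4 * A * gap N) @ \oo --> (0 : R).
      by rewrite -[X in _ --> X](mulr0 (4 * A)); apply: cvgMr; exact: gap_cvg.
    apply: (squeeze_cvgr _ (cvg_cst 0) c0).
    by apply: nearW => N; rewrite normr_ge0/= !fctE distrC energy_gap.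
- move=> x _; rewrite (le_trans (ler_normD _ _))// mulr_natl mulr2n !normrX.
  by rewrite lerD// lerXn2r// ?nnegrE//; apply: trig_bound => k; [exact: cos_max|exact: sin_max].
- exact: circle_integrable_cst.
Qed.

Let cos_prod (m n : int) (x : R) : cos (m%:~R * x) * cos (n%:~R * x) =
  1 / 2 * cos ((m + n)%:~R * x + 0) + 1 / 2 * cos ((m - n)%:~R * x + 0).
Proof. by rewrite rmorphB rmorphD/= !addr0 mulrBl mulrDl cosB cosD; field. Qed.

Let continuous_cos_int (m : int) : continuous (fun x : R => cos (m%:~R * x + 0)).
Proof. by apply: continuous_affine_comp; exact: continuous_cos. Qed.

Let cos_prod_integral (m n : int) :
  \int[mu]_(x in circle) (cos (m%:~R * x) * cos (n%:~R * x)) =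
    pi * ((m + n == 0)%:R + (m - n == 0)%:R).
Proof.
under eq_Rintegral do rewrite cos_prod.
have ci k : circle_integrable (fun x : R => cos (k%:~R * x + 0)).
  by apply: continuous_circle_integrable; exact: continuous_cos_int.
rewrite circle_integralD ?circle_integralZ; try exact: circle_integrableZ; try exact: ci.
by rewrite !circle_integral_cos_int cos0; field.
Qed.

Let circle_integral_sum (F : nat -> R -> R) N : (forall k, circle_integrable (F k)) ->
  circle_integrable (fun x => \sum_(0 <= k < N) F k x) /\
  \int[mu]_(x in circle) (\sum_(0 <= k < N) F k x) =
  \sum_(0 <= k < N) \int[mu]_(x in circle) F k x.
Proof.
move=> iF; elim: N => [|N [iN IHN]].
  have E : (fun x => \sum_(0 <= k < 0) F k x) = fun=> 0.
    by apply/funext => x; rewrite big_nil.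
  split; first by rewrite E; exact: circle_integrable_cst.
  rewrite big_nil -[RHS](mulr0 (2 * pi)) -circle_integral_cst.
  by apply: eq_Rintegral => x _; rewrite big_nil.
have E : (fun x => \sum_(0 <= k < N.+1) F k x) = fun x => \sum_(0 <= k < N) F k x + F N x.
  by apply/funext => x; rewrite big_nat_recr.
split; first by rewrite E; exact: circle_integrableD.
rewrite [RHS]big_nat_recr//= -IHN -circle_integralD//.
by apply: eq_Rintegral => x _; rewrite big_nat_recr.
Qed.

(** Only the diagonals [j = k + n] and [k = j + n] survive, with equal contributions; for [n = 0]
    they coincide and are counted twice, as [cos_prod_integral] requires. Truncating at [N + n]
    makes [k] range over exactly [N] values. *)
Let energyN_integral n N : \int[mu]_(x in circle) (energyN (N + n) x * cos (n%:R * x)) =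
  2 * pi * \sum_(0 <= k < N) b k * b (k + n)%N.
Proof.
pose G k j x := b k * b j * (cos ((k%:Z - j%:Z)%:~R * x) * cos ((n%:Z)%:~R * x)).
have iG k j : circle_integrable (G k j).
  apply: circle_integrableZ.
  rewrite (_ : (fun x => _) = fun x : R => 1 / 2 * cos ((k%:Z - j%:Z + n%:Z)%:~R * x + 0) + 1 / 2 * cos ((k%:Z - j%:Z - n%:Z)%:~R * x + 0)).
    by apply: circle_integrableD; apply: circle_integrableZ;
      apply: continuous_circle_integrable; exact: continuous_cos_int.
  by apply/funext => x; rewrite cos_prod.
have -> : \int[mu]_(x in circle) (energyN (N + n) x * cos (n%:R * x)) =
    \int[mu]_(x in circle) (\sum_(0 <= k < N + n) \sum_(0 <= j < N + n) G k j x).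
  apply: eq_Rintegral => x _; rewrite energyNE mulr_suml; apply: eq_bigr => k _.
  by rewrite mulr_suml; apply: eq_bigr => j _; rewrite /G mulrA.
rewrite (circle_integral_sum _ (fun k => (circle_integral_sum (N + n) (iG k)).1)).2.
under eq_bigr => k _ do rewrite (circle_integral_sum (N + n) (iG k)).2.
have GI k j : \int[mu]_(x in circle) G k j x =
    pi * (b k * b j * (j == k + n)%N%:R) + pi * (b k * b j * (k == j + n)%N%:R).
  rewrite /G circle_integralZ; last first.
    rewrite (_ : (fun x => _) = fun x : R => 1 / 2 * cos ((k%:Z - j%:Z + n%:Z)%:~R * x + 0) + 1 / 2 * cos ((k%:Z - j%:Z - n%:Z)%:~R * x + 0)).
      by apply: circle_integrableD; apply: circle_integrableZ;
        apply: continuous_circle_integrable; exact: continuous_cos_int.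
    by apply/funext => x; rewrite cos_prod.
  rewrite cos_prod_integral.
  rewrite (_ : (k%:Z - j%:Z + n%:Z == 0) = (j == k + n)%N); last by apply/eqP/eqP; lia.
  rewrite (_ : (k%:Z - j%:Z - n%:Z == 0) = (k == j + n)%N); last by apply/eqP/eqP; lia.
  by ring.
pose S := \sum_(0 <= k < N + n) \sum_(0 <= j < N + n) b k * b j * (j == k + n)%N%:R.
have SE : S = \sum_(0 <= k < N) b k * b (k + n)%N.
  rewrite /S (@big_cat_nat _ _ _ N)//= ?leq_addr//.
  rewrite [X in _ + X]big_nat [X in _ + X]big1 ?addr0; last first.
    move=> k /andP[Nk _]; rewrite big_nat big1// => j /andP[_ jN].
    by rewrite (_ : (j == k + n)%N = false) ?mulr0//; apply/eqP; lia.
  rewrite big_nat [RHS]big_nat; apply: eq_bigr => k /andP[_ kN].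
  rewrite (bigD1_seq (k + n)%N)/= ?mem_index_iota ?iota_uniq ?ltn_add2r//.
  by rewrite eqxx mulr1 big1 ?addr0// => j /negbTE ->; rewrite mulr0.
transitivity (pi * S + pi * S); last by rewrite SE; ring.
pose S' := \sum_(0 <= k < N + n) \sum_(0 <= j < N + n) b k * b j * (k == j + n)%N%:R.
have SS' : S = S'.
  rewrite /S exchange_big/=; apply: eq_bigr => k _; apply: eq_bigr => j _.
  by rewrite [b j * _]mulrC.
rewrite {2}SS' /S /S' !mulr_sumr -big_split/=; apply: eq_bigr => k _.
by rewrite !mulr_sumr -big_split/=; apply: eq_bigr => j _; exact: GI.
Qed.

Theorem parseval n : \int[mu]_(x in circle) (energy x * cos (n%:R * x)) =
  2 * pi * rsum (fun k => b k * b (k + n)%N).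
Proof.
have ccos : continuous (fun x : R => cos (n%:R * x)).
  rewrite (_ : (fun x => _) = fun x : R => cos (n%:R * x + 0)).
    by apply: continuous_affine_comp; exact: continuous_cos.
  by apply/funext => x; rewrite addr0.
apply: (@cvg_circle_integral_unif _ _ (fun N x => energyN (N + n) x * cos (n%:R * x))
  (fun N => 4 * A * gap (N + n))).
- rewrite (_ : (fun x => _) = fun x => cos (n%:R * x) * energy x).
    apply: (@circle_integrableMl _ _ _ 1) => //.
    + by apply: measurable_funTS; apply: continuous_measurable_fun.
    + by move=> x _; exact: cos_max.
    + exact: circle_integrable_energy.
  by apply/funext => x; rewrite mulrC.
- move=> N; apply: continuous_circle_integrable => x.
  by apply: cvgM; [exact: continuous_energyN|exact: ccos].
- move=> N x; rewrite -mulrBl normrM.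
  by rewrite (le_trans _ (energy_gap _ x))// ler_piMr// cos_max.
- rewrite -[X in _ --> X](mulr0 (4 * A)); apply: cvgMr.
  by have := gap_cvg; rewrite -(cvg_shiftn n).
- under eq_fun do rewrite energyN_integral.
  apply: cvgMr; apply: abs_summable_cvg.
  have [B bB] := b_summable.
  have bb k : `|b k| <= B.
    by rewrite (le_trans _ (bB k.+1))// big_nat_recr//= lerDr sumr_ge0.
  apply: (@abs_summable_dom _ _ (fun k => B * b k)); last exact: abs_summableZ.
  by move=> k; rewrite !normrM mulrC ler_wpM2r// (le_trans (bb _))// ler_norm.
Qed.

End Parseval.

(** * The modulus of the Szego function inside the disc *)

Section SzegoFunction.
Context {R : realType}.
Local Open Scope complex_scope.
Notation mu := (@lebesgue_measure R).
Notation circle := (`[- pi, pi]%classic : set R).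
Implicit Types (r x t : R).

Definition polar r x : R[i] := (r * cos x) +i* (r * sin x).

Lemma cexp_polar t : cexp ('i * t%:C) = polar 1 t.
Proof.
by rewrite /cexp /polar; simpc; rewrite /= expR0 !mul1r.
Qed.

Lemma polarX r x n : polar r x ^+ n = polar (r ^+ n) (n%:R * x).
Proof.
elim: n => [|n IHn]; first by rewrite !expr0 mul0r /polar cos0 sin0 mulr0 mulr1.
rewrite exprS IHn /polar -[n.+1%:R]natr1 mulrDl mul1r cosD sinD exprS.
by simpc; congr (_ +i* _); ring.
Qed.

Lemma polar_norm r x : 0 <= r -> `|polar r x| = r%:C.
Proof.
move=> r0; rewrite normc_def /= !exprMn -mulrDr cos2Dsin2 mulr1.
by rewrite sqrtr_sqr ger0_norm.
Qed.

Lemma Re_herglotz r x t : 0 <= r < 1 ->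
  complex.Re ((cexp ('i * t%:C) + polar r x) / (cexp ('i * t%:C) - polar r x)) =
  pkernel r (t - x).
Proof.
move=> rr; rewrite cexp_polar /polar !mul1r /pkernel.
have E : (cos t - r * cos x) ^+ 2 + (sin t - r * sin x) ^+ 2 = pden r (t - x).
  rewrite /pden cosB [LHS](_ : _ = (cos t ^+ 2 + sin t ^+ 2) -
    2 * r * (cos t * cos x + sin t * sin x) + r ^+ 2 * (cos x ^+ 2 + sin x ^+ 2)).
    by rewrite !cos2Dsin2 mulr1.
  by ring.
have := pden_gt0 rr (t - x); rewrite -E => d0.
simpc; rewrite /= !mulrA -mulrDl; congr (_ / _).
rewrite [LHS](_ : _ = (cos t ^+ 2 + sin t ^+ 2) - r ^+ 2 * (cos x ^+ 2 + sin x ^+ 2)).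
  by rewrite !cos2Dsin2 mulr1.
by ring.
Qed.

(** Real-valued, whereas the norm on [R[i]] takes its values in [R[i]]. *)
Definition sqmod (w : R[i]) : R := complex.Re w ^+ 2 + complex.Im w ^+ 2.

Lemma sqmodM v w : sqmod (v * w) = sqmod v * sqmod w.
Proof. by case: v w => a b [c d]; rewrite /sqmod; simpc => /=; ring. Qed.

Lemma sqmod_cexp w : sqmod (cexp w) = expR (2 * complex.Re w).
Proof.
rewrite sqmodM {1}/sqmod /= expr0n addr0 /sqmod /= cos2Dsin2 mulr1.
by rewrite expRM_natl.
Qed.

Lemma Re_circle_integral (F : R -> R[i]) :
  complex.Re (circle_integral F) = \int[mu]_(x in circle) complex.Re (F x).
Proof. by []. Qed.

(** The squared modulus of an exponential depends only on twice the real part of the exponent. The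
    real part of the Herglotz kernel is the Poisson kernel, and twice 1 / (4 pi) is its
    normalization. *)
Lemma sqmod_szego (Delta : R -> R) r x : 0 <= r < 1 ->
  sqmod (szego Delta (polar r x)) =
  2 * pi * expR (poisson r (fun t => ln (Delta t)) x).
Proof.
move=> rr; rewrite /szego sqmodM sqmod_cexp; congr (_ * expR _).
  rewrite /sqmod /= expr0n addr0 sqr_sqrtr//.
  by rewrite mulr_ge0 ?pi_ge0.
have Re_scale (w : R[i]) (p : R) : complex.Re (p%:C * w) = p * complex.Re w.
  by case: w => u v; simpc.
rewrite Re_scale mulrA /poisson; congr (_ * _).
  have : (pi : R) != 0 by rewrite gt_eqF ?pi_gt0.
  by move: (pi : R) => p p0; field.
rewrite Re_circle_integral.
by apply: eq_Rintegral => t _; rewrite [X in complex.Re X]mulrC Re_scale Re_herglotz// mulrC.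
Qed.

Lemma Re_le_norm (w : R[i]) : `|complex.Re w|%:C <= `|w|.
Proof. exact: normc_ge_Re. Qed.

Lemma Im_le_norm (w : R[i]) : `|complex.Im w|%:C <= `|w|.
Proof.
by rewrite normc_def lecR -[leLHS]sqrtr_sqr ler_wsqrtr ?real_normK ?num_real// lerDr sqr_ge0.
Qed.

Lemma cvg_complex_parts (v : nat -> R[i]) (w : R[i]) :
  (v : nat -> R[i]^o) @ \oo --> (w : R[i]^o) ->
  (fun n => complex.Re (v n)) @ \oo --> complex.Re w /\
  (fun n => complex.Im (v n)) @ \oo --> complex.Im w.
Proof.
move=> /cvgrPdist_le vw.
have ReB (p q : R[i]) : complex.Re (p - q) = complex.Re p - complex.Re q.
  by case: p q => ? ? [].
have ImB (p q : R[i]) : complex.Im (p - q) = complex.Im p - complex.Im q.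
  by case: p q => ? ? [].
split; apply/cvgrPdist_le => /= e e0;
  (have eC : 0 < e%:C by rewrite ltcR); have := vw _ eC; apply: filterS => n h;
  rewrite -lecR; apply: le_trans h.
- by rewrite -ReB; exact: Re_le_norm.
- by rewrite -ImB; exact: Im_le_norm.
Qed.

Lemma power_series_parts (u : nat -> R) (f : R[i] -> R[i]) r x :
  power_series_on_disc u f -> 0 <= r < 1 ->
  series (fun k => u k * r ^+ k * cos (k%:R * x)) @ \oo --> complex.Re (f (polar r x)) /\
  series (fun k => u k * r ^+ k * sin (k%:R * x)) @ \oo --> complex.Im (f (polar r x)).
Proof.
move=> uf /andP[r0 r1].
have z1 : `|polar r x| < 1 by rewrite polar_norm// -[1]/(1%:C) ltcR.
have SE N : series (fun k => (u k)%:C * polar r x ^+ k) N =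
    (series (fun k => u k * r ^+ k * cos (k%:R * x)) N) +i*
    (series (fun k => u k * r ^+ k * sin (k%:R * x)) N).
  elim: N => [|N IHN]; first by rewrite /series /= !big_nil.
  rewrite /series /= !big_nat_recr//= in IHN *.
  by rewrite IHN polarX /polar; simpc; rewrite !mulrA.
have [h1 h2] := cvg_complex_parts (uf _ z1).
split.
- rewrite [X in X @ _ --> _](_ : _ = fun N => complex.Re (series (fun k => (u k)%:C * polar r x ^+ k) N)); first exact: h1.
  by apply/funext => N; rewrite SE.
- rewrite [X in X @ _ --> _](_ : _ = fun N => complex.Im (series (fun k => (u k)%:C * polar r x ^+ k) N)); first exact: h2.
  by apply/funext => N; rewrite SE.
Qed.

Lemma abs_summable_geometric (u : nat -> R) (K r : R) :
  (forall k, `|u k| <= K) -> 0 <= r < 1 -> abs_summable (fun k => u k * r ^+ k).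
Proof.
move=> uK /andP[r0 r1]; have K0 : 0 <= K by exact: le_trans (uK 0%N).
apply: (@abs_summable_le _ _ (fun k => K * r ^+ k) (K / (1 - r))).
  by move=> k; rewrite normrM [X in _ * X]ger0_norm ?exprn_ge0// ler_wpM2r ?exprn_ge0.
move=> N; rewrite -mulr_sumr ler_wpM2l// -[leRHS]mul1r ler_pdivlMr ?subr_gt0//.
by rewrite big_mkord mulrC -opprB mulNr -subrX1 opprB lerBlDr lerDl exprn_ge0.
Qed.

Lemma energy_szego (Delta : R -> R) (c : nat -> R) (C : R) r x :
  MA_coefficients Delta c -> (forall k, `|c k| <= C) -> 0 <= r < 1 ->
  abs_summable (fun k => c k * r ^+ k) /\
  energy (fun k => c k * r ^+ k) x =
    2 * pi * expR (poisson r (fun t => ln (Delta t)) x).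
Proof.
move=> cD cC rr; split; first exact: abs_summable_geometric cC rr.
have [h1 h2] := power_series_parts x cD rr.
rewrite -sqmod_szego// /energy /sqmod /cos_series /sin_series.
by rewrite (rsumE h1) (rsumE h2).
Qed.

End SzegoFunction.

(** * Passage to the boundary: Fourier coefficients of the spectral density *)

Section SpectralFactorization.
Context {R : realType}.
Notation mu := (@lebesgue_measure R).
Notation circle := (`[- pi, pi]%classic : set R).

(** The powers lie in [0, 1], so the tail is small uniformly in [m] and the head is a finite limit.
    The exponents are arbitrary because the products [c k * c (k + n)] come with the power
    [k + (k + n)]. *)
Lemma abel_summation (t : nat -> R) (p : nat -> nat) (r : nat -> R) :
  abs_summable t -> (forall m, 0 <= r m <= 1) -> r @ \oo --> (1 : R) ->
  (fun m => rsum (fun k => t k * r m ^+ p k)) @ \oo --> rsum t.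
Proof.
move=> st rr r1; apply/cvgrPdist_le => /= e e0.
have snt := abs_summable_norm st.
have e2 : 0 < e / 2 by rewrite divr_gt0.
have [N tN] : exists N, rsum (fun k => `|t (N + k)%N|) <= e / 2.
  have /cvgrPdist_le/(_ _ e2)[N _ hN] := abs_summable_cvg snt.
  exists N; have := hN N (leqnn N); rewrite /= (rsum_shift N snt) /series/=.
  by rewrite addrAC subrr add0r; apply: le_trans (ler_norm _).
have rp m k : 0 <= r m ^+ p k <= 1.
  by have /andP[h1 h2] := rr m; rewrite exprn_ge0//= exprn_ile1.
have c0 : (fun m => \sum_(0 <= k < N) `|t k| * (1 - r m ^+ p k)) @ \oo -->
    \sum_(0 <= k < N) `|t k| * (1 - 1 ^+ p k).
  apply: cvg_sumr => k; apply: cvgMr; apply: cvgB; first exact: cvg_cst.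
  by elim: (p k) => [|q IHq]; [rewrite expr0; exact: cvg_cst|under eq_fun do rewrite exprS; rewrite exprS; exact: cvgM].
have E0 : \sum_(0 <= k < N) `|t k| * (1 - 1 ^+ p k) = 0.
  by rewrite big1// => k _; rewrite expr1n subrr mulr0.
rewrite E0 in c0.
have /cvgrPdist_le/(_ _ e2) := c0; apply: filterS => m; rewrite sub0r normrN => hm.
have str : abs_summable (fun k => t k * r m ^+ p k).
  apply: abs_summable_dom st => k; have /andP[h1 h2] := rp m k.
  by rewrite normrM (ger0_norm h1) ler_piMr.
have sd : abs_summable (fun k => t k * (1 - r m ^+ p k)).
  apply: abs_summable_dom st => k; have /andP[h1 h2] := rp m k.
  by rewrite normrM ler_piMr// ger0_norm ?subr_ge0// gerBl.
have -> : rsum t - rsum (fun k => t k * r m ^+ p k) = rsum (fun k => t k * (1 - r m ^+ p k)).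
  rewrite -rsumN// -rsumD//; first by apply: eq_rsum => k; ring.
  by apply: abs_summable_dom str => k; rewrite normrN.
rewrite (rsum_shift N sd) (le_trans (ler_normD _ _))//.
rewrite [leRHS](_ : e = e / 2 + e / 2); last by field.
apply: lerD.
  apply: (le_trans (ler_norm_sum _ _ _)); apply: le_trans hm.
  rewrite ger0_norm; last first.
    by rewrite sumr_ge0// => k _; have /andP[_ h2] := rp m k; rewrite mulr_ge0// subr_ge0.
  by apply: ler_sum => k _; have /andP[_ h2] := rp m k; rewrite normrM [X in _ * X]ger0_norm// subr_ge0.
apply: le_trans tN; apply: (le_trans (ler_norm_rsum (abs_summable_shift N sd))).
apply: ler_rsum.
- exact: (abs_summable_norm (abs_summable_shift N sd)).
- exact: (abs_summable_shift N snt).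
- move=> k; have /andP[h1 h2] := rp m (N + k)%N.
  by rewrite normrM ler_piMr// ger0_norm ?subr_ge0// gerBl.
Qed.

Lemma poissonZ (r w x : R) f : 0 <= r < 1 -> circle_integrable f ->
  poisson r (fun t => w * f t) x = w * poisson r f x.
Proof.
move=> rr fi; rewrite /poisson mulrCA; congr (_ * _).
rewrite -circle_integralZ; last exact: circle_integrable_pkernel.
by apply: eq_Rintegral => t _; rewrite mulrCA.
Qed.

(* Jensen's inequality for the Poisson kernel, from the tangent line to exp. *)
Lemma expR_poisson_le (r x : R) L : 0 <= r < 1 -> circle_integrable L ->
  circle_integrable (fun t => expR (L t)) ->
  expR (poisson r L x) <= poisson r (fun t => expR (L t)) x.
Proof.
move=> rr Li Di; set m := poisson r L x.
have Zi : circle_integrable (fun t => expR m * L t) by exact: circle_integrableZ.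
have ci := @circle_integrable_cst R (expR m * (m - 1)).
have -> : expR m = poisson r (fun t => expR m * L t - expR m * (m - 1)) x.
  by rewrite poissonB// poissonZ// poisson_cst// -/m; ring.
apply: poisson_le => //; first exact: circle_integrableB.
move=> t _; have h := expR_ge1Dx (L t - m).
have -> : expR (L t) = expR m * expR (L t - m) by rewrite -expRD addrC subrK.
rewrite -mulrBr ler_wpM2l ?expR_ge0// (le_trans _ h)//.
by rewrite le_eqVlt; apply/orP; left; apply/eqP; ring.
Qed.

Variables (L : R -> R) (c : nat -> R) (f : nat -> R -> R) (r : nat -> R).
Let D t := expR (L t).
Hypothesis Li : circle_integrable L.
Hypothesis Di : circle_integrable D.
Hypothesis r_range : forall m, 0 <= r m < 1.
Hypothesis r_cvg : r @ \oo --> (1 : R).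
Hypothesis c2_summable : abs_summable (fun k => c k ^+ 2).
Hypothesis fi : forall m, circle_integrable (f m).
Hypothesis fE : forall m x, f m x = expR (poisson (r m) L x).
Hypothesis f_fourier : forall m n,
  \int[mu]_(x in circle) (f m x * cos (n%:R * x)) =
  rsum (fun k => (c k * c (k + n)%N) * r m ^+ (k + (k + n))%N).

Let S := rsum (fun k => c k ^+ 2).
Let Lerr m := \int[mu]_(x in circle) `|poisson (r m) L x - L x|.
Let Derr m := \int[mu]_(x in circle) `|poisson (r m) D x - D x|.

Let I m := \int[mu]_(x in circle) f m x.

Let IE m : I m = rsum (fun k => (c k ^+ 2) * r m ^+ (k + k)%N).
Proof.
transitivity (\int[mu]_(x in circle) (f m x * cos (0%:R * x))).
  by apply: eq_Rintegral => x _; rewrite mul0r cos0 mulr1.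
by rewrite f_fourier; apply: eq_rsum => k; rewrite addn0 expr2.
Qed.

Let I_cvg : I @ \oo --> S.
Proof.
rewrite (_ : I = fun m => rsum (fun k => (c k ^+ 2) * r m ^+ (k + k)%N)).
  by apply: abel_summation => // m; have /andP[h1 h2] := r_range m; rewrite h1 ltW.
by apply/funext => m; exact: IE.
Qed.

Let I_le m : I m <= S.
Proof.
have /andP[h1 h2] := r_range m.
have rk k : 0 <= r m ^+ (k + k)%N <= 1 by rewrite exprn_ge0//= exprn_ile1// ltW.
rewrite IE; apply: ler_rsum => //; last first.
  by move=> k; have /andP[_ h] := rk k; rewrite ler_piMr ?sqr_ge0.
apply: abs_summable_dom c2_summable => k; have /andP[h h'] := rk k.
by rewrite normrM (ger0_norm h) ler_piMr.
Qed.

Let trunc (N : nat) x := Num.min (L x) N%:R.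

Let mL : measurable_fun circle L := circle_integrable_measurable Li.

Let E_measurable N : measurable_fun circle (fun x => expR (trunc N x)).
Proof.
apply: (@measurableT_comp _ _ _ _ _ _ (@expR R)) => //.
exact: measurable_minr.
Qed.

Let E_integrable N : circle_integrable (fun x => expR (trunc N x)).
Proof.
apply: circle_integrable_le Di; first exact: E_measurable.
by move=> x _; rewrite ger0_norm ?expR_ge0// ler_expR ge_min lexx.
Qed.

(** L1 convergence of the exponents p to [L] gives no control of unbounded exponentials. With t the
    truncation, exp p >= exp t (1 + p - t) >= exp t + exp t (p - L), and exp t is bounded by exp N,
    so the error is at most [expR N%:R * Lerr m]. *)
Let E_le N : \int[mu]_(x in circle) expR (trunc N x) <= S.
Proof.
have le_m m : \int[mu]_(x in circle) expR (trunc N x) <= S + expR N%:R * Lerr m.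
  have pLi : circle_integrable (fun x => `|poisson (r m) L x - L x|).
    by apply: circle_integrable_norm; apply: circle_integrableB => //; exact: circle_integrable_poisson.
  rewrite (@le_trans _ _ (I m + expR N%:R * Lerr m))//; last by rewrite lerD2r.
  rewrite /I /Lerr -circle_integralZ// -circle_integralD//; last exact: circle_integrableZ.
  apply: circle_integral_le => //; first by apply: circle_integrableD => //; exact: circle_integrableZ.
  move=> x _; rewrite fE; set p := poisson (r m) L x.
  have h := expR_ge1Dx (p - trunc N x).
  have tl : trunc N x <= L x by rewrite ge_min lexx.
  have tN : trunc N x <= N%:R by rewrite ge_min lexx orbT.
  have -> : expR p = expR (trunc N x) * expR (p - trunc N x) by rewrite -expRD addrC subrK.
  have E0 := expR_ge0 (trunc N x).
  have h1 : expR (trunc N x) * (1 + (p - trunc N x)) <= expR (trunc N x) * expR (p - trunc N x).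
    by rewrite ler_wpM2l.
  have h2 : expR (trunc N x) * (p - L x) <= expR (trunc N x) * (p - trunc N x).
    by rewrite ler_wpM2l// lerD2l lerN2.
  have h3 : - (expR N%:R * `|p - L x|) <= expR (trunc N x) * (p - L x).
    rewrite lerNl -mulrN; apply: (@le_trans _ _ (expR (trunc N x) * `|p - L x|)).
      by rewrite ler_wpM2l// -normrN ler_norm.
    by rewrite ler_wpM2r// ler_expR.
  by rewrite mulrDr mulr1 in h1; lra.
have c0 : (fun m => S + expR N%:R * Lerr m) @ \oo --> S + expR N%:R * 0.
  by apply: cvgD; [exact: cvg_cst|apply: cvgMr; exact: poisson_L1].
rewrite mulr0 addr0 in c0; rewrite -(cvg_lim _ c0)//.
by apply: limr_ge; [apply: cvgP c0|exact: nearW].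
Qed.

Let D_le : \int[mu]_(x in circle) D x <= S.
Proof.
have mc : measurable circle by exact: measurable_itv.
have [] := @dominated_convergence _ _ _ mu circle mc
  (fun N x => (expR (trunc N x))%:E) (EFin \o D) (EFin \o D).
- by move=> N; apply/measurable_EFinP; exact: E_measurable.
- by apply/measurable_EFinP; exact: circle_integrable_measurable.
- apply: aeW => x _ /=; apply: cvg_EFin; first exact: nearW.
  apply: cvg_near_cst; exists (Num.trunc (L x)).+1 => //= N /= hN.
  rewrite /trunc /D min_l// (le_trans (ltW (truncnS_gt _)))// ler_nat//.
- exact: Di.
- apply: aeW => x N _ /=; rewrite lee_fin ger0_norm ?expR_ge0//.
  by rewrite ler_expR ge_min lexx.
move=> _ _ h.
have : (fun N => \int[mu]_(x in circle) expR (trunc N x)) @ \oo --> \int[mu]_(x in circle) D x.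
  apply: fine_cvg; rewrite fineK; first exact: h.
  exact: integrable_fin_num.
move=> cl; rewrite -(cvg_lim _ cl)//.
by apply: limr_le; [apply: cvgP cl|exact: nearW].
Qed.

(** By Jensen [f m] lies below the Poisson integral of [D], so their L1 distance is the difference
    of their integrals. That integral is at most [S + Derr m] by [D_le], and the integral of [f m]
    tends to [S]: the squeeze needs no dominating function. *)
Let f_L1 : (fun m => \int[mu]_(x in circle) `|f m x - D x|) @ \oo --> (0 : R).
Proof.
have cl : (fun m => S - I m + 2 * Derr m) @ \oo --> S - S + 2 * 0.
  apply: cvgD; first by apply: cvgB; [exact: cvg_cst|exact: I_cvg].
  by apply: cvgMr; exact: poisson_L1.
rewrite subrr mulr0 addr0 in cl.
apply: (squeeze_cvgr _ (cvg_cst 0) cl); apply: nearW => m; apply/andP; split.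
  by apply: Rintegral_ge0.
have pDi := circle_integrable_poisson (r_range m) Di.
have pDDi := circle_integrable_norm (circle_integrableB pDi Di).
have pDf := circle_integrableB pDi (fi m).
have h1 : \int[mu]_(x in circle) `|f m x - D x| <=
    (\int[mu]_(x in circle) poisson (r m) D x - I m) + Derr m.
  rewrite /I /Derr -circle_integralB// -circle_integralD//.
  apply: circle_integral_le.
  - by apply: circle_integrable_norm; exact: circle_integrableB.
  - exact: circle_integrableD.
  - move=> x _.
    have h : f m x <= poisson (r m) D x by rewrite fE; exact: expR_poisson_le.
    have -> : f m x - D x = (f m x - poisson (r m) D x) + (poisson (r m) D x - D x) by ring.
    by rewrite (le_trans (ler_normD _ _))// lerD2r distrC ger0_norm// subr_ge0.
have h2 : \int[mu]_(x in circle) poisson (r m) D x <= S + Derr m.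
  apply: le_trans (lerD D_le (lexx _)).
  rewrite -circle_integralD//; apply: circle_integral_le => //.
    exact: circle_integrableD.
  by move=> x _; rewrite -lerBlDl ler_norm.
by lra.
Qed.

Lemma fourier_expR n :
  \int[mu]_(x in circle) (D x * cos (n%:R * x)) = acov c n.
Proof.
have ccos : continuous (fun x : R => cos (n%:R * x)).
  rewrite (_ : (fun x => _) = fun x : R => cos (n%:R * x + 0)).
    by apply: continuous_affine_comp; exact: continuous_cos.
  by apply/funext => x; rewrite addr0.
have ci (g : R -> R) : circle_integrable g ->
    circle_integrable (fun x : R => g x * cos (n%:R * x)).
  move=> gi; rewrite (_ : (fun x => _) = fun x : R => cos (n%:R * x) * g x).
    apply: (@circle_integrableMl _ _ _ 1) => //.
      by apply: measurable_funTS; apply: continuous_measurable_fun; exact: ccos.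
    by move=> x _; exact: cos_max.
  by apply/funext => x; rewrite mulrC.
have c1 : (fun m => \int[mu]_(x in circle) (f m x * cos (n%:R * x))) @ \oo -->
    \int[mu]_(x in circle) (D x * cos (n%:R * x)).
  apply: cvg_sub0 (cvg_cst _); apply: norm_cvg0.
  apply: (squeeze_cvgr _ (cvg_cst 0) f_L1); apply: nearW => m.
  rewrite normr_ge0/= !fctE -circle_integralB; try exact: ci.
  have ii := circle_integrableB (ci _ (fi m)) (ci _ Di).
  rewrite (le_trans (circle_integral_norm_le ii))//.
  apply: circle_integral_le; first exact: circle_integrable_norm.
    by apply: circle_integrable_norm; exact: circle_integrableB.
  by move=> x _; rewrite -mulrBl normrM ler_piMr// cos_max.
have c2 : (fun m => \int[mu]_(x in circle) (f m x * cos (n%:R * x))) @ \oo --> acov c n.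
  under eq_fun do rewrite f_fourier.
  apply: abel_summation => //; last first.
    by move=> m; have /andP[h1 h2] := r_range m; rewrite h1 ltW.
  by exists S => N; exact: (sum_corr_le c2_summable n%:Z).
by rewrite -(cvg_lim _ c1)// -(cvg_lim _ c2).
Qed.

End SpectralFactorization.

Section AutocovarianceFactorization.
Context {R : realType}.
Local Open Scope complex_scope.
Notation mu := (@lebesgue_measure R).
Notation circle := (`[- pi, pi]%classic : set R).
Variables (gam : int -> R) (Delta : R -> R) (c : nat -> R) (C : R).
Hypothesis gam_density : spectral_density gam Delta.
Hypothesis Delta_log : log_integrable Delta.
Hypothesis c_MA : MA_coefficients Delta c.
Hypothesis c_bounded : forall k, `|c k| <= C.
Hypothesis c2_summable : abs_summable (fun k => c k ^+ 2).

Let L t := ln (Delta t).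
(** It agrees with [Delta] only where [Delta] is positive; elsewhere [ln] is 0 and [D] is 1. Hence
    the dominating function [|Delta x| + 1] in [Di], and the almost everywhere comparison in
    [spectral_autocovariance]. *)
Let D t := expR (L t).

Let Li : circle_integrable L. Proof. by have [_] := Delta_log. Qed.
Let Deltai : circle_integrable Delta. Proof. by have [_ _] := gam_density. Qed.

Let mD : measurable_fun circle D.
Proof.
apply: (@measurableT_comp _ _ _ _ _ _ (@expR R)) => //.
exact: circle_integrable_measurable.
Qed.

Let Di : circle_integrable D.
Proof.
apply: (@circle_integrable_le _ _ (fun x => `|Delta x| + 1)) => //.
  move=> x _; rewrite ger0_norm ?expR_ge0// /D /L.
  have [D0|D0] := ltP 0 (Delta x).
    by rewrite lnK ?posrE// (le_trans (ler_norm _))// lerDl.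
  by rewrite ln0// expR0 lerDr.
by apply: circle_integrableD; [exact: circle_integrable_norm|exact: circle_integrable_cst].
Qed.

Let r (m : nat) : R := 1 - harmonic m.

Let r_range m : 0 <= r m < 1.
Proof.
by rewrite /r subr_ge0 ltrBlDr ltrDl harmonic_gt0 andbT invf_le1 ?ler1n ?ltr0n.
Qed.

Let r_cvg : r @ \oo --> (1 : R).
Proof.
by rewrite -[X in _ --> X](subr0 1); apply: cvgB; [exact: cvg_cst|exact: cvg_harmonic].
Qed.

Let twopi : 0 < 2 * pi :> R. Proof. by rewrite mulr_gt0// pi_gt0. Qed.

Let f m x := (2 * pi)^-1 * energy (fun k => c k * r m ^+ k) x.

Let fE m x : f m x = expR (poisson (r m) L x).
Proof.
rewrite /f; have [_ ->] := energy_szego x c_MA c_bounded (r_range m).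
by rewrite mulrA mulVf ?mul1r// gt_eqF.
Qed.

Let fi m : circle_integrable (f m).
Proof.
have [sb _] := energy_szego 0 c_MA c_bounded (r_range m).
by apply: circle_integrableZ; exact: circle_integrable_energy.
Qed.

Let f_fourier m n :
  \int[mu]_(x in circle) (f m x * cos (n%:R * x)) =
  rsum (fun k => (c k * c (k + n)%N) * r m ^+ (k + (k + n))%N).
Proof.
have [sb _] := energy_szego 0 c_MA c_bounded (r_range m).
have ccos : continuous (fun x : R => cos (n%:R * x)).
  rewrite (_ : (fun x => _) = fun x : R => cos (n%:R * x + 0)).
    by apply: continuous_affine_comp; exact: continuous_cos.
  by apply/funext => x; rewrite addr0.
have ei := circle_integrable_energy sb.
transitivity ((2 * pi)^-1 * \int[mu]_(x in circle)
    (energy (fun k => c k * r m ^+ k) x * cos (n%:R * x))).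
  rewrite -circle_integralZ; first by apply: eq_Rintegral => x _; rewrite /f mulrA.
  rewrite (_ : (fun x => _) = fun x : R => cos (n%:R * x) * energy (fun k => c k * r m ^+ k) x).
    apply: (@circle_integrableMl _ _ _ 1) => //.
      by apply: measurable_funTS; apply: continuous_measurable_fun; exact: ccos.
    by move=> x _; exact: cos_max.
  by apply/funext => x; rewrite mulrC.
rewrite (parseval sb) mulrA mulVf ?mul1r ?gt_eqF//.
by apply: eq_rsum => k; rewrite [in RHS]exprD mulrACA.
Qed.

Theorem spectral_autocovariance (n : nat) : gam n%:Z = acov c n.
Proof.
rewrite -(fourier_expR Li Di r_range r_cvg c2_summable fi fE f_fourier).
have [_ _ _ /(_ n%:Z) E] := gam_density.
have -> : gam n%:Z = complex.Re (circle_integral (fun x => cexp ('i * ((n%:Z)%:~R * x)%:C) * (Delta x)%:C)).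
  by rewrite -E.
rewrite Re_circle_integral.
have ReE x : complex.Re (cexp ('i * ((n%:Z)%:~R * x)%:C) * (Delta x)%:C) =
    Delta x * cos (n%:R * x).
  by rewrite cexp_polar /polar; simpc; rewrite /= mulrC.
under eq_Rintegral do rewrite ReE.
have mcos : measurable_fun circle (fun x : R => cos (n%:R * x)).
  apply: measurable_funTS; apply: continuous_measurable_fun.
  rewrite (_ : (fun x => _) = fun x : R => cos (n%:R * x + 0)).
    by apply: continuous_affine_comp; exact: continuous_cos.
  by apply/funext => x; rewrite addr0.
congr fine; apply: ae_eq_integral => //.
- by apply/measurable_EFinP; apply: measurable_funM => //; exact: circle_integrable_measurable.
- by apply/measurable_EFinP; apply: measurable_funM => //; exact: circle_integrable_measurable.
- have [[N [mN N0 NI]] _] := Delta_log.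
  exists N; split => // x /= h; apply: NI => /= xI; apply: h => xc.
  have D0 : 0 < Delta x by apply: xI.
  by rewrite lnK ?posrE.
Qed.

End AutocovarianceFactorization.

(** * Slowly varying functions *)

Section UniformConvergence.
Variable R : realType.
Local Notation mu := (@lebesgue_measure R).

Lemma lebesgue_measure_shift (t : R) (A : set R) : measurable A ->
  mu ((fun x => x - t) @^-1` A) = mu A.
Proof.
have m_shift : measurable_fun setT ((fun x => x - t) : R -> measurableTypeR R).
  by apply: measurable_funD => //; exact: measurable_id.
move=> mA.
rewrite -[LHS]/(pushforward mu ((fun x => x - t) : R -> measurableTypeR R) A).
apply/esym/lebesgue_measure_unique => //= _ [[u v]] _ <-.
rewrite /pushforward/=.
rewrite (_ : _ @^-1` _ = [set` `]u + t, v + t]]); last first.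
  by apply/seteqP; split => x /=; rewrite !in_itv/= ltrBrDr lerBlDr.
rewrite !lebesgue_measure_itv/= !lte_fin ltrD2r.
by case: ifP => // _; rewrite -!EFinB; congr (_%:E); ring.
Qed.

Lemma egorov_eventually (f : nat -> R -> R) (w eps e : R) :
  (forall n, measurable_fun setT (f n)) ->
  (forall x, 0 <= x <= w -> f ^~ x @ \oo --> (0 : R)) -> 0 < eps -> 0 < e ->
  exists B, [/\ measurable B, (mu B < eps%:E)%E & exists N, forall n x,
    (N <= n)%N -> 0 <= x <= w -> ~ B x -> `|f n x| < e].
Proof.
move=> mf f0 eps0 e0.
have mu_fin : (mu `[0%R, w] < +oo)%E.
  by rewrite lebesgue_measure_itv/=; case: ifP => // _; exact: ltry.
have [] := @pointwise_almost_uniform _ R (measurableTypeR R) mu f (fun=> 0) `[0, w] eps => //.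
  by move=> n; exact: (measurable_funS measurableT (@subsetT _ _) (mf n)).
move=> B [mB Beps unif]; exists B; split => //.
have /unif : nbhs ((fun=> 0) : {uniform` (`[0, w] `\` B)%classic -> R})
    [set g : R -> R | forall x, (`[0, w] `\` B) x -> `|g x| < e].
  apply/uniform_nbhs; exists [set xy | ball xy.1 e xy.2]; split.
    exact: entourage_ball (PosNum e0).
  by move=> g /= gP x /gP; rewrite /ball/= sub0r normrN.
move=> [N _ NP]; exists N => n x Nn xw nBx; exact: NP.
Qed.

(* By Egorov, convergence along x_n and along x_n + u_n is uniform off small sets;
   moved to a common unit interval, these sets do not cover it. *)
Lemma uniform_shift (h : R -> R) (e : R) : measurable_fun setT h ->
  (forall u, h (x + u) - h x @[x --> +oo] --> 0) -> 0 < e ->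
  exists x0, forall x u, x0 <= x -> 0 <= u <= 1 -> `|h (x + u) - h x| <= e.
Proof.
move=> mh h0 e0; apply: contrapT => nex.
have bad n : {xu : R * R | [/\ n%:R <= xu.1, 0 <= xu.2 <= 1 &
    e < `|h (xu.1 + xu.2) - h xu.1|]}.
  apply: cid; apply: contrapT => nbad; apply: nex; exists n%:R => x u nx u01.
  by rewrite leNgt; apply/negP => ?; apply: nbad; exists (x, u).
pose x n := (sval (bad n)).1; pose u n := (sval (bad n)).2.
have xn n : n%:R <= x n by case: (svalP (bad n)).
have u01 n : 0 <= u n <= 1 by case: (svalP (bad n)).
have xuP n : e < `|h (x n + u n) - h (x n)| by case: (svalP (bad n)).
have mhs (t : R) : measurable_fun setT (fun s : R => h (t + s)).
  by apply: measurableT_comp => //; apply: measurable_funD.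
have cvg_h (y : nat -> R) s : (forall n, n%:R <= y n) ->
    (fun n => h (y n + s) - h (y n)) @ \oo --> (0 : R).
  move=> yn; apply: (cvg_comp _ _ _ (h0 s)).
  have := @cvgr_idn R; apply: ger_cvgy.
  by near=> n; exact: yn.
have e20 : 0 < e / 2 by rewrite divr_gt0.
(* A common point s is sought in [t, t + 1] with t in [0, 1]: it lies in [0, 2], and [s - t] in
   [0, 1], whence the two windows. Exceptional sets of measure below 1/2 each cannot cover an
   interval of length 1. *)
have [B1 [mB1 B1lt [N1 N1P]]] := @egorov_eventually
  (fun n s => h (x n + s) - h (x n)) 2 (1 / 2) (e / 2)
  (fun n => measurable_funB (mhs (x n)) (@measurable_cst _ _ _ _ _ _))
  (fun s _ => cvg_h x s xn) ltac:(lra) e20.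
have xun n : n%:R <= x n + u n.
  by apply: le_trans (xn n) _; rewrite lerDl; case/andP: (u01 n).
have [B2 [mB2 B2lt [N2 N2P]]] := @egorov_eventually
  (fun n s => h (x n + u n + s) - h (x n + u n)) 1 (1 / 2) (e / 2)
  (fun n => measurable_funB (mhs (x n + u n)) (@measurable_cst _ _ _ _ _ _))
  (fun s _ => cvg_h (fun n => x n + u n) s xun) ltac:(lra) e20.
pose N := maxn N1 N2; pose t := u N.
have [s [s_ge s_le nB1 nB2]] : exists s, [/\ t <= s, s <= t + 1, ~ B1 s &
    ~ B2 (s - t)].
  apply: contrapT => nex_s.
  have mB2t : measurable ((fun s : R => s - t) @^-1` B2).
    by rewrite -[X in measurable X]setTI; exact: measurable_funB.
  have : (mu `[t, (t + 1)%R] <= mu B1 + mu ((fun s : R => (s - t)%R) @^-1` B2))%E.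
    apply: (@le_trans _ _ (mu (B1 `|` (fun s : R => s - t) @^-1` B2))); last first.
      exact: measureU2.
    apply: le_measure; rewrite ?inE//; first exact: measurableU.
    move=> s /=; rewrite in_itv/= => /andP[ts st].
    by apply: contrapT => /not_orP[nB1 nB2]; apply: nex_s; exists s.
  rewrite lebesgue_measure_shift// lebesgue_measure_itv/= lte_fin ltrDl ltr01.
  apply/negP; rewrite -ltNge.
  apply: (lt_le_trans (lteD B1lt B2lt)).
  by rewrite -EFinD -EFinB lee_fin; lra.
have := xuP N; apply/negP; rewrite -leNgt.
have /andP[t0 t1] := u01 N; rewrite -/t in t0 t1 *.
have := N1P N s (leq_maxl _ _); have := N2P N (s - t) (leq_maxr _ _).
rewrite -/t (_ : x N + t + (s - t) = x N + s); last by ring.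
move=> /(_ _ nB2) H2 /(_ _ nB1) H1.
have {}H1 := H1 ltac:(lra); have {}H2 := H2 ltac:(lra).
rewrite (_ : h (x N + t) - h (x N) = (h (x N + s) - h (x N)) -
  (h (x N + s) - h (x N + t))); last by ring.
apply: le_trans (ler_normB _ _) _.
by move: (`|_|) (`|_|) H1 H2 => ? ? ? ?; lra.
Unshelve. all: by end_near. Qed.

End UniformConvergence.

Section SlowVariation.
Variable R : realType.
Implicit Types l : R -> R.

(** A shift by [u] is a chain of at most [u + 1] shifts of length at most 1, each costing [e]. After
    exponentiation the linear growth becomes a small power. *)
Lemma uniform_shift_linear (h : R -> R) (e : R) : measurable_fun setT h ->
  (forall u, h (x + u) - h x @[x --> +oo] --> 0) -> 0 < e ->
  exists x0, forall x u, x0 <= x -> 0 <= u -> `|h (x + u) - h x| <= e * (u + 1).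
Proof.
move=> mh h0 e0; have [x0 x0P] := uniform_shift mh h0 e0; exists x0.
have step n x u : x0 <= x -> 0 <= u <= n%:R -> `|h (x + u) - h x| <= e * n%:R.
  elim: n x u => [|n ih] x u x0x /andP[u0 un].
    by rewrite (_ : u = 0) ?addr0 ?subrr ?normr0 ?mulr0//; apply: le_anti; lra.
  have [u1|u1] := leP u 1.
    apply: le_trans (x0P _ _ x0x _) _; first by rewrite u0.
    by rewrite ler_peMr// ?ler1n// ltW.
  rewrite -natr1 mulrDr mulr1.
  rewrite (_ : h (x + u) - h x =
    (h (x + 1 + (u - 1)) - h (x + 1)) + (h (x + 1) - h x)); last first.
    by rewrite (_ : x + 1 + (u - 1) = x + u); ring.
  apply: le_trans (ler_normD _ _) _; apply: lerD.
    by apply: ih; [lra|rewrite -natr1 in un; lra].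
  by apply: x0P => //; lra.
move=> x u x0x u0; have /andP[nu un] := truncn_itv u0.
apply: le_trans (step (Num.truncn u).+1 x u x0x _) _; first by rewrite u0 ltW.
by rewrite ler_pM2l// -natr1 lerD2r.
Qed.

Lemma cvgy_expR : expR x @[x --> +oo] --> (+oo : set_system R).
Proof.
apply/cvgryPge => w; near=> x; apply: (@le_trans _ _ (1 + x)).
  by apply: (@le_trans _ _ x); [near: x; apply: nbhs_pinfty_ge; exact: num_real|rewrite lerDr ler01].
exact: expR_ge1Dx.
Unshelve. all: by end_near. Qed.

Lemma slowly_varying_gt0 l : slowly_varying l ->
  exists N, forall n, (N <= n)%N -> 0 < l n%:R.
Proof.
move=> [[b [l_gt0 _]] _]; exists (Num.truncn b).+1 => n bn; apply: l_gt0.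
by apply: le_trans (ltW (truncnS_gt b)) _; rewrite ler_nat.
Qed.

(** In the logarithmic variable, h(x) = ln l(e^x) turns dilations into shifts. Cutting the argument
    off below at [b] makes [h] measurable on the whole line, since nothing is known about [l] before
    its starting point. *)
Lemma slowly_varying_shift l : slowly_varying l ->
  exists b (h : R -> R), [/\ 1 <= b, forall y, b <= y -> 0 < l y /\ h (ln y) = ln (l y),
    measurable_fun setT h & forall u, h (x + u) - h x @[x --> +oo] --> 0].
Proof.
move=> [[b0 [l_gt0 ml]] l_sv]; pose b := Num.max b0 1.
have b0b : b0 <= b by rewrite le_max lexx.
have b1 : 1 <= b by rewrite le_max lexx orbT.
pose h x := ln (l (Num.max b (expR x))).
have hE y : b <= expR y -> h y = ln (l (expR y)) by rewrite /h => /max_r ->.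
exists b, h; split=> //.
- move=> y yb; split; first by apply: l_gt0; exact: le_trans yb.
  by rewrite hE lnK// posrE; apply: lt_le_trans yb; exact: lt_le_trans b1.
- apply: measurableT_comp => //.
  apply: (measurable_comp (F := `[b0, +oo[)) => //.
    by move=> _ [y _ <-] /=; rewrite in_itv/= andbT le_max b0b.
  by apply: measurable_maxr => //; exact: measurable_expR.
move=> u.
have lim1 : ln (l (expR u * expR x) / l (expR x)) @[x --> +oo] --> (0 : R).
  rewrite -(@ln1 R).
  apply: (cvg_comp (fun x => l (expR u * expR x) / l (expR x)) (@ln R)).
    exact: (cvg_comp _ _ cvgy_expR (l_sv _ (expR_gt0 u))).
  by apply: continuous_ln.
apply: cvg_trans lim1; apply: near_eq_cvg.
near=> x.
have bx : b <= expR x by near: x; move/cvgryPge : cvgy_expR; exact.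
have bxu : b <= expR (x + u).
  have : b * expR (- u) <= expR x by near: x; move/cvgryPge : cvgy_expR; exact.
  by rewrite -ler_pdivlMr ?expR_gt0// expRN invrK expRD.
rewrite !hE// -expRD (addrC u) ln_div// posrE; apply: l_gt0.
  exact: le_trans bxu.
exact: le_trans bx.
Unshelve. all: by end_near. Qed.

(** With the slope ln(1 + e) in [uniform_shift_linear], exponentiating ln(1 + e) (ln(m/k) + 1) gives
    the factor 1 + e and the power ln(1 + e) <= e of m/k. *)
Lemma slowly_varying_potter l : slowly_varying l ->
  potter (fun n => l n%:R).
Proof.
move=> /slowly_varying_shift[b [h [b1 hP mh h0]]] e e0.
have e1_gt0 : 0 < ln (1 + e) by rewrite ln_gt0// ltrDl.
have e1_le : ln (1 + e) <= e by rewrite le_ln1Dx//; lra.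
have [x0 x0P] := uniform_shift_linear mh h0 e1_gt0.
exists (Num.truncn (Num.max b (expR x0))).+1 => k m Nk km.
have : Num.max b (expR x0) <= k%:R.
  by apply: le_trans (ltW (truncnS_gt _)) _; rewrite ler_nat.
rewrite ge_max => /andP[bk x0k].
have k_gt0 : 0 < k%:R :> R by apply: lt_le_trans bk; exact: lt_le_trans b1.
have km' : k%:R <= m%:R :> R by rewrite ler_nat.
have m_gt0 : 0 < m%:R :> R by exact: lt_le_trans km'.
have [lk hk] := hP _ bk; have [lm hm] := hP _ (le_trans bk km').
have u0 : 0 <= ln (m%:R / k%:R) :> R by rewrite ln_ge0// ler_pdivlMr// mul1r.
have := x0P (ln k%:R) _ _ u0; rewrite -lnM ?posrE ?divr_gt0//.
rewrite mulrC divfK ?gt_eqF// hk hm.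
have x0_le : x0 <= ln k%:R by rewrite -ler_expR lnK ?posrE.
move=> /(_ x0_le); rewrite ler_norml => /andP[le1 le2].
have up : expR (ln (1 + e) * (ln (m%:R / k%:R) + 1)) <= (1 + e) * (m%:R / k%:R) `^ e.
  rewrite mulrDr mulr1 expRD [X in _ * X]lnK ?posrE; last by lra.
  rewrite [leLHS]mulrC ler_pM2l; last by lra.
  by rewrite /powR gt_eqF ?divr_gt0// ler_expR ler_wpM2r.
have exp_le x y : 0 < x -> 0 < y ->
    ln y - ln x <= ln (1 + e) * (ln (m%:R / k%:R) + 1) ->
    y <= (1 + e) * (m%:R / k%:R) `^ e * x.
  move=> x_gt0 y_gt0 xy; apply: le_trans (ler_wpM2r (ltW x_gt0) up).
  rewrite -[leLHS]lnK ?posrE// -[X in _ * X]lnK ?posrE// -expRD ler_expR.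
  by rewrite -lerBlDr.
split; apply: exp_le => //.
by rewrite -opprB lerNl.
Qed.

End SlowVariation.

(** * Inverse coefficients and normal equations *)

Section PowerSeries.
Context {R : realType}.
Local Open Scope complex_scope.
Implicit Types u v e : nat -> R.

Lemma cauchy_product u v : abs_summable u -> abs_summable v ->
  abs_summable (fun s => \sum_(0 <= i < s.+1) u i * v (s - i)%N) /\
  rsum (fun s => \sum_(0 <= i < s.+1) u i * v (s - i)%N) = rsum u * rsum v.
Proof.
move=> su sv; have [A uA] := su; have [B vB] := sv.
have sumAB N : \sum_(0 <= i < N) \sum_(0 <= j < N) `|u i * v j| <= A * B.
  under eq_bigr => i _.
    under eq_bigr do rewrite normrM.
    rewrite -mulr_sumr; over.
  rewrite -mulr_suml; apply: ler_pM => //; exact: sumr_ge0.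
split; last first.
  rewrite -(rsum_antidiag sumAB) -rsumZr//.
  by apply: eq_rsum => i; rewrite rsumZ.
exists (A * B) => N.
apply: le_trans (sumAB N).
apply: (@le_trans _ _ (\sum_(0 <= s < N) \sum_(0 <= i < s.+1) `|u i * v (s - i)%N|)).
  by apply: ler_sum => s _; exact: ler_norm_sum.
rewrite (sum_antidiag (fun i j => `|u i * v j|)).
apply: ler_sum => i _.
rewrite [leRHS](@big_cat_nat _ _ _ (N - i))//= ?leq_subr// lerDl.
exact: sumr_ge0.
Qed.

(** Once the earlier coefficients vanish, |e n| r^n is at most the absolute tail beyond n. For r <=
    1/2 that tail is at most (2r)^(n+1) times its value at 1/2, so |e n| = O(r), and r tends to
    0. *)
Lemma power_series_coef_eq0 e :
  (forall r, 0 <= r < 1 -> abs_summable (fun k => e k * r ^+ k)) ->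
  (forall r, 0 <= r < 1 -> rsum (fun k => e k * r ^+ k) = 0) ->
  forall n, e n = 0.
Proof.
move=> se e0; elim/ltn_ind => n IHn.
have half : 0 <= (2^-1 : R) < 1 by apply/andP; split; lra.
pose B := rsum (fun k => `|e (n.+1 + k)%N * 2^-1 ^+ (n.+1 + k)|) * 2 ^+ n.+1.
have bound r : 0 < r -> r <= 2^-1 -> `|e n| <= r * B.
  move=> r_gt0 r_le; have rr : 0 <= r < 1 by apply/andP; split; lra.
  have := e0 r rr; rewrite (rsum_shift n.+1 (se r rr)) big_nat_recr//=.
  rewrite big_nat_cond big1 ?add0r; last first.
    by move=> i /andP[/andP[_ /IHn ->] _]; rewrite mul0r.
  move=> /eqP; rewrite addr_eq0 => /eqP E.
  have rn : 0 < r ^+ n by rewrite exprn_gt0.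
  rewrite -(ler_pM2r rn) -[X in _ * X](ger0_norm (ltW rn)) -normrM E normrN.
  apply: le_trans (ler_norm_rsum (abs_summable_shift n.+1 (se r rr))) _.
  have -> : r * B * r ^+ n = (r * 2) ^+ n.+1 *
      rsum (fun k => `|e (n.+1 + k)%N * 2^-1 ^+ (n.+1 + k)|).
    by rewrite /B exprMn (exprS r); ring.
  rewrite -rsumZ; last first.
    exact: abs_summable_norm (abs_summable_shift n.+1 (se _ half)).
  apply: ler_rsum.
  - exact: abs_summable_norm (abs_summable_shift n.+1 (se r rr)).
  - apply: abs_summableZ.
    exact: abs_summable_norm (abs_summable_shift n.+1 (se _ half)).
  move=> k; rewrite !normrM mulrCA ler_wpM2l//.
  have r2 : 0 <= r * 2 <= 1 by apply/andP; split; lra.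
  have rE : r = r * 2 * 2^-1 by field.
  rewrite !ger0_norm; last 2 first.
  - by rewrite exprn_ge0//; lra.
  - by rewrite exprn_ge0//; lra.
  have h2 : 0 <= (2^-1 : R) ^+ (n.+1 + k) by rewrite exprn_ge0//; lra.
  rewrite {1}rE exprMn ler_wpM2r//.
  by case/andP: r2 => r20 r21; apply: ler_wiXn2l => //; rewrite leq_addr.
apply/eqP; rewrite -normr_le0; apply/ler_addgt0Pl => eps eps0; rewrite addr0.
have B0 : 0 <= B.
  by have := bound 2^-1; rewrite lexx => /(_ ltac:(lra) isT); move: (normr_ge0 (e n)); lra.
have [s0 s1] : 0 < Num.min 2^-1 (eps / (B + 1)) /\ Num.min 2^-1 (eps / (B + 1)) <= 2^-1.
  by rewrite ge_min lexx lt_min divr_gt0//; [split => //; lra|lra].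
apply: le_trans (bound _ s0 s1) _.
apply: (@le_trans _ _ (eps / (B + 1) * B)).
  by rewrite ler_wpM2r// ge_min lexx orbT.
by rewrite mulrAC ler_pdivrMr ?ler_pM2l; lra.
Qed.

(** Real points of the disc suffice: there the sine series vanish, and [f * g = -1] becomes an
    identity between real power series. *)
Lemma power_series_inverse u v (f g : R[i] -> R[i]) (K : R) :
  power_series_on_disc u f -> power_series_on_disc v g ->
  (forall k, `|u k| <= K) -> (forall k, `|v k| <= K) ->
  (forall z, f z * g z = -1) ->
  forall n, \sum_(0 <= i < n.+1) u i * v (n - i)%N = - (n == 0%N)%:R.
Proof.
move=> uf vg uK vK fg n; apply/eqP; rewrite -addr_eq0; apply/eqP.
pose w s := \sum_(0 <= i < s.+1) u i * v (s - i)%N.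
have delta (r : R) : rsum (fun k => (k == 0%N)%:R * r ^+ k) = 1 /\
    abs_summable (fun k => (k == 0%N)%:R * r ^+ k).
  split.
    rewrite (rsum_finsupp (m := 1)) ?big_nat1 ?mulr1// => -[|k]//.
    by rewrite mul0r.
  exists 1; elim=> [|[|N] ih]; first by rewrite big_nil.
    by rewrite big_nat1 mulr1 normr1.
  by rewrite big_nat_recr//= mul0r normr0 addr0.
have wE r : (fun k => w k * r ^+ k) =
    fun s => \sum_(0 <= i < s.+1) (u i * r ^+ i) * (v (s - i)%N * r ^+ (s - i)).
  apply/funext => s; rewrite /w big_distrl/=; apply: eq_big_nat => i /= i_s.
  by rewrite mulrACA -exprD subnKC.
have both r : 0 <= r < 1 -> abs_summable (fun k => w k * r ^+ k) /\
    rsum (fun k => w k * r ^+ k) = - 1.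
  move=> rr; have su := abs_summable_geometric uK rr.
  have sv := abs_summable_geometric vK rr.
  have [sw we] := cauchy_product su sv; rewrite wE; split=> //.
  rewrite we; have gfE := fg (polar r 0).
  have [uR uI] := power_series_parts 0 uf rr.
  have [vR vI] := power_series_parts 0 vg rr.
  have drop_cos q : (fun k => q k * r ^+ k * cos (k%:R * 0)) = fun k => q k * r ^+ k.
    by apply/funext => k; rewrite mulr0 cos0 mulr1.
  have drop_sin q (y : R) :
      series (fun k => q k * r ^+ k * sin (k%:R * 0)) @ \oo --> y -> y = 0.
    move/rsumE <-; rewrite -[RHS]rsum0; apply: eq_rsum => k.
    by rewrite mulr0 sin0 mulr0.
  rewrite drop_cos in uR; rewrite drop_cos in vR.
  move/drop_sin : uI; move/drop_sin : vI.
  rewrite (rsumE uR) (rsumE vR).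
  case: (f _) (g _) gfE => x y [z t]; simpc => -[zt _] /= t0 y0.
  by rewrite -zt t0 y0 mulr0 subr0.
have := @power_series_coef_eq0 (fun k => w k + (k == 0%N)%:R) _ _ n; apply.
- move=> r rr; under eq_fun do rewrite mulrDl.
  by apply: abs_summableD; [have [] := both r rr|have [] := delta r].
- move=> r rr; rewrite (eq_rsum (fun k => mulrDl _ _ _)).
  rewrite rsumD; [|by have [] := both r rr|by have [] := delta r].
  by rewrite (both r rr).2 (delta r).1 addNr.
Qed.

End PowerSeries.

Section InverseCoefficients.
Context {R : realType}.
Implicit Types (Delta : R -> R) (c a : nat -> R).

Lemma szego_neq0 Delta z : szego Delta z != 0.
Proof.
have twopi : 0 < 2 * pi :> R by rewrite mulr_gt0// pi_gt0.
apply/eqP => h0; have : 0 < sqmod (szego Delta z).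
  rewrite sqmodM sqmod_cexp mulr_gt0 ?expR_gt0//.
  by rewrite /sqmod/= expr0n addr0 sqr_sqrtr ?ltW.
by rewrite h0 /sqmod/= expr0n addr0 ltxx.
Qed.

Lemma MA_AR_convolution Delta c a (K : R) :
  MA_coefficients Delta c -> AR_coefficients Delta a ->
  (forall k, `|c k| <= K) -> (forall k, `|a k| <= K) ->
  forall n, \sum_(0 <= i < n.+1) a i * c (n - i)%N = - (n == 0%N)%:R.
Proof.
move=> cP aP cK aK; apply: power_series_inverse aP cP aK cK _ => z.
by rewrite mulrAC -mulrA divff ?szego_neq0// mulr1.
Qed.

End InverseCoefficients.

Section NormalEquations.
Context (disp : measure_display) (T : measurableType disp) (R : realType)
  (P : probability T R).
Implicit Types (X : int -> T -> R) (Y Z : T -> R).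

Lemma expectation_lincomb (I : Type) (s : seq I) (b : I -> R) (F : I -> T -> R) :
  (forall i, F i \in Lfun P 1) ->
  (fun w => \sum_(i <- s) b i * F i w) \in Lfun P 1 /\
  fine 'E_P[fun w => \sum_(i <- s) b i * F i w] =
    \sum_(i <- s) b i * fine 'E_P[F i].
Proof.
move=> FL; elim: s => [|i s [sL sE]].
  have -> : (fun w => \sum_(i <- [::]) b i * F i w) = cst 0.
    by apply/funext => w; rewrite big_nil.
  by rewrite Lfun_cst expectation_cst big_nil.
have -> : (fun w => \sum_(j <- i :: s) b j * F j w) =
    (b i \o* F i) \+ (fun w => \sum_(j <- s) b j * F j w).
  by apply/funext => w; rewrite big_cons/= mulrC.
have bF : b i \o* F i \in Lfun P 1 by exact: Lfun_scale.
split; first by rewrite rpredD.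
rewrite expectationD// fineD ?expectation_fin_num// sE big_cons.
by rewrite expectationZl// fineM ?expectation_fin_num.
Qed.

Lemma inner_residual (I : Type) (s : seq I) (b : I -> R) (W : I -> T -> R) Y Z :
  (forall i, W i \in Lfun P 2%:E) -> Y \in Lfun P 2%:E -> Z \in Lfun P 2%:E ->
  inner P (Y \- fun w => \sum_(i <- s) b i * W i w) Z =
  inner P Y Z - \sum_(i <- s) b i * inner P (W i) Z.
Proof.
move=> WL YL ZL.
have WZ i : W i \* Z \in Lfun P 1 by exact: Lfun2_mul_Lfun1.
have YZ : Y \* Z \in Lfun P 1 by exact: Lfun2_mul_Lfun1.
have [sL sE] := expectation_lincomb s b WZ.
rewrite /inner -sE -fineB ?expectation_fin_num// -expectationB//.
congr (fine 'E_P[_]); apply/funext => w /=.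
by rewrite mulrBl mulr_suml; under [in RHS]eq_bigr do rewrite mulrA.
Qed.

Lemma closed_span_self X (I : interval int) k : X k \in Lfun P 2%:E -> k \in I ->
  closed_span P X I (X k).
Proof.
move=> XL kI; split=> // e e0; exists [:: k], (fun=> 1); split; first by rewrite /= kI.
rewrite (_ : EFin \o _ = cst 0%E); last first.
  by apply/funext => w /=; rewrite big_seq1 mul1r subrr.
by rewrite Lnorm0// lte_fin.
Qed.

Lemma autocovarianceN X n : stationary P X ->
  autocovariance P X (- n) = autocovariance P X n.
Proof.
move=> [_ _ st]; rewrite /autocovariance -[RHS](st n (- n)) addrN /inner.
by congr (fine 'E_P[_]); apply/funext => w /=; rewrite mulrC.
Qed.

(** The residual is tested against the single generator [X (- m)]. Stationarity reduces every inner
    product to a lag, and evenness of the autocovariance allows absolute lags. *)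
Lemma normal_equations X (phi : nat -> nat -> R) : stationary P X ->
  finite_predictor_coefficients P X phi -> forall n m, (1 <= m <= n)%N ->
  autocovariance P X m%:Z =
  \sum_(1 <= j < n.+1) phi n j * autocovariance P X `|m%:Z - j%:Z|%N.
Proof.
move=> stX phiP n m /andP[m1 mn]; have [XL _ st] := stX.
have n0 : (0 < n)%N by exact: leq_trans mn.
have [_ orth] := phiP n n0.
have /orth : closed_span P X `[- n%:Z, - 1%:Z] (X (- m%:Z)).
  by apply: closed_span_self => //; rewrite in_itv/= !lerN2 !lez_nat mn m1.
rewrite inner_residual// => /eqP; rewrite subr_eq0 => /eqP.
have ac i j : inner P (X i) (X j) = autocovariance P X (i - j).
  by rewrite -(st (i - j) j) subrK.
rewrite ac sub0r opprK => ->; apply: eq_bigr => j _; rewrite ac opprK (addrC (- j%:Z)).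
congr (_ * _).
have [jm|/ltnW mj] := leqP j m.
  by rewrite abszE ger0_norm ?subr_ge0 ?lez_nat.
by rewrite abszE ler0_norm ?subr_le0 ?lez_nat ?(autocovarianceN _ stX).
Qed.

End NormalEquations.

(** * Translation of the hypotheses and the final assembly *)

Section Conclusion.
Context {R : realType}.

Lemma asymp_equiv_eqo (f g : nat -> R) : (exists N, forall n, (N <= n)%N -> 0 <= g n) ->
  (f : nat -> R^o) ~_\oo g -> asymp_equiv f g.
Proof.
move=> [N1 g0] fg e e0.
have [N2 _ fgP] := (eqaddoP _ _ _ _).1 fg _ e0.
exists (maxn N1 N2) => n; rewrite geq_max => /andP[/g0 gn /fgP] /=.
by rewrite (ger0_norm gn).
Qed.

Lemma nneseries_tail (b : nat -> R) n : abs_summable b ->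
  (\sum_(n.+1 <= k <oo) `|b k|%:E)%E = (tail b n)%:E.
Proof.
move=> sb; rewrite -nneseries_addn; last by move=> i; rewrite lee_fin.
have st : abs_summable (fun k => `|b (n.+1 + k)%N|).
  exact: abs_summable_norm (abs_summable_shift n.+1 sb).
rewrite -EFin_lim; last exact: abs_summable_cvgn.
congr (limn _); apply/funext => N /=.
by rewrite sumEFin; congr (_%:E); apply: eq_bigr => k _; rewrite addnC.
Qed.

Lemma abs_summable_bounded (b : nat -> R) : abs_summable b ->
  exists B, forall k, `|b k| <= B.
Proof.
move=> [B bB]; exists B => k; apply: le_trans (bB k.+1).
by rewrite big_nat_recr//= lerDr sumr_ge0.
Qed.

(** The strict upper bound is what makes the coupled system a contraction; it follows from cos(pi d)
    > 0. *)
Lemma sin_pi_range (d : R) : 0 < d < 1 / 2 -> 0 < sin (pi * d) < 1.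
Proof.
move=> /andP[d0 d1].
have pi0 := pi_gt0 R.
have x0 : 0 < pi * d by rewrite mulr_gt0.
have x1 : pi * d < pi / 2.
  by rewrite ltr_pM2l//; lra.
apply/andP; split; first by apply: sin_gt0_pi; rewrite ?x0//=; lra.
have c0 : 0 < cos (pi * d) by apply: cos_gt0_pihalf; lra.
have := cos2Dsin2 (pi * d).
have : sin (pi * d) <= 1 by exact: sin_le1.
rewrite le_eqVlt => /orP[/eqP ->|//].
by have := exprn_gt0 2 c0; lra.
Qed.

End Conclusion.

Theorem theorem4p1 (disp : measure_display) (T : measurableType disp)
    (R : realType) (P : probability T R)
    (X : int -> T -> R)
    (X_stationary : stationary P X)
    (X_pnd : purely_nondeterministic P X)
    (Delta : R -> R)
    (Delta_density : spectral_density (autocovariance P X) Delta)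
    (Delta_log : log_integrable Delta)
    (c a : nat -> R)
    (cP : MA_coefficients Delta c)
    (aP : AR_coefficients Delta a)
    (phi : nat -> nat -> R)
    (phiP : finite_predictor_coefficients P X phi)
    (d : R) (d_gt0 : 0 < d) (d_lt : d < 1 / 2)
    (l : R -> R) (l_sv : slowly_varying l)
    (c_asymp : (c : nat -> R^o) ~_\oo
       (fun n : nat => n%:R `^ (- (1 - d)) * l n%:R))
    (a_asymp : (a : nat -> R^o) ~_\oo
       (fun n : nat => n%:R `^ (- (1 + d)) * (1 / l n%:R) *
                       (d * sin (pi * d) / pi))) :
  exists M : R, 0 < M /\
    forall n : nat, (0 < n)%N ->
      ((\sum_(1 <= j < n.+1)
          `|phi n j - infinite_predictor_coefficient c a j|)%:E <=
        M%:E * \sum_(n.+1 <= k <oo) `|infinite_predictor_coefficient c a k|%:E)%E.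
Proof.
have d_range : 0 < d < 1 / 2 by rewrite d_gt0.
have sn_range := sin_pi_range d_range.
have /andP[sn_gt0 _] := sn_range.
have l_gt0 := slowly_varying_gt0 l_sv.
have l_potter := slowly_varying_potter l_sv.
have c_equiv : asymp_equiv c (fun n => n%:R `^ (- (1 - d)) * l n%:R).
  apply: asymp_equiv_eqo c_asymp; have [N lN] := l_gt0; exists N => n /lN ln.
  by rewrite mulr_ge0 ?powR_ge0 ?ltW.
have a_equiv : asymp_equiv a
    (fun n => n%:R `^ (- (1 + d)) * (l n%:R)^-1 * (d * sin (pi * d) / pi)).
  under [X in asymp_equiv _ X]eq_fun do rewrite -div1r.
  apply: asymp_equiv_eqo a_asymp; have [N lN] := l_gt0; exists N => n /lN ln.
  by rewrite !mulr_ge0 ?powR_ge0 ?invr_ge0 ?pi_ge0 ?ltW.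
have c2 := ma_square_abs_summable d_range l_gt0 l_potter c_equiv.
have sa := ar_abs_summable d_range sn_range l_gt0 l_potter a_equiv.
have [K [cK aK]] : exists K, (forall k, `|c k| <= K) /\ (forall k, `|a k| <= K).
  have [B1 c2B] := abs_summable_bounded c2; have [B2 aB] := abs_summable_bounded sa.
  (* [B1] bounds the squares of [c], hence the added 1: |c| <= c^2 + 1. *)
  exists (B1 + B2 + 1); split=> k.
    have := c2B k; have := aB k; have := normr_ge0 (a k).
    rewrite normrX; have := sqr_ge0 (`|c k| - 1); rewrite sqrrB1.
    have := normr_ge0 (c k); move: (`|c k|) (`|a k|) => x y; lra.
  have := c2B k; have := aB k; have := normr_ge0 (c k ^+ 2).
  by move: (`|c k ^+ 2|) (`|a k|) => x y; lra.
have conv_ac := MA_AR_convolution cP aP cK aK.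
have acovE := spectral_autocovariance Delta_density Delta_log cP cK c2.
have phi_normal n m : (1 <= m <= n)%N ->
    acov c m = \sum_(1 <= j < n.+1) phi n j * acov c `|m%:Z - j%:Z|%N.
  move=> mn; rewrite -acovE (normal_equations X_stationary phiP mn).
  by apply: eq_bigr => j _; rewrite acovE.
have [M M0 MP] := baxter_of_normal_equations d_range sn_range l_gt0 l_potter
  c_equiv a_equiv conv_ac phi_normal.
exists M; split=> // n n0.
rewrite (nneseries_tail n (abs_summableZ (c 0%N) sa)) -EFinM lee_fin.
exact: MP.
Qed.
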